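(* Let $m\ge1$ be an integer, let $p_i(\cdot)\in LH\cap\mathcal P$ for $i=1,\dots,m$, put $\frac1{p(\cdot)}=\sum_{i=1}^m\frac1{p_i(\cdot)}$, let $\alpha$ be a constant and $q(\cdot)\in\mathcal P_0$ an exponent with $\frac{\alpha}{n}=\frac1{p(\cdot)}-\frac1{q(\cdot)}\in[0,m)$, and let $\vec\omega=(\omega_1,\dots,\omega_m)$ be a multiple weight with $\omega:=\prod_{i=1}^m\omega_i$. Then $\mathscr M_\alpha$ is bounded from $L^{p_1(\cdot)}(\omega_1)\times\cdots\times L^{p_m(\cdot)}(\omega_m)$ to $L^{q(\cdot)}(\omega)$ if and only if $\vec\omega\in A_{\vec p(\cdot),q(\cdot)}$.
   Context: Exponents: for a measurable $p:\mathbb R^n\to(0,\infty)$ put $p_-=\operatorname{ess\,inf}p$, $p_+=\operatorname{ess\,sup}p$. $\mathcal P$ is the set of measurable $p(\cdot)$ with $1<p_-\le p_+<\infty$; $\mathcal P_0$ the set of measurable $p(\cdot)$ with $0<p_-\le p_+<\infty$. The conjugate exponent is $p'(\cdot)=p(\cdot)/(p(\cdot)-1)$. $p(\cdot)\in LH$ (globally log-Hölder continuous) means there are $C>0$ and $p_\infty>0$ with $|p(x)-p(y)|\le\frac{C}{-\log|x-y|}$ whenever $|x-y|<\frac12$, and $|p(x)-p_\infty|\le\frac{C}{\log(e+|x|)}$ for all $x\in\mathbb R^n$. Spaces: for $p(\cdot)\in\mathcal P_0$, $\|f\|_{L^{p(\cdot)}}=\inf\{\lambda>0:\int_{\mathbb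 R^n}(|f(x)|/\lambda)^{p(x)}dx\le1\}$, and $\|f\|_{L^{p(\cdot)}(\omega)}=\|\omega f\|_{L^{p(\cdot)}}$. A weight is a locally integrable $\omega:\mathbb R^n\to[0,\infty]$ with $0<\omega<\infty$ a.e.; a multiple weight is an $m$-tuple of weights. $\vec\omega\in A_{\vec p(\cdot),q(\cdot)}$ means $$[\vec\omega]_{A_{\vec p(\cdot),q(\cdot)}}:=\sup_{B\subseteq\mathbb R^n}|B|^{\frac{\alpha}{n}-m}\|\omega\chi_B\|_{L^{q(\cdot)}}\prod_{i=1}^m\|\omega_i^{-1}\chi_B\|_{L^{p_i'(\cdot)}}<\infty,$$ the supremum being over all balls $B$. The multilinear fractional maximal operator is $$\mathscr M_\alpha(\vec f)(x)=\sup_{r>0}\frac1{|B(x,r)|^{m-\frac{\alpha}{n}}}\prod_{i=1}^m\int_{B(x,r)}|f_i(y_i)|\,dy_i.$$ Bounded means: there is $C$ with $\|\mathscr M_\alpha(\vec f)\|_{L^{q(\cdot)}(\omega)}\le C\prod_{i=1}^m\|f_i\|_{L^{p_i(\cdot)}(\omega_i)}$ for all $f_i\in L^{p_i(\cdot)}(\omega_i)$. *)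

(* Defs.v *)
From HB Require Import structures.
From mathcomp Require Import all_boot all_order all_algebra.
From mathcomp Require Import all_classical all_reals all_analysis.
From mathcomp Require Import measurable_realfun ess_sup_inf.
Set Implicit Arguments.
Unset Strict Implicit.
Unset Printing Implicit Defensive.
Import Order.TTheory GRing.Theory Num.Theory.
Import numFieldNormedType.Exports.
Local Open Scope classical_set_scope.
Local Open Scope ring_scope.

(** [borelRn R n] is ['rV[R]_n] with the product (i.e. Borel) sigma-algebra,
    [borel_lebesgue R n] is the n-fold product of the Lebesgue measure of the
    line, and [lebesgueRn R n] is its completion, a measure on [Rn R n], which
    is ['rV[R]_n] with the sigma-algebra of Lebesgue measurable sets. *)
Definition borelRn (R : realType) (n : nat) : Type := 'rV[R]_n.

Definition borelRn_display : measure_display.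
Proof. exact: default_measure_display. Qed.

Section borelRn_measurable.
Variables (R : realType) (n : nat).

Definition coordRn (i : 'I_n) (x : borelRn R n) : measurableTypeR R :=
  (x : 'rV[R]_n) ord0 i.

Let borelRn_set0 : g_sigma_preimage coordRn set0.
Proof. exact: sigma_algebra0. Qed.

Let borelRn_setC A :
  g_sigma_preimage coordRn A -> g_sigma_preimage coordRn (~` A).
Proof. exact: sigma_algebraC. Qed.

Let borelRn_bigcup (F : _^nat) : (forall i, g_sigma_preimage coordRn (F i)) ->
  g_sigma_preimage coordRn (\bigcup_i (F i)).
Proof. exact: sigma_algebra_bigcup. Qed.

HB.instance Definition _ := Pointed.copy (borelRn R n) 'rV[R]_n.
HB.instance Definition _ := @isMeasurable.Build borelRn_display
  (borelRn R n) (g_sigma_preimage coordRn) borelRn_set0 borelRn_setC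
  borelRn_bigcup.

Lemma measurable_coordRn (i : 'I_n) : measurable_fun [set: borelRn R n] (coordRn i).
Proof.
move=> _ Y mY; rewrite setTI; apply: sub_sigma_algebra => /=.
rewrite -bigcup_seq/=; exists i => /=; first by rewrite mem_index_enum.
by exists Y => //; rewrite setTI.
Qed.

Lemma measurable_fun_coordRnP d (T : measurableType d) (f : T -> borelRn R n) :
  (forall i, measurable_fun [set: T] (coordRn i \o f)) ->
  measurable_fun [set: T] f.
Proof.
move=> mf.
suff : g_sigma_preimage (fun i => coordRn i \o f) `<=` measurable.
  rewrite g_sigma_preimage_comp => H _ A mA; apply: H; exists A => //.
apply: smallest_sub; first exact: sigma_algebra_measurable.
rewrite -bigcup_seq; apply: bigcup_sub => i _ A [B mB <-].
exact: mf.
Qed.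

End borelRn_measurable.

Definition consRn (R : realType) (n : nat)
    (p : borelRn R n * measurableTypeR R) : borelRn R n.+1 :=
  \row_(i < n.+1) (if unlift ord0 i is Some j then coordRn j p.1 else p.2 : R).

Lemma coordRn0 (R : realType) (n : nat) p :
  coordRn ord0 (@consRn R n p) = p.2.
Proof. by rewrite /coordRn mxE unlift_none. Qed.

Lemma coordRn_lift (R : realType) (n : nat) j p :
  coordRn (lift ord0 j) (@consRn R n p) = coordRn j p.1.
Proof. by rewrite /coordRn mxE liftK. Qed.

Lemma measurable_consRn (R : realType) (n : nat) :
  measurable_fun [set: borelRn R n * measurableTypeR R] (@consRn R n).
Proof.
apply: measurable_fun_coordRnP => i.
have [j ->|->] := unliftP ord0 i.
  rewrite (_ : _ \o _ = (@coordRn R n j) \o fst).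
    by apply: measurableT_comp => //; exact: measurable_coordRn.
  by apply/funext => p /=; rewrite coordRn_lift.
rewrite (_ : _ \o _ = snd) //.
by apply/funext => p /=; rewrite coordRn0.
Qed.

Section borel_lebesgue_step.
Variables (R : realType) (n : nat) (mu : {measure set (borelRn R n) -> \bar R}).

Definition borel_lebesgue_step : set (borelRn R n.+1) -> \bar R :=
  pushforward (mu \x lebesgue_measure)%E (@consRn R n).

Let borel_lebesgue_step0 : borel_lebesgue_step set0 = 0.
Proof. apply: measure0; exact: measurable_consRn. Qed.

Let borel_lebesgue_step_ge0 A : (0 <= borel_lebesgue_step A)%E.
Proof. by apply: measure_ge0; exact: measurable_consRn. Qed.

Let borel_lebesgue_step_sigma_additive : semi_sigma_additive borel_lebesgue_step.
Proof.
apply: measure_semi_sigma_additive; exact: measurable_consRn.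
Qed.

HB.instance Definition _ := isMeasure.Build _ _ _ borel_lebesgue_step
  borel_lebesgue_step0 borel_lebesgue_step_ge0
  borel_lebesgue_step_sigma_additive.

End borel_lebesgue_step.

Fixpoint borel_lebesgue (R : realType) (n : nat) :
    {measure set (borelRn R n) -> \bar R} :=
  match n with
  | 0 => dirac ((0 : 'rV[R]_0) : borelRn R 0)
  | n.+1 => borel_lebesgue_step (borel_lebesgue R n)
  end.

Definition Rn (R : realType) (n : nat) : Type :=
  caratheodory_type (borel_lebesgue R n)^*%mu.

HB.instance Definition _ (R : realType) (n : nat) :=
  Measurable.copy (Rn R n) (caratheodory_type (borel_lebesgue R n)^*%mu).

Definition lebesgueRn (R : realType) (n : nat) :
    {measure set (Rn R n) -> \bar R} :=
  @completed_measure_extension _ _ _ (borel_lebesgue R n).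

Lemma lebesgueRn_prod (R : realType) (n : nat)
    (A : 'I_n -> set (measurableTypeR R)) :
  (forall i, measurable (A i)) ->
  lebesgueRn R n [set x | forall i, A i (coordRn i x)] =
  (\prod_(i < n) lebesgue_measure (A i))%E.
Proof.
have mbox k (B : 'I_k -> set (measurableTypeR R)) :
    (forall i, measurable (B i)) ->
    measurable [set x : borelRn R k | forall i, B i (coordRn i x)].
  move=> mB.
  rewrite (_ : [set x | _] = \bigcap_(i in [set: 'I_k]) (coordRn i @^-1` B i)).
    apply: fin_bigcap_measurable; first exact: finite_finset.
    move=> i _; rewrite -[X in measurable X]setTI.
    exact: measurable_coordRn.
  by apply/seteqP; split=> [x Bx i _|x Bx i]; [exact: Bx|exact: (Bx i)].
move=> mA; rewrite /lebesgueRn /= /completed_measure_extension.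
rewrite measurable_mu_extE; last exact: mbox.
elim: n A mA => [|n IH] A mA.
  rewrite big_ord0 /= diracE mem_set//= => -[]//.
rewrite big_ord_recl /= /borel_lebesgue_step /pushforward.
rewrite (_ : _ @^-1` _ =
    [set x | forall i, A (lift ord0 i) (coordRn i x)] `*` A ord0).
  rewrite product_measure1E//; last exact: (mbox n (fun i => A (lift ord0 i))).
  rewrite muleC; congr (_ * _)%E.
  exact: (IH (fun i => A (lift ord0 i))).
apply/seteqP; split => [p /= Ap|p /= [Ap A0] i].
  split=> [i|]; first by have := Ap (lift ord0 i); rewrite coordRn_lift.
  by have := Ap ord0; rewrite coordRn0.
have [j ->|->] := unliftP ord0 i; first by rewrite coordRn_lift.
by rewrite coordRn0.
Qed.

Section exponents.
Variables (R : realType) (n : nat).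
Implicit Types p q : Rn R n -> R.

(** The library's norm on ['rV[R]_n] is the sup norm. *)
Definition enorm (x : 'rV[R]_n) : R := Num.sqrt (\sum_i x ord0 i ^+ 2).

Definition eball (x : Rn R n) (r : R) : set (Rn R n) :=
  [set y | enorm ((y : 'rV[R]_n) - (x : 'rV[R]_n)) < r].

Definition exponent p := measurable_fun [set: Rn R n] p /\ forall x, 0 < p x.

Definition exponentP p := [/\ exponent p,
  (1 < ess_inf (lebesgueRn R n) (EFin \o p))%E &
  (ess_sup (lebesgueRn R n) (EFin \o p) < +oo)%E].

Definition exponentP0 p := [/\ exponent p,
  (0 < ess_inf (lebesgueRn R n) (EFin \o p))%E &
  (ess_sup (lebesgueRn R n) (EFin \o p) < +oo)%E].

Definition conj_exponent p : Rn R n -> R := fun x => p x / (p x - 1).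

(** At [x = y] the first bound reads [0 <= C / (- ln 0) = C / 0 = 0], which is
    consistent with the limit value of [1 / (- ln t)] as [t] tends to [0]. *)
Definition log_holder p := exists C pinf : R, [/\ 0 < C, 0 < pinf,
  (forall x y : 'rV[R]_n, enorm (x - y) < 2^-1 ->
    `|p x - p y| <= C / (- ln (enorm (x - y)))) &
  (forall x : 'rV[R]_n, `|p x - pinf| <= C / ln (expR 1 + enorm x))].

Definition harmonic_exponent m (p : 'I_m -> Rn R n -> R) : Rn R n -> R :=
  fun x => (\sum_(i < m) (p i x)^-1)^-1.

End exponents.

Section weighted_spaces.
Variables (R : realType) (n : nat).
Local Notation mu := (lebesgueRn R n).
Implicit Types (p q : Rn R n -> R) (f w : Rn R n -> \bar R).
Local Open Scope ereal_scope.

Definition varnorm p f : \bar R :=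
  ereal_inf [set l%:E | l in [set l : R | (0 < l)%R /\
    \int[mu]_x (`|f x| * (l^-1)%:E) `^ (p x) <= 1]].

Definition wnorm p w f : \bar R := varnorm p (fun x => w x * f x).

Definition wLp p w : set (Rn R n -> \bar R) :=
  [set f : Rn R n -> \bar R | measurable_fun [set: Rn R n] f /\ wnorm p w f < +oo].

Definition weight w := [/\ measurable_fun [set: Rn R n] w,
  (forall x, 0 <= w x),
  (forall K : set 'rV[R]_n, compact K ->
    \int[mu]_(x in (K : set (Rn R n))) w x < +oo) &
  {ae mu, forall x, 0 < w x < +oo}].

End weighted_spaces.

Section multilinear.
Variables (R : realType) (n m : nat).
Local Notation mu := (lebesgueRn R n).
Implicit Types (p : 'I_m -> Rn R n -> R) (q : Rn R n -> R) (alpha : R).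
Implicit Types (f w : 'I_m -> Rn R n -> \bar R).
Local Open Scope ereal_scope.

Definition frac_maximal alpha f (x : Rn R n) : \bar R :=
  ereal_sup [set (mu (eball x r) `^ (m%:R - alpha / n%:R))^-1 *
                 \prod_(i < m) \int[mu]_(y in eball x r) `|f i y|
            | r in [set r : R | (0 < r)%R]].

Definition prod_weight w : Rn R n -> \bar R := fun x => \prod_(i < m) w i x.

Definition frac_maximal_bounded alpha p q w := exists C : R,
  forall f, (forall i, wLp (p i) (w i) (f i)) ->
    wnorm q (prod_weight w) (frac_maximal alpha f) <=
    C%:E * \prod_(i < m) wnorm (p i) (w i) (f i).

(** [0 * +oo = 0] and [0^-1 = +oo] in [\bar R]: the functions below vanish off the
    ball whatever the values of the weights there. *)
Definition Apq_const alpha p q w : \bar R :=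
  ereal_sup [set mu (eball b.1 b.2) `^ (alpha / n%:R - m%:R) *
      varnorm q (fun x => prod_weight w x * (\1_(eball b.1 b.2) x)%:E) *
      \prod_(i < m) varnorm (conj_exponent (p i))
        (fun x => (w i x)^-1 * (\1_(eball b.1 b.2) x)%:E)
    | b in [set b : Rn R n * R | (0 < b.2)%R]].

Definition Apq alpha p q w := Apq_const alpha p q w < +oo.

End multilinear.

(* Main.v *)
Require Import Defs.
From HB Require Import structures.
From mathcomp Require Import all_boot all_order all_algebra.
From mathcomp Require Import all_classical all_reals all_analysis.
From mathcomp Require Import measurable_realfun ess_sup_inf ring lra zify.
Set Implicit Arguments.
Unset Strict Implicit.
Unset Printing Implicit Defensive.
Import Order.TTheory GRing.Theory Num.Theory.
Import numFieldNormedType.Exports.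
Import HBNNSimple.
Local Open Scope classical_set_scope.
Local Open Scope ring_scope.

(** Put v_i = 1/w_i and gamma = m - alpha/n, so that 1/q + sum_i 1/p_i' is the
    constant gamma.

    Necessity is duality: on a ball B one tests the operator with the functions
    which are extremal for the norms of the v_i chi_B.

    Sufficiency. By the generalized Hoelder inequality, the A_{p,q} condition
    forces each of the m+1 norms N_k(E), of w chi_E and of the v_i chi_E, to satisfy
    (|E|/|B|)^gamma N_k(B) <= C N_k(E) for E in B. Hence each norm grows and decays
    at most polynomially, grows at least like a power on large cubes, and its
    modular has polynomial growth. By the one-third trick it is enough to
    consider finite families of dyadic cubes. For a family of stopping cubes Q
    of the averages |Q|^(-gamma) prod_i int_Q f_i, these averages are at most
    C prod_i b_i(Q) / N_0(Q) with b_i(Q) = int_Q |f_i| / (2 N_i(Q)) <= 1, and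
    (prod_i b_i)^q <= (prod_i b_i)^p <= sum_i b_i^(p_i) pointwise, which decouples the
    functions: it remains to bound the sum of the b_i(Q)^(p_i(Q)) over the stopping
    cubes for each i separately, p_i(Q) being a value at which log-Hoelder
    continuity allows one to freeze p_i on Q. On each Q the function is split
    according to its size: the parts that are very small or very large, or live
    close to the origin with respect to the size of Q, are summable thanks to the
    polynomial bounds, and on the remaining part Jensen's inequality reduces the
    claim to the Carleson embedding theorem for the measure v_i^(p_i'). *)

(** * Integrals of nonnegative functions *)

Section nonmeasurable_integral.
Context d (T : measurableType d) (R : realType) (mu : {measure set T -> \bar R}).
Local Open Scope ereal_scope.

(* The library's [ge0_le_integral] asks for measurability, but the integral
   of a nonnegative function is a supremum over the simple functions below it. *)
Lemma le_integral_ge0 (D : set T) (f g : T -> \bar R) :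
  (forall x, D x -> 0 <= f x) -> (forall x, D x -> f x <= g x) ->
  \int[mu]_(x in D) f x <= \int[mu]_(x in D) g x.
Proof.
move=> f0 fg.
rewrite !ge0_integralE//; last by move=> x Dx; exact: le_trans (f0 _ Dx) (fg _ Dx).
apply: ereal_sup_le => _ [h hf <-]; exists h => // x; apply: le_trans (hf x) _.
by rewrite /patch; case: ifPn => // /set_mem; exact: fg.
Qed.

End nonmeasurable_integral.

Section nnfun.
Context d (T : measurableType d) (R : realType).

Definition nnmfun (f : T -> R) := measurable_fun setT f /\ forall x, 0 <= f x.

Lemma nnmfun_ge0 f x : nnmfun f -> 0 <= f x. Proof. by case. Qed.

Lemma nnmfun_measurable f : nnmfun f -> measurable_fun setT f.
Proof. by case. Qed.

Lemma nnmfun_cst (c : R) : 0 <= c -> nnmfun (fun=> c).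
Proof. by split. Qed.

Lemma nnmfunD f g : nnmfun f -> nnmfun g -> nnmfun (fun x => f x + g x).
Proof.
by move=> [mf f0] [mg g0]; split => [|x]; [exact: measurable_funD|exact: addr_ge0].
Qed.

Lemma nnmfunM f g : nnmfun f -> nnmfun g -> nnmfun (fun x => f x * g x).
Proof.
by move=> [mf f0] [mg g0]; split => [|x]; [exact: measurable_funM|exact: mulr_ge0].
Qed.

Lemma nnmfunZ c f : 0 <= c -> nnmfun f -> nnmfun (fun x => c * f x).
Proof. by move=> c0 nf; apply: nnmfunM => //; exact: nnmfun_cst. Qed.

Lemma nnmfun_sum (I : Type) (s : seq I) (P : pred I) (f : I -> T -> R) :
  (forall i, P i -> nnmfun (f i)) -> nnmfun (fun x => \sum_(i <- s | P i) f i x).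
Proof.
move=> nf; under eq_fun do rewrite big_mkcond.
elim: s => [|i s ih].
  by under eq_fun do rewrite big_nil; exact: nnmfun_cst.
under eq_fun do rewrite big_cons.
by apply: nnmfunD => //; have := nf i; case: (P i) => [/(_ isT)//|_]; exact: nnmfun_cst.
Qed.

Lemma nnmfun_prod (I : Type) (s : seq I) (P : pred I) (f : I -> T -> R) :
  (forall i, P i -> nnmfun (f i)) -> nnmfun (fun x => \prod_(i <- s | P i) f i x).
Proof.
move=> nf; under eq_fun do rewrite big_mkcond.
elim: s => [|i s ih].
  by under eq_fun do rewrite big_nil; exact: nnmfun_cst.
under eq_fun do rewrite big_cons.
by apply: nnmfunM => //; have := nf i; case: (P i) => [/(_ isT)//|_]; exact: nnmfun_cst.
Qed.

Lemma nnmfun_powR f (p : T -> R) :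
  nnmfun f -> measurable_fun setT p -> nnmfun (fun x => f x `^ p x).
Proof.
move=> [mf f0] mp; split => [|x]; last exact: powR_ge0.
rewrite /powR; apply: measurable_fun_ifT => /=.
- by apply: measurable_fun_eqr.
- rewrite (_ : (fun _ => _) = fun t => if p t == 0 then 1 else 0).
    by apply: measurable_fun_ifT => //; exact: measurable_fun_eqr.
  by apply/funext => t; case: ifP.
- apply: measurableT_comp => //; apply: measurable_funM => //.
  by apply: measurableT_comp.
Qed.

Lemma nnmfun_indic (D : set T) : measurable D -> nnmfun (\1_D : T -> R).
Proof. by move=> mD; split => [|x]; [exact: measurable_indic|rewrite indicE]. Qed.

End nnfun.

Section nnint.
Context d (T : measurableType d) (R : realType) (mu : {measure set T -> \bar R}).
Local Notation "''I_(' D ) f" := (\int[mu]_(x in D) (f x)%:E)%E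
  (at level 10, D at level 100, f at level 9).
Implicit Types (f g : T -> R) (D : set T).

Lemma nnint_ge0 D f : (forall x, 0 <= f x) -> (0 <= \int[mu]_(x in D) (f x)%:E)%E.
Proof. by move=> f0; apply: integral_ge0 => x _; rewrite lee_fin. Qed.

Lemma nnint_le D f g : (forall x, 0 <= f x) -> (forall x, D x -> f x <= g x) ->
  (\int[mu]_(x in D) (f x)%:E <= \int[mu]_(x in D) (g x)%:E)%E.
Proof.
move=> f0 fg; apply: le_integral_ge0 => x Dx; rewrite lee_fin//; exact: fg.
Qed.

Lemma nnmfun_EFin D f : nnmfun f -> measurable_fun D (fun x => (f x)%:E).
Proof.
move=> [mf _]; apply/measurable_EFinP; apply: measurable_funS mf => //.
Qed.

Lemma nnint_subset D D' f : measurable D -> measurable D' -> nnmfun f ->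
  D `<=` D' -> (\int[mu]_(x in D) (f x)%:E <= \int[mu]_(x in D') (f x)%:E)%E.
Proof.
move=> mD mD' nf DD'; apply: ge0_subset_integral => //.
- exact: nnmfun_EFin.
- by move=> x _; rewrite lee_fin nnmfun_ge0.
Qed.

Lemma nnintZ D c f : measurable D -> 0 <= c -> nnmfun f ->
  (\int[mu]_(x in D) (c * f x)%:E = c%:E * \int[mu]_(x in D) (f x)%:E)%E.
Proof.
move=> mD c0 nf; under eq_integral do rewrite EFinM.
rewrite ge0_integralZl_EFin//; last exact: nnmfun_EFin.
by move=> x _; rewrite lee_fin nnmfun_ge0.
Qed.

Lemma nnintD D f g : measurable D -> nnmfun f -> nnmfun g ->
  (\int[mu]_(x in D) (f x + g x)%:E =
   \int[mu]_(x in D) (f x)%:E + \int[mu]_(x in D) (g x)%:E)%E.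
Proof.
move=> mD nf ng; under eq_integral do rewrite EFinD.
by rewrite ge0_integralD//; try exact: nnmfun_EFin;
  move=> x _; rewrite lee_fin nnmfun_ge0.
Qed.

Lemma nnint_sum (I : Type) (s : seq I) (P : pred I) D (f : I -> T -> R) :
  measurable D -> (forall i, P i -> nnmfun (f i)) ->
  (\int[mu]_(x in D) (\sum_(i <- s | P i) f i x)%:E =
   \sum_(i <- s | P i) \int[mu]_(x in D) (f i x)%:E)%E.
Proof.
move=> mD nf; elim: s => [|i s ih].
  by under eq_integral do rewrite big_nil; rewrite big_nil integral0.
rewrite big_cons; under eq_integral do rewrite big_cons.
case: (boolP (P i)) => // Pi; rewrite -ih -nnintD//; first exact: nf.
exact: nnmfun_sum.
Qed.

Lemma nnint_mkcond D f :
  (\int[mu]_(x in D) (f x)%:E = \int[mu]_x (f x * \1_D x)%:E)%E.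
Proof.
rewrite integral_mkcond; apply: eq_integral => x _.
by rewrite /patch indicE; case: (x \in D); rewrite ?mulr1 ?mulr0.
Qed.

Lemma nnint_sum_le (I : finType) (P : pred I) (D : I -> set T) (E : set T)
    (f : I -> T -> R) g :
  (forall i, measurable (D i)) -> measurable E -> (forall i, P i -> nnmfun (f i)) ->
  (forall i, P i -> D i `<=` E) ->
  (forall x, E x -> \sum_(i | P i && `[< D i x >]) f i x <= g x) ->
  (\sum_(i | P i) \int[mu]_(x in D i) (f i x)%:E <= \int[mu]_(x in E) (g x)%:E)%E.
Proof.
move=> mD mE nf DE fg.
have nfD i : P i -> nnmfun (fun x => f i x * \1_(D i) x).
  by move=> Pi; apply: nnmfunM; [exact: nf|exact: nnmfun_indic].
rewrite (eq_bigr (fun i => \int[mu]_(x in E) (f i x * \1_(D i) x)%:E)%E); last first.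
  move=> i Pi; rewrite nnint_mkcond [RHS]nnint_mkcond; apply: eq_integral => x _.
  rewrite -mulrA; congr (_ * _)%:E; rewrite !indicE -natrM mulnb.
  by case: (boolP (x \in D i)) => // /set_mem/(DE _ Pi)/mem_set ->.
rewrite -nnint_sum//; apply: nnint_le.
  by move=> x; apply: sumr_ge0 => i Pi; exact: nnmfun_ge0 (nfD i Pi).
move=> x Ex; apply: le_trans (fg x Ex); rewrite big_mkcondr/=.
apply: ler_sum => i Pi; rewrite indicE.
case: ifPn => /asboolP h; first by rewrite mem_set// mulr1.
by rewrite memNset// mulr0.
Qed.

Lemma le_EFin_fine (x : \bar R) (C : R) : (0 <= x)%E -> (x <= C%:E)%E ->
  exists2 r, x = r%:E & 0 <= r <= C.
Proof.
case: x => [r| |]//; rewrite ?lee_fin => r0 rC; exists r => //; exact/andP.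
Qed.

End nnint.

Section ae_integral.
Context d (T : measurableType d) (R : realType) (mu : {measure set T -> \bar R}).

(** Made for the maximal function, whose measurability is never established. A simple function below
    [f] is cut off on the measurable null set [N]: its integral does not change, and it is then
    below [g] everywhere. *)
Lemma ae_le_integral (f g : T -> \bar R) :
  (forall x, 0 <= f x)%E -> (forall x, 0 <= g x)%E ->
  {ae mu, forall x, f x <= g x}%E -> (\int[mu]_x f x <= \int[mu]_x g x)%E.
Proof.
move=> f0 g0 [N [mN N0 sub]]; rewrite [leLHS]ge0_integralTE//.
apply: ge_ereal_sup => _ [h hf <-]; rewrite -integralT_nnsfun.
have nh : nnmfun (fun x => h x * \1_(~` N) x).
  by apply: nnmfunM; [split|apply: nnmfun_indic; exact: measurableC].
apply: (@le_trans _ _ (\int[mu]_x (h x * \1_(~` N) x)%:E)%E).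
  rewrite le_eqVlt; apply/orP; left; apply/eqP; apply: ge0_ae_eq_integral => //.
  - exact/measurable_EFinP.
  - exact: nnmfun_EFin nh.
  - by move=> x _; rewrite lee_fin.
  - by move=> x _; rewrite lee_fin (nnmfun_ge0 x nh).
  exists N; split => // x /= hx; apply: contrapT => Nx; apply: hx => _.
  by rewrite indicE mem_set// mulr1.
apply: le_integral_ge0 => x _; first by rewrite lee_fin (nnmfun_ge0 x nh).
rewrite indicE; case: (boolP (x \in _)) => [/set_mem/= Nx|_]; last by rewrite mulr0.
rewrite mulr1; apply: le_trans (hf x) _; apply: contrapT => h1; apply: Nx; exact: sub.
Qed.

Lemma ae_eq_integral_ge0 (f g : T -> \bar R) :
  (forall x, 0 <= f x)%E -> (forall x, 0 <= g x)%E ->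
  {ae mu, forall x, f x = g x} -> (\int[mu]_x f x = \int[mu]_x g x)%E.
Proof.
move=> f0 g0 fg; apply/eqP; rewrite eq_le !ae_le_integral//.
  by apply: filterS fg => x ->.
by apply: filterS fg => x ->.
Qed.

End ae_integral.

(** * Laminar families and the Carleson embedding *)

Lemma absz_sub_inj (a b c : int) : a <= c -> b <= c ->
  `|c - a|%N = `|c - b|%N -> a = b.
Proof. lia. Qed.

Section geometric.
Context {R : realType} (I : finType).

Lemma sum_geometric_inj (A : pred I) (h : I -> nat) (x : R) :
  0 <= x < 1 -> {in A &, injective h} ->
  \sum_(i | A i) x ^+ h i <= (1 - x)^-1.
Proof.
move=> /andP[x0 x1] inj; pose M := (\max_i h i).+1.
have hM i : (h i < M)%N by rewrite ltnS; exact: leq_bigmax.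
rewrite (partition_big (fun i => Ordinal (hM i)) predT)//=.
apply: (@le_trans _ _ (\sum_(k < M) x ^+ k)).
  apply: ler_sum => k _.
  rewrite (eq_bigr (fun=> x ^+ k)); last by move=> i /andP[_ /eqP <-].
  rewrite big_const iter_addr_0 -mulr_natr ler_piMr ?exprn_ge0//.
  rewrite -[leRHS]/1%:R ler_nat; apply/card_le1_eqP => i j.
  rewrite !unfold_in => /andP[Ai /eqP hi] /andP[Aj /eqP hj].
  by apply: inj => //; rewrite -[h i]/(val (Ordinal (hM i))) hi -hj.
rewrite -[leRHS]mul1r ler_pdivlMr ?subr_gt0//.
rewrite mulrC -opprB mulNr -subrX1 opprB.
by rewrite gerBl exprn_ge0.
Qed.

Lemma sum_geometric_int (A : pred I) (g : I -> int) (x : R) :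
  0 <= x < 1 -> {in A &, injective g} ->
  \sum_(i | A i) x ^+ `|g i|%N <= 2 / (1 - x).
Proof.
move=> x01 inj; rewrite (bigID (fun i => 0 <= g i))/= mulrDl mul1r.
apply: lerD; apply: (sum_geometric_inj (h := fun i => `|g i|%N)) => // i j.
  rewrite !unfold_in => /andP[Ai gi] /andP[Aj gj] h; apply: inj => //.
  by rewrite -(gez0_abs gi) -(gez0_abs gj) h.
rewrite !unfold_in -!ltNge => /andP[Ai gi] /andP[Aj gj] h; apply: inj => //.
by apply: oppr_inj; rewrite -!ltz0_abs// h.
Qed.

Lemma sum_le_atmost1 (A : pred I) (c : I -> R) (B : R) :
  0 <= B -> (forall i, A i -> c i <= B) -> {in A &, forall i j, i = j} ->
  \sum_(i | A i) c i <= B.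
Proof.
move=> B0 cB A1; have [i Ai|A0] := pickP A; last by rewrite big_pred0.
rewrite (big_pred1 i) ?cB// => j; apply/idP/eqP => [Aj|->//].
exact: A1.
Qed.
End geometric.

Section level.
Context {R : realType}.
Implicit Types a x y : R.

Definition lev a x : int := Num.floor (ln x / ln a).

Lemma lev_le a x : 1 < a -> 0 < x -> a `^ (lev a x)%:~R <= x.
Proof.
move=> a1 x0; have lna : 0 < ln a by rewrite ln_gt0.
rewrite -ler_ln ?posrE ?powR_gt0 ?(lt_trans _ a1)// ln_powR -ler_pdivlMr//.
exact: floor_le.
Qed.

Lemma lev_gt a x : 1 < a -> 0 < x -> x < a `^ ((lev a x)%:~R + 1).
Proof.
move=> a1 x0; have lna : 0 < ln a by rewrite ln_gt0.
rewrite -ltr_ln ?posrE ?powR_gt0 ?(lt_trans _ a1)// ln_powR -ltr_pdivrMr//.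
by have := floorD1_gt (ln x / ln a); rewrite intrD.
Qed.

(** A gap of two levels is required, since values in adjacent levels may be arbitrarily close to
    each other. *)
Lemma lev_lt a x y : 1 < a -> 0 < x -> 0 < y -> lev a x + 1 < lev a y -> a * x < y.
Proof.
move=> a1 x0 y0 h; have a0 : 0 < a by apply: lt_trans a1.
apply: lt_le_trans (lev_le a1 y0).
apply: (@lt_le_trans _ _ (a * a `^ ((lev a x)%:~R + 1))).
  by rewrite ltr_pM2l// lev_gt.
rewrite -{1}(powRr1 (ltW a0)) -powRD ?(gt_eqF a0) ?implybT//.
rewrite ler_powR ?(ltW a1)//.
by have : ((lev a x + 1 + 1)%:~R <= (lev a y)%:~R :> R);
  [rewrite ler_int; lia|rewrite !intrD; lra].
Qed.
End level.

Section laminar.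
Context d (T : measurableType d) (R : realType) (mu : {measure set T -> \bar R}).
Variables (I : finType) (Q : I -> set T) (gen : I -> int).

(** The equality clause makes [gen] injective on the members containing a given point; geometric
    sums over them rest on this. *)
Definition laminar := forall i j, Q i `&` Q j !=set0 -> gen i <= gen j ->
  Q i `<=` Q j /\ (gen i = gen j -> i = j).

Hypothesis lam : laminar.
Hypothesis mQ : forall i, measurable (Q i).

(** Members that meet are nested in the order of [gen], so maximality for inclusion can be tested on
    generations. *)
Definition maxQ (P : pred I) : pred I := fun i =>
  P i && [forall j, P j && (gen i < gen j) ==> ~~ `[< Q i `&` Q j !=set0 >]].

Lemma maxQ_sub P i : maxQ P i -> P i. Proof. by case/andP. Qed.

Lemma maxQ_max P i j x : maxQ P i -> P j -> Q i x -> Q j x -> gen j <= gen i.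
Proof.
move=> /andP[Pi /forallP/(_ j)] + Pj Qi Qj; rewrite Pj/= => /implyP h.
by rewrite leNgt; apply/negP => /h/negP; apply; apply/asboolP; exists x.
Qed.

Lemma maxQ_disjoint P i j x : maxQ P i -> maxQ P j -> Q i x -> Q j x -> i = j.
Proof.
move=> mi mj Qi Qj.
have gij : gen i = gen j.
  apply/eqP; rewrite eq_le; apply/andP; split.
    by apply: maxQ_max mj _ Qj Qi; exact: maxQ_sub mi.
  by apply: maxQ_max mi _ Qi Qj; exact: maxQ_sub mj.
have ne : Q i `&` Q j !=set0 by exists x.
by have [//|_ ->//] := lam ne; rewrite gij.
Qed.

Lemma maxQ_cover (P : pred I) i x : P i -> Q i x -> exists2 j, maxQ P j & Q j x.
Proof.
move=> Pi Qi.
have PQi : P i && `[< Q i x >] by rewrite Pi/=; exact/asboolP.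
have [j /andP[Pj /asboolP Qj] jmax] := @Order.TotalTheory.arg_maxP _ _ _ i
  (fun i => P i && `[< Q i x >]) gen PQi.
exists j => //; rewrite /maxQ Pj/=; apply/forallP => k; apply/implyP => /andP[Pk jk].
apply/negP => /asboolP ne.
have [/(_ _ Qj) Qk _] := lam ne (ltW jk).
have := jmax k; rewrite Pk/= => /(_ (asboolT Qk)).
by rewrite /= leNgt jk.
Qed.

Lemma maxQ_sum_le (P : pred I) (A : set T) (f : T -> R) :
  measurable A -> nnmfun f -> (forall i, P i -> Q i `<=` A) ->
  (\sum_(i | maxQ P i) \int[mu]_(x in Q i) (f x)%:E <= \int[mu]_(x in A) (f x)%:E)%E.
Proof.
move=> mA nf QA; apply: nnint_sum_le => // [i /maxQ_sub/QA//|x Ax].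
apply: sum_le_atmost1 => // [|i j].
  exact: nnmfun_ge0.
by rewrite !unfold_in => /andP[mi /asboolP ?] /andP[mj /asboolP ?]; exact: (@maxQ_disjoint P _ _ x).
Qed.

Section carleson.
Variables (u G : T -> R).
Hypotheses (nu : nnmfun u) (nG : nnmfun G).
Hypothesis u_fin : forall i, (\int[mu]_(x in Q i) (u x)%:E < +oo)%E.

Lemma measurable_setle (f : T -> R) (t : R) : measurable_fun setT f ->
  measurable [set y | t <= f y].
Proof.
move=> mf; rewrite (_ : [set _ | _] = setT `&` f @^-1` `[t, +oo[).
  by apply: mf => //; exact: measurable_itv.
by rewrite setTI; apply/seteqP; split => y /=; rewrite in_itv/= andbT.
Qed.

(** Where G < t/2, the integral of G u over a cube is at most half of t times that of u, and this
    half is absorbed on the left, which uses [u_fin]. What remains adds up because the maximal cubes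
    are disjoint. *)
Lemma weak_type (P : pred I) (t : R) : 0 < t ->
  (forall i, P i ->
    t%:E * \int[mu]_(x in Q i) (u x)%:E <= \int[mu]_(x in Q i) (G x * u x)%:E)%E ->
  (\sum_(i | maxQ P i) \int[mu]_(x in Q i) (u x)%:E <=
   (2 / t)%:E * \int[mu]_x (G x * u x * \1_[set y | t / 2 <= G y] x)%:E)%E.
Proof.
move=> t0 hP; set g := fun x => G x * u x * \1_[set y | t / 2 <= G y] x.
have ng : nnmfun g.
  apply: nnmfunM; first exact: nnmfunM.
  by apply: nnmfun_indic; apply: measurable_setle; exact: nnmfun_measurable.
have t20 : 0 <= 2 / t by rewrite divr_ge0// ltW.
rewrite -nnintZ//; apply: le_trans (maxQ_sum_le (P := P) measurableT _ _) => //;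
  last exact: nnmfunZ.
apply: lee_sum => i /maxQ_sub Pi; rewrite nnintZ//.
have /(le_trans (hP i Pi)) : (\int[mu]_(x in Q i) (G x * u x)%:E <=
    \int[mu]_(x in Q i) (g x + t / 2 * u x)%:E)%E.
  apply: nnint_le => [x|x _]; first by rewrite mulr_ge0 ?nnmfun_ge0.
  rewrite /g indicE; have [h|h] := leP (t / 2) (G x).
    rewrite mem_set// mulr1 lerDl; apply: mulr_ge0; last exact: nnmfun_ge0.
    by rewrite divr_ge0// ltW.
  rewrite memNset /=; last by apply/negP; rewrite -ltNge.
  by rewrite mulr0 add0r ler_wpM2r ?nnmfun_ge0// ltW.
rewrite nnintD//; last by apply: nnmfunZ => //; rewrite divr_ge0// ltW.
rewrite nnintZ ?divr_ge0 ?(ltW t0)//.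
have : (0 <= \int[mu]_(x in Q i) (u x)%:E)%E by apply: nnint_ge0 => x; exact: nnmfun_ge0.
have : (0 <= \int[mu]_(x in Q i) (g x)%:E)%E by apply: nnint_ge0 => x; exact: nnmfun_ge0.
have := u_fin i.
case: (\int[mu]_(x in Q i) (u x)%:E)%E => [m| |]// _.
case: (\int[mu]_(x in Q i) (g x)%:E)%E => [X| |]//; last first.
  by move=> _ _ _; rewrite gt0_muley ?leey// lte_fin divr_gt0.
rewrite !lee_fin => X0 m0 h; rewrite mulrAC ler_pdivlMr//; lra.
Qed.

Variables (S : pred I) (E : I -> set T) (A : I -> R) (s : R).
Hypotheses (s1 : 1 < s) (mE : forall i, measurable (E i)).
Hypotheses (EQ : forall i, S i -> E i `<=` Q i) (A0 : forall i, 0 <= A i).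
Hypothesis avgA : forall i, S i ->
  ((A i)%:E * \int[mu]_(x in Q i) (u x)%:E <= \int[mu]_(x in Q i) (G x * u x)%:E)%E.
Hypothesis overlapE : forall x, (#|[pred i | S i && `[< E i x >]]| <= 2)%N.

Let S' : pred I := fun i => S i && (0 < A i).
(** One index is chosen for each level of [A] that occurs, so that sums over levels remain finite
    sums over [I]. *)
Let rep i := odflt i [pick j | S' j && (lev 2 (A j) == lev 2 (A i))].

Let rep_prop i : S' i -> S' (rep i) /\ lev 2 (A (rep i)) = lev 2 (A i).
Proof.
rewrite /rep => Si; case: pickP => [j /andP[Sj /eqP]//|/(_ i)].
by rewrite Si eqxx.
Qed.

Let rep_eq i j : S' i -> lev 2 (A i) = lev 2 (A j) -> rep i = rep j.
Proof.
move=> Si e; rewrite /rep e; case: pickP => //= /(_ i).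
by rewrite Si e eqxx.
Qed.

(** On one level [A] is comparable to a constant. The sets [E i] overlap at most twice and are
    covered by the maximal cubes of the level, so their total mass is at most twice the one bounded
    by [weak_type]. *)
Let level_sum j : S' j ->
  (\sum_(i | S' i && (rep i == j)) (A i `^ s)%:E * \int[mu]_(x in E i) (u x)%:E <=
   ((2 * 2 `^ (lev 2 (A j))%:~R) `^ s * (4 / 2 `^ (lev 2 (A j))%:~R))%:E *
   \int[mu]_x (G x * u x * \1_[set y | 2 `^ (lev 2 (A j))%:~R / 2 <= G y] x)%:E)%E.
Proof.
move=> Sj; set t := 2 `^ _; have t0 : 0 < t by rewrite powR_gt0.
pose P i := S' i && (rep i == j).
have levP i : P i -> lev 2 (A i) = lev 2 (A j).
  by move=> /andP[Si /eqP <-]; have [_ ->] := rep_prop Si.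
have A_t i : P i -> t <= A i.
  by move=> Pi; rewrite /t -(levP _ Pi) lev_le ?ltr1n//; case/andP: Pi => /andP[].
have A_2t i : P i -> A i <= 2 * t.
  move=> Pi; have Ai0 : 0 < A i by case/andP: Pi => /andP[].
  apply/ltW; rewrite (lt_le_trans (lev_gt (ltr1n _ 2) Ai0))// (levP _ Pi).
  by rewrite powRD ?pnatr_eq0 ?implybT// powRr1// mulrC.
have SP i : P i -> S i by case/andP => /andP[].
apply: (@le_trans _ _ (((2 * t) `^ s)%:E *
    \sum_(i | P i) \int[mu]_(x in E i) (u x)%:E)%E).
  rewrite ge0_sume_distrr; last first.
    by move=> i _; apply: nnint_ge0 => x; exact: nnmfun_ge0.
  apply: lee_sum => i Pi; apply: lee_wpmul2r.
    by apply: nnint_ge0 => x; exact: nnmfun_ge0.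
  by rewrite lee_fin ge0_ler_powR ?nnegrE ?A_2t// ?mulr_ge0// ltW// (lt_trans _ s1).
rewrite EFinM -muleA; apply: lee_wpmul2l; first by rewrite lee_fin powR_ge0.
have -> : 4 / t = 2 * (2 / t) by rewrite mulrA -natrM.
rewrite EFinM -muleA.
have two0 : (0 <= 2%:E :> \bar R)%E by rewrite lee_fin.
apply: le_trans (lee_wpmul2l two0 (@weak_type P t t0 _)); last first.
  move=> i Pi; apply: le_trans (avgA (SP _ Pi)); apply: lee_wpmul2r.
    by apply: nnint_ge0 => x; exact: nnmfun_ge0.
  by rewrite lee_fin A_t.
rewrite [X in (_ <= _ * X)%E](eq_bigr (fun i => \int[mu]_x (u x * \1_(Q i) x)%:E)%E); last first.
  by move=> i _; rewrite nnint_mkcond.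
have nuQ i : nnmfun (fun x => u x * \1_(Q i) x).
  by apply: nnmfunM => //; exact: nnmfun_indic.
rewrite -nnint_sum// -nnintZ//; last exact: nnmfun_sum.
apply: nnint_sum_le => // x _.
rewrite sumr_const; have [->|] := eqVneq #|[pred i | P i && `[< E i x >]]| 0%N.
  rewrite mulr0n mulr_ge0// sumr_ge0// => i _; exact: (nnmfun_ge0 x (nuQ i)).
rewrite -lt0n => /card_gt0P[i]; rewrite inE => /andP[Pi /asboolP Ei].
have [k mk Qk] := @maxQ_cover P i x Pi (EQ (SP _ Pi) Ei).
apply: (@le_trans _ _ (2 * u x)).
  rewrite -[leLHS]mulr_natl ler_wpM2r ?nnmfun_ge0// ler_nat.
  apply: leq_trans (overlapE x); apply: subset_leq_card; apply/fintype.subsetP => l.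
  by rewrite !unfold_in => /andP[/SP -> ->].
rewrite ler_wpM2l// (bigD1 k)//= indicE mem_set// mulr1 lerDl.
by apply: sumr_ge0 => l _; exact: (nnmfun_ge0 x (nuQ l)).
Qed.

(** Only levels t <= 2 G contribute, and t^s / t = t^(s-1) increases with t because s > 1: a
    geometric series dominated by its top term, of order G^(s-1). *)
Let levels_sum x :
  \sum_(j | S' j && (rep j == j))
    (2 * 2 `^ (lev 2 (A j))%:~R) `^ s * (4 / 2 `^ (lev 2 (A j))%:~R) *
    (G x * u x * \1_[set y | 2 `^ (lev 2 (A j))%:~R / 2 <= G y] x) <=
  2 `^ (2 * s + 1) / (1 - 2 `^ (1 - s)) * (G x `^ s * u x).
Proof.
have s0 : 0 < s by apply: lt_trans s1.
have G0 := nnmfun_ge0 x nG; have u0 := nnmfun_ge0 x nu.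
have y1 : 0 <= 2 `^ (1 - s) < 1.
  rewrite powR_ge0/= -ltr_ln ?posrE ?powR_gt0// ln1 ln_powR.
  by rewrite pmulr_llt0 ?ln_gt0 ?ltr1n// subr_lt0.
have [Gx0|Gx0] := eqVneq (G x) 0.
  rewrite Gx0 big1 ?mulr_ge0 ?powR_ge0 ?invr_ge0 ?subr_ge0// ?powR_ge0//.
    by case/andP: y1 => _ /ltW.
  by move=> j _; rewrite !mul0r mulr0.
have {}Gx0 : 0 < G x by rewrite lt_neqAle eq_sym Gx0.
pose L := lev 2 (2 * G x).
pose B j := (S' j && (rep j == j)) && (2 `^ (lev 2 (A j))%:~R / 2 <= G x).
have BL j : B j -> lev 2 (A j) <= L.
  move=> /andP[_]; rewrite ler_pdivrMr// mulrC => h.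
  rewrite floor_ge_int ler_pdivlMr ?ln_gt0 ?ltr1n//.
  by rewrite -ln_powR ler_ln ?posrE ?powR_gt0 ?mulr_gt0.
rewrite (bigID (fun j => 2 `^ (lev 2 (A j))%:~R / 2 <= G x))/= [X in _ + X]big1 ?addr0; last first.
  by move=> j /andP[_ /negP h]; rewrite indicE memNset// !mulr0.
apply: (@le_trans _ _ (\sum_(j | B j)
   4 * 2 `^ s * (2 * G x) `^ (s - 1) * (G x * u x) * (2 `^ (1 - s)) ^+ `|L - lev 2 (A j)|%N)).
  apply: ler_sum => j Bj; case/andP: (Bj) => _ h; rewrite indicE mem_set// mulr1.
  rewrite [leRHS]mulrAC; apply: ler_wpM2r; first exact: mulr_ge0.
  set t := 2 `^ _; have t0 : 0 < t by rewrite powR_gt0.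
  rewrite powRM ?(ltW t0)// -[leRHS]mulrA.
  rewrite [leLHS](_ : _ = 4 * 2 `^ s * (t `^ s / t)); last by ring.
  apply: ler_wpM2l; first by rewrite mulr_ge0// powR_ge0.
  have -> : t `^ s / t = t `^ (s - 1).
    by rewrite powRB ?(gt_eqF t0) ?implybT// powRr1// ltW.
  apply: (@le_trans _ _ ((2 `^ L%:~R) `^ (s - 1) * (2 `^ (1 - s)) ^+ `|L - lev 2 (A j)|%N)).
    rewrite /t -!powRrM -powR_mulrn ?powR_ge0// -powRrM -powRD ?pnatr_eq0 ?implybT//.
    rewrite natr_absz ger0_norm ?subr_ge0 ?BL//.
    rewrite [X in _ <= _ `^ X](_ : _ = (lev 2 (A j))%:~R * (s - 1))// intrB; ring.
  apply: ler_wpM2r; first by rewrite exprn_ge0// powR_ge0.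
  rewrite ge0_ler_powR ?nnegrE ?powR_ge0 ?subr_ge0 ?(ltW s1)// ?mulr_ge0//.
  by rewrite lev_le ?ltr1n ?mulr_gt0.
rewrite -mulr_sumr; apply: (@le_trans _ _ (4 * 2 `^ s * (2 * G x) `^ (s - 1) *
    (G x * u x) * (1 - 2 `^ (1 - s))^-1)).
  apply: ler_wpM2l; first by rewrite !mulr_ge0 ?powR_ge0.
  apply: sum_geometric_inj => // i j; rewrite !unfold_in => Bi Bj e.
  have {}e := absz_sub_inj (BL _ Bi) (BL _ Bj) e.
  case/andP: Bi => /andP[Si /eqP <-] _; case/andP: Bj => /andP[Sj /eqP <-] _.
  exact: rep_eq.
have -> : 2 `^ (2 * s + 1) = 4 * 2 `^ s * 2 `^ (s - 1) :> R.
  rewrite (_ : 2 * s + 1 = 2 + s + (s - 1)); last by ring.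
  have h a b : 2 `^ (a + b) = 2 `^ a * 2 `^ b :> R.
    by rewrite powRD// pnatr_eq0 implybT.
  by rewrite (h (2 + s)) (h 2) powR_mulrn//; congr (_ * _ * _); ring.
rewrite powRM// -(mulr_powRB1 G0 s0) le_eqVlt; apply/orP; left; apply/eqP; ring.
Qed.

(** Marcinkiewicz interpolation by hand: the sum is split by the level of [A], each level is
    estimated by the truncated weak type bound, and the levels are added under the integral sign. *)
Lemma carleson :
  (\sum_(i | S i) (A i `^ s)%:E * \int[mu]_(x in E i) (u x)%:E <=
   (2 `^ (2 * s + 1) / (1 - 2 `^ (1 - s)))%:E * \int[mu]_x (G x `^ s * u x)%:E)%E.
Proof.
have s0 : 0 < s by apply: lt_trans s1.
rewrite (bigID (fun i => 0 < A i))/= [X in (_ + X)%E]big1 ?adde0; last first.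
  move=> i /andP[_]; rewrite -leNgt => Ai; have -> : A i = 0.
    by apply/eqP; rewrite eq_le Ai A0.
  by rewrite powR0 ?mul0e// gt_eqF.
rewrite (partition_big rep (fun j => S' j && (rep j == j)))/=; last first.
  move=> i Si; have [Sr e] := rep_prop Si; rewrite Sr/=; apply/eqP.
  exact: rep_eq.
have ngE j : nnmfun (fun x => G x * u x *
    \1_[set y | 2 `^ (lev 2 (A j))%:~R / 2 <= G y] x).
  apply: nnmfunM; first exact: nnmfunM.
  by apply: nnmfun_indic; apply: measurable_setle; exact: nnmfun_measurable.
have c0 j : 0 <= (2 * 2 `^ (lev 2 (A j))%:~R) `^ s * (4 / 2 `^ (lev 2 (A j))%:~R) :> R.
  by rewrite mulr_ge0 ?powR_ge0// divr_ge0// powR_ge0.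
apply: le_trans (_ : _ <= \sum_(j | S' j && (rep j == j)) _)%E _.
  by apply: lee_sum => j /andP[Sj _]; exact: level_sum.
under eq_bigr do rewrite -nnintZ//.
rewrite -nnint_sum//; last by move=> j _; exact: nnmfunZ.
have nGs : nnmfun (fun x => G x `^ s) by exact: nnmfun_powR.
rewrite -nnintZ//.
- apply: nnint_le => [x|x _]; last exact: levels_sum.
  by apply: sumr_ge0 => j _; exact: mulr_ge0 (c0 j) (nnmfun_ge0 x (ngE j)).
- rewrite divr_ge0 ?powR_ge0// subr_ge0 -[leRHS](powRr0 2) ler_powR ?ler1n//.
  by rewrite subr_le0 ltW.
- exact: nnmfunM.
Qed.

End carleson.
End laminar.

(** * The estimate for a single weight *)

Section powR_facts.
Context {R : realType}.
Implicit Types a b t p r : R.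

Lemma gt1_conj p : 1 < p -> 1 < p / (p - 1).
Proof. by move=> p1; rewrite ltr_pdivlMr ?subr_gt0// mul1r ltrBlDr ltrDl. Qed.

Lemma conj_inv p : 1 < p -> p^-1 + (p / (p - 1))^-1 = 1.
Proof.
move=> p1; rewrite invf_div.
have p0 : p != 0 by rewrite gt_eqF// (lt_trans _ p1).
by field.
Qed.

Lemma conj_le a b : 1 < a -> a <= b -> b / (b - 1) <= a / (a - 1).
Proof.
move=> a1 ab; have b1 := lt_le_trans a1 ab.
rewrite ler_pdivrMr ?subr_gt0// mulrAC ler_pdivlMr ?subr_gt0//; nra.
Qed.

Lemma young_le a b p : 1 < p -> 0 <= a -> 0 <= b ->
  a * b <= a `^ p + b `^ (p / (p - 1)).
Proof.
move=> p1 a0 b0; have q1 := gt1_conj p1.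
have p0 : 0 < p by apply: lt_trans p1.
have q0 : 0 < p / (p - 1) by apply: lt_trans q1.
apply: (le_trans (conjugate_powR a0 b0 p0 q0 (conj_inv p1))).
by apply: lerD; rewrite ler_pdivrMr// ler_peMr ?powR_ge0// ltW.
Qed.

(** t^(a - b) = exp((a - b) ln t) with |ln t| <= K ln L. Log-Hoelder continuity bounds |a - b| ln L,
    so an exponent can be frozen whenever the base lies between two fixed powers of [L]. *)
Lemma powR_freeze t L a b K C : 1 <= L -> 0 < t -> 0 <= K ->
  L `^ (- K) <= t <= L `^ K -> `|a - b| * ln L <= C ->
  t `^ a <= expR (K * C) * t `^ b.
Proof.
move=> L1 t0 K0 /andP[t1 t2] abC.
have L0 : 0 < L by apply: lt_le_trans L1.
rewrite /powR gt_eqF// -expRD ler_expR -lerBlDr -mulrBl.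
apply: le_trans (ler_norm _) _; rewrite normrM.
have lnt : `|ln t| <= K * ln L.
  rewrite ler_norml -mulNr -!ln_powR !ler_ln ?posrE ?powR_gt0//.
  by rewrite t1 t2.
apply: le_trans (ler_wpM2l (normr_ge0 _) lnt) _.
by rewrite mulrCA ler_wpM2l.
Qed.

Lemma ler_powRN a b r : 0 < a -> a <= b -> 0 <= r -> b `^ (- r) <= a `^ (- r).
Proof.
move=> a0 ab r0; have b0 : 0 < b by apply: lt_le_trans ab.
by rewrite !powRN lef_pV2 ?posrE ?powR_gt0// ge0_ler_powR ?nnegrE ?(ltW a0) ?(ltW b0).
Qed.

Lemma powR_invl t a : t^-1 `^ a = t `^ (- a).
Proof.
have [t0|t0] := leP 0 t; first by rewrite -powR_inv1// -powRrM mulN1r.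
rewrite !lt0_powR1// ?invr_lt0//.
Qed.

End powR_facts.

Lemma measurable_conj d (T : measurableType d) (R : realType) (p : T -> R) :
  measurable_fun setT p -> (forall y, 1 < p y) ->
  measurable_fun setT (fun y => p y / (p y - 1)).
Proof.
move=> mp p_gt1; rewrite (_ : (fun _ => _) = fun y => 1 + (p y - 1) `^ (-1)); last first.
  apply/funext => y; rewrite powR_inv1 ?subr_ge0 ?(ltW (p_gt1 y))//.
  by field; rewrite subr_eq0 gt_eqF.
apply: measurable_funD => //; apply: nnmfun_measurable.
apply: nnmfun_powR => //; split => [|y]; first exact: measurable_funB.
by rewrite subr_ge0 ltW.
Qed.

Section jensen.
Context d (T : measurableType d) (R : realType) (mu : {measure set T -> \bar R}).

(** The tangent line inequality r m^(r-1) k <= k^r + (r-1) m^r, an instance of Young's inequality,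
    is integrated against [V]. A total mass at most one is enough because the constant term is
    nonnegative and stands on the right. *)
Lemma jensen_powR (M : set T) (k V : T -> R) (r m : R) :
  measurable M -> nnmfun k -> nnmfun V -> 1 <= r -> 0 <= m ->
  (\int[mu]_(x in M) (V x)%:E <= 1)%E ->
  (\int[mu]_(x in M) (k x * V x)%:E = m%:E)%E ->
  ((m `^ r)%:E <= \int[mu]_(x in M) (k x `^ r * V x)%:E)%E.
Proof.
move=> mM nk nV r1 m0 V1 kVm.
have [->|rN1] := eqVneq r 1.
  rewrite powRr1// -kVm le_eqVlt; apply/orP; left; apply/eqP.
  by apply: eq_integral => x _; rewrite powRr1 ?nnmfun_ge0.
have {}r1 : 1 < r by rewrite lt_neqAle eq_sym rN1.
have r0 : 0 < r by apply: lt_trans r1.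
have nkr : nnmfun (fun x => k x `^ r) by exact: nnmfun_powR.
have nkrV := nnmfunM nkr nV; have nkV := nnmfunM nk nV.
have c0 : 0 <= r * m `^ (r - 1) by rewrite mulr_ge0 ?powR_ge0// ltW.
have c1 : 0 <= (r - 1) * m `^ r by rewrite mulr_ge0 ?powR_ge0// subr_ge0 ltW.
have : (\int[mu]_(x in M) (r * m `^ (r - 1) * (k x * V x))%:E <=
    \int[mu]_(x in M) (k x `^ r * V x + (r - 1) * m `^ r * V x)%:E)%E.
  apply: nnint_le => [x|x _]; first exact: mulr_ge0 c0 (nnmfun_ge0 x nkV).
  rewrite -mulrDl mulrA; apply: ler_wpM2r; first exact: nnmfun_ge0.
  have k0 := nnmfun_ge0 x nk.
  have := conjugate_powR k0 (powR_ge0 m (r - 1)) r0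
    (lt_trans ltr01 (gt1_conj r1)) (conj_inv r1).
  rewrite -powRrM mulrCA divff ?mulr1 ?subr_eq0// => h.
  have -> : k x `^ r + (r - 1) * m `^ r = r * (k x `^ r / r + m `^ r / (r / (r - 1))).
    by field; rewrite subr_eq0 rN1 gt_eqF.
  by rewrite -mulrA ler_pM2l// mulrC.
rewrite nnintZ// nnintD//; last exact: nnmfunZ.
rewrite [X in (_ <= _ + X)%E -> _]nnintZ// kVm -EFinM.
have -> : r * m `^ (r - 1) * m = r * m `^ r by rewrite -mulrA [_ * m]mulrC mulr_powRB1.
have : (0 <= \int[mu]_(x in M) (k x `^ r * V x)%:E)%E.
  by apply: nnint_ge0 => x; exact: nnmfun_ge0 nkrV.
have : (0 <= \int[mu]_(x in M) (V x)%:E)%E.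
  by apply: nnint_ge0 => x; exact: nnmfun_ge0.
case: (\int[mu]_(x in M) (V x)%:E)%E V1 => [y| |]//.
case: (\int[mu]_(x in M) (k x `^ r * V x)%:E)%E => [z| |]//; last by move=> *; rewrite leey.
rewrite !lee_fin => y1 y0 z0 h.
have : (r - 1) * m `^ r * y <= (r - 1) * m `^ r by rewrite ler_piMr.
lra.
Qed.
End jensen.

(* [Q j] is a cube of side [ell j], [N j] the norm of the weight [v] on it,
   [pQ j] the constant by which the exponent [p] is replaced on it, and [X y] is
   of the order of [e + |y|]. The hypotheses on [N] are what the A_{p,q}
   condition implies for each weight separately. *)
Section linear.
Context d (T : measurableType d) (R : realType) (mu : {measure set T -> \bar R}).
Variables (J : Type) (Q : J -> set T) (ell : J -> R) (X p v : T -> R) (pQ N : J -> R).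
Variables (pm CL C0 K0 K1 C6 delta c1 : R).
Hypotheses (mQ : forall j, measurable (Q j)) (ell_gt0 : forall j, 0 < ell j).
Hypotheses (mX : measurable_fun setT X) (X_ge : forall y, expR 1 <= X y).
Hypotheses (mp : measurable_fun setT p) (pm1 : 1 < pm).
Hypotheses (p_ge : forall y, pm <= p y) (pQ_ge : forall j, pm <= pQ j).
Hypothesis p_osc : forall j y, Q j y ->
  `|p y - pQ j| * ln (X y + (ell j)^-1) <= CL.
Hypotheses (mv : measurable_fun setT v) (v_gt0 : forall y, 0 < v y).
Hypotheses (N_gt0 : forall j, 0 < N j) (C0_ge1 : 1 <= C0) (K0_ge0 : 0 <= K0).
Hypotheses (K1_ge0 : 0 <= K1) (C6_ge0 : 0 <= C6) (delta_gt0 : 0 < delta).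
Hypothesis c1_gt0 : 0 < c1.

Let pc y := p y / (p y - 1).
Let qQ j := pQ j / (pQ j - 1).
Let Pc := pm / (pm - 1).

Hypothesis N_mod : forall j, (\int[mu]_(y in Q j) ((v y / N j) `^ pc y)%:E <= 1)%E.
Hypothesis N_lower : forall j y, Q j y -> (X y + (ell j)^-1) `^ (- K0) <= C0 * N j.
Hypothesis N_upper : forall j y, Q j y -> N j <= C0 * (X y + ell j) `^ K0.
Hypothesis N_doubling : forall j y, Q j y -> X y <= ell j -> ell j `^ delta <= C0 * N j.
Hypothesis sigma_decay : (\int[mu]_y (X y `^ (- K1) * v y `^ pc y)%:E <= C6%:E)%E.

(** Chosen so that kap delta/2 = K1 + delta/2: at a bad point X^K1 is then at most ell^(delta/2),
    half of the gain that [N_doubling] offers. *)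
Let kap := 2 * K1 / delta + 1.
(** Large enough for the bad points of a cube to carry at most c1/2 of the modular; see
    [sg_lower]. *)
Let L0 := (1 + C0 `^ (Pc + 1) * C6 * 2 / c1) `^ (2 / delta).
(** Each group of summands serves one estimate: [K0 * Pc + K1 + 1] makes the part with small [kk]
    summable, [(pm - 1)^-1] the part with large [kk], and [K0 + ln C0] keeps [N j] between two
    powers of [Lam], since C0 <= Lam^(ln C0) for Lam >= e. *)
Let K := K0 * Pc + K1 + 1 + (pm - 1)^-1 + K0 + ln C0.
Let Lam j y := X y + ell j + (ell j)^-1.
(* At a good point [ln (Lam j y)] is at most a multiple of [ln (X y + (ell j)^-1)],
   so that [p_osc] allows one to freeze the exponent of any quantity lying
   between two powers of [Lam j y]; at a bad point [X y] is negligible with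
   respect to [ell j] and [N_doubling] wins. *)
Let good j y := ell j <= L0 * X y `^ kap.
Let Cosc := CL * (ln (1 + L0) + kap) * (1 + (pm - 1)^-1 ^+ 2).
Let CF := expR (K * Cosc).
Let V j y := (v y / N j) `^ pc y.
Let sg y := v y `^ pc y.

Let X_gt0 y : 0 < X y. Proof. exact: lt_le_trans (expR_gt0 1) (X_ge y). Qed.
Let X_ge1 y : 1 <= X y.
Proof. by apply: le_trans (X_ge y); rewrite -[leLHS](@expR0 R) ler_expR. Qed.
Let p_gt1 y : 1 < p y. Proof. exact: lt_le_trans (p_ge y). Qed.
Let pQ_gt1 j : 1 < pQ j. Proof. exact: lt_le_trans (pQ_ge j). Qed.
Let p_gt0 y : 0 < p y. Proof. exact: lt_trans (p_gt1 y). Qed.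
Let pc_gt1 y : 1 < pc y. Proof. exact: gt1_conj. Qed.
Let qQ_gt1 j : 1 < qQ j. Proof. exact: gt1_conj. Qed.
Let pc_gt0 y : 0 < pc y. Proof. exact: lt_trans (pc_gt1 y). Qed.
Let C0_gt0 : 0 < C0. Proof. exact: lt_le_trans C0_ge1. Qed.
Let Pc_gt0 : 0 < Pc. Proof. exact: lt_trans (gt1_conj pm1). Qed.

Let pc_le y : pc y <= Pc. Proof. exact: conj_le. Qed.
Let qQ_le j : qQ j <= Pc. Proof. exact: conj_le. Qed.

Let conj_osc y j : `|pc y - qQ j| <= `|p y - pQ j| * (pm - 1)^-1 ^+ 2.
Proof.
have pm0 : 0 < pm - 1 by rewrite subr_gt0.
have a0 : 0 < p y - 1 by rewrite subr_gt0.
have b0 : 0 < pQ j - 1 by rewrite subr_gt0.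
have -> : pc y - qQ j = (pQ j - p y) / ((p y - 1) * (pQ j - 1)).
  by rewrite /pc /qQ; field; rewrite !gt_eqF.
rewrite normrM distrC ler_wpM2l// ger0_norm; last first.
  by rewrite invr_ge0 mulr_ge0// ltW.
rewrite exprVn lef_pV2 ?posrE ?exprn_gt0 ?mulr_gt0//.
by rewrite expr2 ler_pM ?(ltW pm0)// lerD2r.
Qed.

Let L0_ge1 : 1 <= L0.
Proof.
have -> : 1 = 1 `^ (2 / delta) :> R by rewrite powR1.
apply: ge0_ler_powR.
- by rewrite divr_ge0// ltW.
- by rewrite nnegrE.
- by rewrite nnegrE addr_ge0// !mulr_ge0 ?powR_ge0// invr_ge0 ltW.
- by rewrite lerDl !mulr_ge0 ?powR_ge0// invr_ge0 ltW.
Qed.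

Let kap_ge1 : 1 <= kap.
Proof. by rewrite lerDr divr_ge0 ?mulr_ge0// ltW. Qed.

Let lnC0_ge0 : 0 <= ln C0. Proof. exact: ln_ge0. Qed.

Let K_ge0 : 0 <= K.
Proof.
have h1 : 0 <= K0 * Pc by rewrite mulr_ge0// ltW.
have h2 : 0 <= (pm - 1)^-1 by rewrite invr_ge0 subr_ge0 ltW.
by rewrite /K !addr_ge0.
Qed.

Let base_ge1 j y : 1 <= X y + (ell j)^-1.
Proof. by rewrite (le_trans (X_ge1 y))// lerDl invr_ge0 ltW. Qed.

Let Lam_ge j y : expR 1 <= Lam j y.
Proof.
by rewrite (le_trans (X_ge y))// /Lam -addrA lerDl addr_ge0 ?invr_ge0 ?(ltW (ell_gt0 j)).
Qed.

Let Lam_ge1 j y : 1 <= Lam j y.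
Proof. by apply: le_trans (Lam_ge j y); rewrite -[leLHS](@expR0 R) ler_expR. Qed.

Let Lam_gt0 j y : 0 < Lam j y. Proof. exact: lt_le_trans (Lam_ge1 j y). Qed.

Let ln_Lam j y : good j y ->
  ln (Lam j y) <= (ln (1 + L0) + kap) * ln (X y + (ell j)^-1).
Proof.
move=> gjy; set Y := X y + _; have Y1 : 1 <= Y by exact: base_ge1.
have Y0 : 0 < Y by apply: lt_le_trans Y1.
have L01 : 0 < 1 + L0 by rewrite addr_gt0// (lt_le_trans _ L0_ge1).
have lnY : 1 <= ln Y.
  rewrite -[leLHS](@expRK R) ler_ln ?posrE ?expR_gt0// (le_trans (X_ge y))//.
  by rewrite lerDl invr_ge0 ltW.
apply: (@le_trans _ _ (ln ((1 + L0) * Y `^ kap))).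
  rewrite ler_ln ?posrE ?mulr_gt0 ?powR_gt0//.
  rewrite /Lam addrAC -/Y mulrDl mul1r; apply: lerD.
    by rewrite le1r_powR.
  apply: (le_trans gjy); apply: ler_wpM2l; first exact: le_trans L0_ge1.
  rewrite ge0_ler_powR ?nnegrE ?(ltW Y0) ?(ltW (X_gt0 y))//.
    exact: le_trans kap_ge1.
  by rewrite lerDl invr_ge0 ltW.
rewrite lnM ?posrE ?powR_gt0// ln_powR [leRHS]mulrDl lerD2r.
by rewrite ler_peMr// ln_ge0// lerDl (le_trans _ L0_ge1).
Qed.

Let osc_good j y : Q j y -> good j y ->
  `|p y - pQ j| * ln (Lam j y) <= CL * (ln (1 + L0) + kap).
Proof.
move=> Qjy gjy; apply: le_trans (ler_wpM2l (normr_ge0 _) (ln_Lam gjy)) _.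
rewrite mulrCA mulrC; apply: ler_wpM2r; last exact: p_osc.
by rewrite addr_ge0 ?ln_ge0 ?(le_trans ler01 kap_ge1)// lerDl (le_trans _ L0_ge1).
Qed.

Let freeze j y t a b : Q j y -> good j y -> 0 < t ->
  Lam j y `^ (- K) <= t <= Lam j y `^ K ->
  (`|a - b| <= `|p y - pQ j| \/ `|a - b| <= `|pc y - qQ j|) ->
  t `^ a <= CF * t `^ b.
Proof.
move=> Qjy gjy t0 tb ab; apply: (powR_freeze (Lam_ge1 j y)) => //.
have := osc_good Qjy gjy; set B := CL * _ => hB.
have B0 : 0 <= B by apply: le_trans hB; rewrite mulr_ge0// ln_ge0.
have s0 : 0 <= (pm - 1)^-1 ^+ 2 by rewrite exprn_ge0// invr_ge0 subr_ge0 ltW.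
have lnL : 0 <= ln (Lam j y) by rewrite ln_ge0.
rewrite /Cosc -/B [leRHS]mulrDr mulr1; case: ab => ab.
  by rewrite (le_trans (ler_wpM2r lnL ab))// (le_trans hB)// lerDl mulr_ge0.
rewrite (le_trans (ler_wpM2r lnL (le_trans ab (conj_osc y j))))//.
by rewrite mulrAC (le_trans (ler_wpM2r s0 hB))// lerDr.
Qed.

Let C0_Lam j y : C0 <= Lam j y `^ (ln C0).
Proof.
rewrite -{1}(lnK (x := C0)) ?posrE// /powR gt_eqF// ler_expR ler_peMr//.
by rewrite -[leLHS](@expRK R) ler_ln ?posrE ?expR_gt0.
Qed.

Let N_range j y : Q j y -> Lam j y `^ (- K) <= N j <= Lam j y `^ K.
Proof.
move=> Qjy; have KK : K0 + ln C0 <= K.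
  have h1 : 0 <= K0 * Pc by rewrite mulr_ge0// ltW.
  have h2 : 0 <= (pm - 1)^-1 by rewrite invr_ge0 subr_ge0 ltW.
  by rewrite /K -[leRHS]addrA lerDr !addr_ge0.
have e a b : Lam j y `^ (a + b) = Lam j y `^ a * Lam j y `^ b.
  by rewrite powRD// (gt_eqF (Lam_gt0 j y)) implybT.
apply/andP; split.
  apply: (@le_trans _ _ (Lam j y `^ (- (K0 + ln C0)))).
    by rewrite ler_powR// lerN2.
  rewrite opprD e; apply: (@le_trans _ _ (Lam j y `^ (- K0) / C0)).
    apply: ler_wpM2l; first exact: powR_ge0.
    by rewrite powRN lef_pV2 ?posrE ?powR_gt0.
  rewrite ler_pdivrMr// mulrC; apply: le_trans (N_lower Qjy).
  rewrite !powRN lef_pV2 ?posrE ?powR_gt0//; last exact: lt_le_trans (base_ge1 j y).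
  rewrite ge0_ler_powR ?nnegrE ?(ltW (Lam_gt0 j y)) ?(le_trans ler01 (base_ge1 j y))//.
  by rewrite /Lam addrAC lerDl ltW.
apply: (@le_trans _ _ (Lam j y `^ (K0 + ln C0))); last by rewrite ler_powR.
rewrite e mulrC; apply: le_trans (N_upper Qjy) _.
apply: ler_pM; rewrite ?powR_ge0 ?(ltW C0_gt0)//.
rewrite ge0_ler_powR ?nnegrE ?(ltW (Lam_gt0 j y)) ?addr_ge0 ?(ltW (X_gt0 y)) ?(ltW (ell_gt0 j))//.
by rewrite /Lam lerDl invr_ge0 ltW.
Qed.

Let sg_gt0 y : 0 < sg y. Proof. exact: powR_gt0. Qed.
Let V_gt0 j y : 0 < V j y. Proof. by rewrite powR_gt0// divr_gt0. Qed.
Let mpc : measurable_fun setT pc.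
Proof. by apply: measurable_conj => // y; exact: p_gt1. Qed.
Let nv : nnmfun v. Proof. by split => // y; exact: ltW. Qed.
Let nX : nnmfun X. Proof. by split => // y; exact: ltW. Qed.
Let nsg : nnmfun sg. Proof. by apply: nnmfun_powR. Qed.
Let nV j : nnmfun (V j).
Proof.
apply: nnmfun_powR => //; apply: nnmfunM => //; apply: nnmfun_cst.
by rewrite invr_ge0 ltW.
Qed.
Let nLam j : nnmfun (Lam j).
Proof.
by apply: nnmfunD; [apply: nnmfunD => //|]; apply: nnmfun_cst;
  rewrite ?invr_ge0 ltW.
Qed.
Let VE j y : V j y = sg y * N j `^ (- pc y).
Proof. by rewrite /V powRM ?invr_ge0 ?(ltW (v_gt0 y)) ?(ltW (N_gt0 j))// powR_invl. Qed.

Section one_function.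
Variable h : T -> R.
Hypotheses (nh : nnmfun h) (h_mod : (\int[mu]_y (h y `^ p y)%:E <= 1)%E).

Let h_ge0 y : 0 <= h y. Proof. exact: nnmfun_ge0. Qed.

(** The density of h v / N with respect to V: kk V = h v / N and kk^p V = h^p, because 1/p + 1/p' =
    1. The splitting according to size is made on [kk]. *)
Let kk j y := h y * V j y `^ (- (p y)^-1).
Let bad j := [set y | L0 * X y `^ kap < ell j].
(** One term for each discarded part: the bad points, the points where [kk] is very small, and those
    where it is very large. *)
Let err j y := C0 * ell j `^ (- delta) * (h y * v y) * \1_(bad j) y +
  Lam j y `^ (- K) * V j y + h y `^ p y * Lam j y `^ (- (K * (pm - 1))).
Let Mid j := Q j `&` [set y | ell j <= L0 * X y `^ kap] `&`
  ([set y | Lam j y `^ (- K) <= kk j y] `&` [set y | kk j y <= Lam j y `^ K]).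
(** The geometric mean of h^p and sg with exponents 1/pm and 1 - 1/pm, so that H/sg is the pm-th
    root of h^p/sg. *)
Let H y := h y `^ (p y / pm) * sg y `^ (1 - pm^-1).

Let kkV j y : kk j y * V j y = h y * (v y / N j).
Proof.
have V0 := V_gt0 j y.
rewrite /kk -mulrA -{2}(powRr1 (ltW V0)) -powRD ?(gt_eqF V0) ?implybT//.
rewrite {1}/V -powRrM -[in RHS](powRr1 (_ : 0 <= v y / N j)) ?divr_ge0 ?ltW//.
congr (_ * _ `^ _); rewrite /pc; field.
by rewrite (gt_eqF (p_gt0 y)) subr_eq0 (gt_eqF (p_gt1 y)).
Qed.

Let nkk j : nnmfun (kk j).
Proof.
apply: nnmfunM => //; apply: nnmfun_powR => //.
rewrite (_ : (fun _ => _) = fun y => - (p y `^ (-1))).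
  apply: measurableT_comp => //; apply: nnmfun_measurable.
  by apply: nnmfun_powR => //; split => // y; exact: ltW.
by apply/funext => y; rewrite powR_inv1// ltW.
Qed.

Let mLamK j (c : R) : measurable_fun setT (fun y => Lam j y `^ c).
Proof. by apply: nnmfun_measurable; apply: nnmfun_powR. Qed.

Let mXK (c : R) : measurable_fun setT (fun y => X y `^ c).
Proof. by apply: nnmfun_measurable; apply: nnmfun_powR. Qed.

Let mle (f g : T -> R) : measurable_fun setT f -> measurable_fun setT g ->
  measurable [set y | f y <= g y].
Proof.
move=> mf mg; rewrite -[X in measurable X]setTI.
have mt : measurable [set true] by [].
exact: (measurable_fun_ler mf mg measurableT mt).
Qed.

Let mbad j : measurable (bad j).
Proof.
rewrite (_ : bad j = ~` [set y | ell j <= L0 * X y `^ kap]).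
  by apply: measurableC; apply: mle => //; exact: measurable_funM.
by apply/seteqP; split => y; rewrite /bad /= ltNge => /negP.
Qed.

Let mMid j : measurable (Mid j).
Proof.
apply: measurableI; first apply: measurableI => //.
  by apply: mle => //; exact: measurable_funM.
have [mk _] := nkk j; by apply: measurableI; exact: mle.
Qed.

Let nerr j : nnmfun (err j).
Proof.
have nhv : nnmfun (fun y => h y * v y) by exact: nnmfunM.
apply: nnmfunD; first apply: nnmfunD.
- apply: nnmfunM; last exact: nnmfun_indic.
  by apply: nnmfunZ => //; rewrite mulr_ge0 ?powR_ge0// ltW.
- by apply: nnmfunM => //; split => // y; exact: powR_ge0.
- apply: nnmfunM; last by split => // y; exact: powR_ge0.
  exact: nnmfun_powR.
Qed.

Let nhvN j : nnmfun (fun y => h y * (v y / N j)).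
Proof.
apply: nnmfunM => //; apply: nnmfunM => //; apply: nnmfun_cst.
by rewrite invr_ge0 ltW.
Qed.

Let nhp : nnmfun (fun y => h y `^ p y). Proof. exact: nnmfun_powR. Qed.

Let N_big j y : Q j y -> bad j y ->
  [/\ 1 <= ell j, (N j)^-1 <= C0 * ell j `^ (- delta) & X y `^ kap <= ell j].
Proof.
rewrite /bad/= => Qjy bjy.
have X1 : 1 <= X y `^ kap by rewrite -(powRr0 (X y)) ler_powR// (le_trans ler01 kap_ge1).
have Xe : X y `^ kap <= ell j by apply: le_trans (ltW bjy); rewrite ler_peMl// powR_ge0.
split => //; first exact: le_trans Xe.
have Xell : X y <= ell j by apply: le_trans Xe; rewrite le1r_powR.
rewrite powRN ler_pdivlMr ?powR_gt0// mulrC ler_pdivrMr//.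
exact: N_doubling Qjy Xell.
Qed.

Let split_point j y : Q j y ->
  h y * (v y / N j) <= err j y + kk j y * V j y * \1_(Mid j) y.
Proof.
move=> Qjy; have V0 := ltW (V_gt0 j y); have L1 := Lam_ge1 j y; have L0' := Lam_gt0 j y.
have p1 : 0 <= p y - 1 by rewrite subr_ge0 ltW.
have e1 : 0 <= C0 * ell j `^ (- delta) * (h y * v y) * \1_(bad j) y.
  by rewrite indicE !mulr_ge0 ?powR_ge0// ltW.
have e2 : 0 <= Lam j y `^ (- K) * V j y by rewrite mulr_ge0 ?powR_ge0.
have e3 : 0 <= h y `^ p y * Lam j y `^ (- (K * (pm - 1))) by rewrite mulr_ge0 ?powR_ge0.
have e4 : 0 <= kk j y * V j y * \1_(Mid j) y.
  apply: mulr_ge0; first exact: mulr_ge0 (nnmfun_ge0 y (nkk j)) V0.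
  by rewrite indicE.
rewrite /err; have [bjy|bjy] := pselect (bad j y).
  have [_ Ni _] := N_big Qjy bjy.
  rewrite indicE mem_set// mulr1 in e1 *.
  apply: (@le_trans _ _ (C0 * ell j `^ (- delta) * (h y * v y))); last by lra.
  by rewrite mulrA mulrC ler_wpM2r// mulr_ge0// ltW.
have gjy : ell j <= L0 * X y `^ kap by rewrite leNgt; apply/negP.
rewrite -kkV; have [k1|k1] := ltP (kk j y) (Lam j y `^ (- K)).
  apply: (@le_trans _ _ (Lam j y `^ (- K) * V j y)); last by lra.
  by rewrite ler_wpM2r// ltW.
have [k2|k2] := leP (kk j y) (Lam j y `^ K).
  have -> : \1_(Mid j) y = 1 :> R by rewrite indicE mem_set//; split.
  by rewrite mulr1; lra.
have k0 : 0 < kk j y by apply: lt_le_trans k1; exact: powR_gt0.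
apply: (@le_trans _ _ (h y `^ p y * Lam j y `^ (- (K * (pm - 1))))); last by lra.
(* Where [kk] exceeds Lam^K, h^p = kk^(p-1) kk V dominates kk V with the factor Lam^(K (pm-1)) to
   spare. *)
have -> : h y `^ p y = kk j y * kk j y `^ (p y - 1) * V j y.
  rewrite mulr_powRB1 ?(ltW k0)// /kk powRM ?powR_ge0// -powRrM mulNr mulVf ?gt_eqF//.
  by rewrite powR_inv1// -mulrA mulVf ?mulr1// gt_eqF.
rewrite [leRHS](_ : _ = kk j y * V j y *
  (kk j y `^ (p y - 1) * Lam j y `^ (- (K * (pm - 1))))); last by ring.
apply: ler_peMr; first exact: mulr_ge0 (ltW k0) V0.
rewrite powRN ler_pdivlMr ?powR_gt0// mul1r.
apply: (@le_trans _ _ (Lam j y `^ (K * (p y - 1)))).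
  by rewrite ler_powR// ler_wpM2l// lerD2r.
by rewrite powRrM ge0_ler_powR ?nnegrE ?powR_ge0 ?(ltW k0)// ltW.
Qed.

Let H_young y : H y <= h y `^ p y + sg y.
Proof.
have := young_le pm1 (powR_ge0 (h y) (p y / pm)) (powR_ge0 (sg y) (1 - pm^-1)).
have pm0 : pm != 0 by rewrite gt_eqF// (lt_trans _ pm1).
have e : (1 - pm^-1) * (pm / (pm - 1)) = 1.
  by field; rewrite pm0 subr_eq0 gt_eqF.
rewrite -[X in _ <= X + _]powRrM mulfVK// -[X in _ <= _ + X]powRrM e.
by rewrite [X in _ <= _ + X]powRr1 ?(ltW (sg_gt0 y)).
Qed.

(** Two exponents are frozen: p/pm on [kk], then p' on [N j], after kk^(p/pm) V has been rewritten
    as h^(p/pm) V^(1 - 1/pm) with V = sg N^(-p'). The factors 1/pm and 1 - 1/pm only shrink the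
    oscillations. *)
Let mid_point j y : Mid j y ->
  kk j y `^ (pQ j / pm) * V j y <= CF * CF * N j `^ (- (qQ j * (1 - pm^-1))) * H y.
Proof.
move=> [[Qjy /= gjy] [/= k1 k2]].
have V0 := V_gt0 j y.
have k0 : 0 < kk j y by apply: lt_le_trans k1; exact: powR_gt0.
have pm0 : 0 < pm by apply: lt_trans pm1.
have CF0 : 0 < CF by exact: expR_gt0.
apply: (@le_trans _ _ (CF * kk j y `^ (p y / pm) * V j y)).
  apply: ler_wpM2r; first exact: ltW.
  apply: (freeze Qjy gjy) => //; first by rewrite k1.
  left; rewrite -mulrBl normrM distrC ler_piMr// ger0_norm ?invr_ge0 ?(ltW pm0)//.
  by rewrite invf_le1// ltW.
rewrite -[leLHS]mulrA.
have -> : kk j y `^ (p y / pm) * V j y = h y `^ (p y / pm) * V j y `^ (1 - pm^-1) :> R.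
  rewrite /kk powRM ?powR_ge0// -powRrM (_ : - (p y)^-1 * (p y / pm) = - pm^-1).
    rewrite -mulrA; congr (_ * _).
    by rewrite addrC powRD ?(gt_eqF V0) ?implybT// powRr1// ltW.
  by field; rewrite !gt_eqF.
have -> : V j y `^ (1 - pm^-1) = N j `^ (- (pc y * (1 - pm^-1))) * sg y `^ (1 - pm^-1).
  rewrite VE (powRM _ (ltW (sg_gt0 y)) (powR_ge0 _ _)) -[(N j `^ _) `^ _]powRrM.
  by rewrite mulrC mulNr.
have fr : N j `^ (- (pc y * (1 - pm^-1))) <= CF * N j `^ (- (qQ j * (1 - pm^-1))).
  apply: (freeze Qjy gjy) => //; first exact: N_range.
  right; rewrite -opprD normrN -mulNr -mulrDl normrM ler_piMr//.
  by rewrite ger0_norm ?subr_ge0 ?invf_le1 ?(ltW pm1)// gerBl invr_ge0 ltW.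
apply: (@le_trans _ _ (CF * (h y `^ (p y / pm) *
    (CF * N j `^ (- (qQ j * (1 - pm^-1))) * sg y `^ (1 - pm^-1))))).
  apply: ler_wpM2l (ltW CF0) _ _ _; apply: ler_wpM2l (powR_ge0 _ _) _ _ _.
  by apply: ler_wpM2r (powR_ge0 _ _) _ _ _.
by rewrite /H le_eqVlt; apply/orP; left; apply/eqP; ring.
Qed.

Let sg_fin j : (\int[mu]_(y in Q j) (sg y)%:E < +oo)%E.
Proof.
pose B := (1 + N j) `^ Pc; have N0 := N_gt0 j.
apply: (@le_lt_trans _ _ (\int[mu]_(y in Q j) (B * V j y)%:E)%E).
  apply: nnint_le => [y|y _]; first exact: ltW.
  rewrite VE mulrCA ler_peMr ?(ltW (sg_gt0 y))//.
  rewrite powRN ler_pdivlMr ?powR_gt0// mul1r /B.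
  apply: (@le_trans _ _ ((1 + N j) `^ pc y)).
    by rewrite ge0_ler_powR ?nnegrE ?(ltW (pc_gt0 y)) ?addr_ge0 ?(ltW N0)// lerDr.
  by rewrite ler_powR// lerDl ltW.
rewrite nnintZ// ?powR_ge0//; apply: (@le_lt_trans _ _ (B%:E * 1)%E).
  by apply: lee_wpmul2l (N_mod j); rewrite lee_fin powR_ge0.
by rewrite mule1 ltry.
Qed.

Let nH : nnmfun H. Proof. by apply: nnmfunM; apply: nnmfun_powR => //; exact: measurable_funM. Qed.

Let H_fin j : (\int[mu]_(y in Q j) (H y)%:E < +oo)%E.
Proof.
apply: (@le_lt_trans _ _ (\int[mu]_(y in Q j) (h y `^ p y + sg y)%:E)%E).
  by apply: nnint_le => [y|y _]; [exact: nnmfun_ge0 nH|exact: H_young].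
rewrite nnintD// lte_add_pinfty//; apply: le_lt_trans (ltry 1).
by apply: le_trans h_mod; exact: nnint_subset.
Qed.

Let Hint j := fine (\int[mu]_(y in Q j) (H y)%:E)%E.

Let HintE j : (\int[mu]_(y in Q j) (H y)%:E = (Hint j)%:E)%E.
Proof.
rewrite fineK// ge0_fin_numE//; apply: nnint_ge0 => y; exact: nnmfun_ge0 nH.
Qed.

Let Hint_ge0 j : 0 <= Hint j.
Proof. by apply: fine_ge0; apply: nnint_ge0 => y; exact: nnmfun_ge0 nH. Qed.

Let avg_le2 j : (\int[mu]_(y in Q j) (h y * (v y / N j))%:E <= 2%:E)%E.
Proof.
apply: (@le_trans _ _ (\int[mu]_(y in Q j) (h y `^ p y + V j y)%:E)%E).
  apply: nnint_le => [y|y _]; first exact: nnmfun_ge0 (nhvN j).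
  by apply: young_le => //; rewrite divr_ge0// ltW.
rewrite nnintD// [leRHS](_ : _ = 1%:E + 1%:E)%E//.
by apply: leeD (N_mod j); apply: le_trans h_mod; exact: nnint_subset.
Qed.

Let cube_estimate j b : (\int[mu]_(y in Q j) (h y * (v y / N j))%:E = b%:E)%E ->
  (((b / 2) `^ pQ j)%:E <= \int[mu]_(y in Q j) (err j y)%:E +
   ((CF * CF) `^ pm * Hint j `^ pm * N j `^ (- (qQ j * (pm - 1))))%:E)%E.
Proof.
move=> bE; have pm0 : 0 < pm by apply: lt_trans pm1.
have b0 : 0 <= b.
  by rewrite -lee_fin -bE; apply: nnint_ge0 => y; exact: nnmfun_ge0 (nhvN j).
have b2 : b / 2 <= 1 by rewrite ler_pdivrMr// mul1r -lee_fin -bE.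
have nkV : nnmfun (fun y => kk j y * V j y) by exact: (nnmfunM (nkk j) (nV j)).
have MQ : Mid j `<=` Q j by move=> y [[]].
have mQj := mQ j.
have [m mE /andP[m0 mb]] : exists2 m,
    (\int[mu]_(y in Mid j) (kk j y * V j y)%:E)%E = m%:E & 0 <= m <= b.
  apply: le_EFin_fine; first by apply: nnint_ge0 => y; exact: nnmfun_ge0 nkV.
  by rewrite -bE; under [leRHS]eq_integral do rewrite -kkV; exact: nnint_subset.
have split : (b%:E <= \int[mu]_(y in Q j) (err j y)%:E + m%:E)%E.
  rewrite -bE -mE.
  have -> : (\int[mu]_(y in Mid j) (kk j y * V j y)%:E =
      \int[mu]_(y in Q j) (kk j y * V j y * \1_(Mid j) y)%:E)%E.
    rewrite nnint_mkcond [RHS]nnint_mkcond; apply: eq_integral => y _.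
    rewrite -[in RHS]mulrA; congr (_ * _)%:E; rewrite !indicE -natrM mulnb.
    by case: (boolP (y \in Mid j)) => // /set_mem/MQ/mem_set ->.
  rewrite -nnintD//; last by apply: nnmfunM => //; exact: nnmfun_indic.
  by apply: nnint_le => [y|y]; [exact: nnmfun_ge0 (nhvN j)|exact: split_point].
have : (0 <= \int[mu]_(y in Q j) (err j y)%:E)%E.
  by apply: nnint_ge0 => y; exact: nnmfun_ge0 (nerr j).
case: (\int[mu]_(y in Q j) (err j y)%:E)%E split => [x| |]//; last first.
  by move=> _ _; rewrite addye// leey.
rewrite -EFinD !lee_fin => split x0.
have pQ0 : 0 < pQ j by apply: lt_trans (pQ_gt1 j).
have [xm|xm] := leP m x.
  apply: (@le_trans _ _ x); last by rewrite lerDl !mulr_ge0 ?powR_ge0.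
  have [->|bN0] := eqVneq b 0; first by rewrite mul0r powR0// gt_eqF.
  apply: (@le_trans _ _ (b / 2)); last by rewrite ler_pdivrMr//; lra.
  rewrite ge1r_powR ?(ltW (pQ_gt1 j))// b2 divr_gt0// lt_neqAle eq_sym bN0//.
apply: (@le_trans _ _ (m `^ pQ j)).
  rewrite ge0_ler_powR ?nnegrE ?divr_ge0 ?(ltW pQ0)// ler_pdivrMr//; lra.
apply: (@le_trans _ _ ((CF * CF) `^ pm * Hint j `^ pm * N j `^ (- (qQ j * (pm - 1))))); last first.
  by rewrite lerDr.
have CF0 : 0 < CF by exact: expR_gt0.
have Jm : m `^ (pQ j / pm) <= CF * CF * N j `^ (- (qQ j * (1 - pm^-1))) * Hint j.
  rewrite -lee_fin.
  have r1 : 1 <= pQ j / pm by rewrite ler_pdivlMr// mul1r.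
  have VM : (\int[mu]_(y in Mid j) (V j y)%:E <= 1)%E.
    by apply: le_trans (N_mod j); exact: nnint_subset.
  apply: le_trans (jensen_powR (mMid j) (nkk j) (nV j) r1 m0 VM mE) _.
  rewrite EFinM -HintE -nnintZ//; last first.
    by rewrite !mulr_ge0 ?powR_ge0// ltW.
  have nR : nnmfun (fun y => CF * CF * N j `^ (- (qQ j * (1 - pm^-1))) * H y).
    by apply: nnmfunZ => //; rewrite !mulr_ge0 ?powR_ge0// ltW.
  apply: le_trans (nnint_subset _ _ _ nR MQ) => //.
  apply: nnint_le => [y|y]; last exact: mid_point.
  by rewrite mulr_ge0 ?powR_ge0// ltW.
have -> : m `^ pQ j = (m `^ (pQ j / pm)) `^ pm by rewrite -powRrM mulfVK// gt_eqF.
apply: le_trans (ge0_ler_powR _ _ _ Jm) _; rewrite ?nnegrE ?powR_ge0 ?(ltW pm0)//.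
  by rewrite !mulr_ge0 ?powR_ge0// ltW.
have C1 : 0 <= CF * CF by rewrite mulr_ge0// ltW.
rewrite powRM ?(mulr_ge0 C1) ?powR_ge0// [(CF * CF * _) `^ _]powRM ?powR_ge0// -powRrM.
rewrite mulrAC (_ : - _ * pm = - (qQ j * (pm - 1)))//.
by field; rewrite gt_eqF.
Qed.

Let N_bad_pow j y : Q j y -> bad j y ->
  [/\ X y `^ K1 <= ell j `^ (delta / 2), N j <= C0 `^ Pc * N j `^ qQ j &
      N j `^ (- pc y) <= C0 `^ Pc * ell j `^ (- delta)].
Proof.
move=> Qjy bjy; have [e1 Ni Xe] := N_big Qjy bjy; have N0 := N_gt0 j.
have e0 : 0 < ell j by [].
have Ni1 : (N j)^-1 <= C0.
  apply: le_trans Ni _; rewrite ler_piMr ?(ltW C0_gt0)//.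
  by rewrite powRN invf_le1 ?powR_gt0// -(powRr0 (ell j)) ler_powR// ltW.
split.
- apply: (@le_trans _ _ ((X y `^ kap) `^ (delta / 2))).
    rewrite -[leRHS]powRrM ler_powR//.
    have -> : kap * (delta / 2) = K1 + delta / 2 by rewrite /kap; field; rewrite gt_eqF.
    by rewrite lerDl divr_ge0// ltW.
  by rewrite ge0_ler_powR ?nnegrE ?powR_ge0 ?(ltW e0)// divr_ge0// ltW.
- rewrite -ler_pdivrMr ?powR_gt0// -{1}(powRr1 (ltW N0)) -powRB ?(gt_eqF N0) ?implybT//.
  rewrite -opprB -powR_invl.
  have a0 : 0 <= qQ j - 1 by rewrite subr_ge0 ltW.
  apply: (@le_trans _ _ (C0 `^ (qQ j - 1))).
    by rewrite ge0_ler_powR ?nnegrE ?invr_ge0 ?(ltW N0) ?(ltW C0_gt0).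
  by rewrite ler_powR// lerBlDr (le_trans (qQ_le j))// lerDl.
- rewrite -powR_invl; apply: (@le_trans _ _ ((C0 * ell j `^ (- delta)) `^ pc y)).
    rewrite ge0_ler_powR ?nnegrE ?invr_ge0 ?(ltW N0) ?(ltW (pc_gt0 y))//.
    by rewrite mulr_ge0 ?powR_ge0// ltW.
  rewrite (powRM _ (ltW C0_gt0) (powR_ge0 _ _)); apply: ler_pM; rewrite ?powR_ge0//.
    by rewrite ler_powR.
  rewrite -powRrM ler_powR// mulNr lerN2 ler_peMr ?(ltW delta_gt0)//.
  exact: ltW.
Qed.

Let sgX y : sg y = X y `^ K1 * (X y `^ (- K1) * sg y).
Proof. by rewrite mulrA -powRD ?(gt_eqF (X_gt0 y)) ?implybT// subrr powRr0 mul1r. Qed.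

Let nXsg : nnmfun (fun y => X y `^ (- K1) * sg y).
Proof. by apply: nnmfunM => //; apply: nnmfun_powR. Qed.

Let Xsg_ge0 y : 0 <= X y `^ (- K1) * sg y. Proof. exact: nnmfun_ge0 nXsg. Qed.

Let good_or_bad j y : bad j y \/ good j y.
Proof.
by have [lt|le] := ltP (L0 * X y `^ kap) (ell j); [left|right].
Qed.

Let D1 := CF + C0 `^ Pc * C0 * C6.

(** With [sg_lower], the substitute for the constant exponent identity that the sg-measure of a cube
    is N^(p'). At good points p' is frozen in sg = N^(p') V; at bad points X^K1 <= ell^delta <= C0
    N, and the decay of X^(-K1) sg is used. *)
Let sg_upper j : (\int[mu]_(y in Q j) (sg y)%:E <= (D1 * N j `^ qQ j)%:E)%E.
Proof.
have N0 := N_gt0 j; have CF0 : 0 <= CF by exact: expR_ge0.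
have C00 := ltW C0_gt0; have mQj := mQ j.
pose c := C0 `^ Pc * C0 * N j `^ qQ j.
have c0 : 0 <= c by rewrite !mulr_ge0 ?powR_ge0.
have c'0 : 0 <= CF * N j `^ qQ j by rewrite mulr_ge0 ?powR_ge0.
apply: (@le_trans _ _ (\int[mu]_(y in Q j)
    (CF * N j `^ qQ j * V j y + c * (X y `^ (- K1) * sg y))%:E)%E).
  apply: nnint_le => [y|y Qjy]; first exact: ltW.
  have V0 := ltW (V_gt0 j y).
  have [bjy|gjy] := good_or_bad j y.
    have [h1 h2 _] := N_bad_pow Qjy bjy; have [e1 Ni _] := N_big Qjy bjy.
    rewrite {1}sgX; apply: (@le_trans _ _ (c * (X y `^ (- K1) * sg y))).
      apply: ler_wpM2r => //; apply: (le_trans h1).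
      apply: (@le_trans _ _ (ell j `^ delta)).
        by rewrite ler_powR// ler_pdivrMr// ler_peMr ?ler1n// ltW.
      apply: (@le_trans _ _ (C0 * N j)).
        have := Ni; rewrite powRN ler_pdivlMr ?powR_gt0// mulrC.
        by rewrite ler_pdivrMr// mulrC.
      rewrite /c -mulrA mulrCA; exact: ler_wpM2l.
    by rewrite lerDr mulr_ge0.
  apply: (@le_trans _ _ (CF * N j `^ qQ j * V j y)); last by rewrite lerDl mulr_ge0.
  have -> : sg y = N j `^ pc y * V j y.
    rewrite VE mulrCA -powRD ?(gt_eqF N0) ?implybT// subrr powRr0 mulr1//.
  apply: ler_wpM2r => //; apply: (freeze Qjy gjy) => //; first exact: N_range.
  by right.
rewrite nnintD//; [|exact: nnmfunZ|exact: nnmfunZ].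
rewrite nnintZ// nnintZ//.
have -> : D1 * N j `^ qQ j = CF * N j `^ qQ j * 1 + c * C6 by rewrite /D1 /c; ring.
rewrite EFinD (EFinM (CF * _) 1) (EFinM c C6); apply: leeD; apply: lee_wpmul2l; rewrite ?lee_fin//.
by apply: le_trans sigma_decay; exact: nnint_subset.
Qed.

Let sg_lower j (F : set T) : measurable F -> F `<=` Q j ->
  (c1%:E <= \int[mu]_(y in F) (V j y)%:E)%E ->
  ((c1 / 2 * N j `^ qQ j)%:E <= CF%:E * \int[mu]_(y in F) (sg y)%:E)%E.
Proof.
move=> mF FQ c1F; have N0 := N_gt0 j; have CF0 : 0 <= CF by exact: expR_ge0.
have C00 := ltW C0_gt0; have L00 : 0 < L0 by apply: lt_le_trans L0_ge1.
pose c := C0 `^ Pc * L0 `^ (- (delta / 2)).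
have c0 : 0 <= c by rewrite mulr_ge0 ?powR_ge0.
pose c' := CF * N j `^ (- qQ j).
have c'0 : 0 <= c' by rewrite mulr_ge0 ?powR_ge0.
(* The choice of [L0]: on the bad points V is at most c X^(-K1) sg, whose integral is at most c C6,
   so half of the mass [c1] remains on the good points. *)
have cC6 : c * C6 <= c1 / 2.
  have -> : c * C6 = C0 `^ Pc * C6 / L0 `^ (delta / 2) by rewrite /c powRN mulrAC.
  rewrite ler_pdivrMr; last exact: powR_gt0 L00.
  have -> : L0 `^ (delta / 2) = 1 + C0 `^ (Pc + 1) * C6 * 2 / c1.
    rewrite /L0 -[LHS]powRrM (_ : 2 / delta * (delta / 2) = 1); last first.
      by field; rewrite gt_eqF.
    by rewrite powRr1// addr_ge0// !mulr_ge0 ?powR_ge0// invr_ge0 ltW.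
  rewrite mulrDr mulr1 (_ : c1 / 2 * _ = C0 `^ (Pc + 1) * C6); last first.
    by field; rewrite gt_eqF.
  rewrite -[leLHS]add0r; apply: lerD; first by rewrite divr_ge0// ltW.
  by rewrite ler_wpM2r// ler_powR// lerDl.
have : (\int[mu]_(y in F) (V j y)%:E <= \int[mu]_(y in F)
    (c' * sg y + c * (X y `^ (- K1) * sg y))%:E)%E.
  apply: nnint_le => [y|y /FQ Qjy]; first exact: ltW.
  have s0 := ltW (sg_gt0 y); rewrite VE.
  have [bjy|gjy] := good_or_bad j y.
    have [h1 _ h3] := N_bad_pow Qjy bjy; have [e1 _ _] := N_big Qjy bjy.
    apply: (@le_trans _ _ (c * (X y `^ (- K1) * sg y))); last by rewrite lerDr mulr_ge0.
    rewrite {1}sgX mulrAC; apply: ler_wpM2r => //; rewrite mulrC.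
    apply: le_trans (ler_pM _ _ h3 h1) _; rewrite ?powR_ge0//.
    rewrite -mulrA; apply: ler_wpM2l; first exact: powR_ge0.
    rewrite -powRD ?(gt_eqF (ell_gt0 j)) ?implybT//.
    rewrite (_ : - delta + delta / 2 = - (delta / 2)); last by field.
    apply: (ler_powRN L00); last by rewrite divr_ge0// ltW.
    apply: le_trans (ltW bjy); rewrite ler_peMr ?(ltW L00)//.
    by rewrite -(powRr0 (X y)) ler_powR// (le_trans ler01 kap_ge1).
  apply: (@le_trans _ _ (c' * sg y)); last by rewrite lerDl mulr_ge0.
  rewrite mulrC; apply: ler_wpM2r => //; apply: (freeze Qjy gjy) => //; first exact: N_range.
  by right; rewrite -opprD normrN.
rewrite nnintD//; [|exact: nnmfunZ|exact: nnmfunZ].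
rewrite [X in (_ <= X + _)%E -> _]nnintZ// [X in (_ <= _ + X)%E -> _]nnintZ//.
move=> /(le_trans c1F).
have : (\int[mu]_(y in F) (X y `^ (- K1) * sg y)%:E <= C6%:E)%E.
  by apply: le_trans sigma_decay; exact: nnint_subset.
have : (0 <= \int[mu]_(y in F) (X y `^ (- K1) * sg y)%:E)%E.
  by apply: nnint_ge0 => y; exact: Xsg_ge0.
case: (\int[mu]_(y in F) (X y `^ (- K1) * sg y)%:E)%E => [x| |]//.
have : (0 <= \int[mu]_(y in F) (sg y)%:E)%E by apply: nnint_ge0 => y; exact: ltW.
case: (\int[mu]_(y in F) (sg y)%:E)%E => [z| |]//; last first.
  by move=> *; rewrite gt0_muley ?leey// lte_fin expR_gt0.
rewrite !lee_fin => z0 x0 xC cs.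
have h' : c1 / 2 <= c' * z.
  have cx : c * x <= c * C6 by exact: ler_wpM2l.
  by move: cs cx cC6; lra.
apply: le_trans (ler_wpM2r (powR_ge0 (N j) (qQ j)) h') _.
have -> : c' * z * N j `^ qQ j = CF * z * (N j `^ (- qQ j) * N j `^ qQ j).
  by rewrite /c'; ring.
by rewrite -powRD ?(gt_eqF N0) ?implybT// addNr powRr0 mulr1.
Qed.

(** * Summation over a laminar family of cubes *)

Section family.
Variables (I : finType) (c : I -> J) (gen : I -> int) (S : pred I) (E : I -> set T).
Hypothesis ell_gen : forall i, ell (c i) = 2 `^ (gen i)%:~R.
Hypothesis lam : laminar (fun i => Q (c i)) gen.
Hypotheses (mE : forall i, measurable (E i)) (EQ : forall i, S i -> E i `<=` Q (c i)).
Hypothesis overlapE : forall x, (#|[pred i | S i && `[< E i x >]]| <= 2)%N.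
Hypothesis E_mass : forall i, S i -> (c1%:E <= \int[mu]_(y in E i) (V (c i) y)%:E)%E.

(** The larger of 2^(-delta/2) and 1/2: a common ratio for the errors decaying like ell^(-delta/2)
    and those decaying like 1/Lam. *)
Let theta := 2 `^ (- Num.min (delta / 2) 1) : R.

Let min_gt0 : 0 < Num.min (delta / 2) 1.
Proof. by rewrite lt_min ltr01 divr_gt0. Qed.

Let theta01 : 0 <= theta < 1.
Proof.
rewrite powR_ge0/= -ltr_ln ?posrE ?powR_gt0// ln1 ln_powR.
by rewrite pmulr_llt0 ?ln_gt0 ?ltr1n// oppr_lt0.
Qed.

Let theta_ge (a : R) n : Num.min (delta / 2) 1 <= a -> 2 `^ (- (a * n%:R)) <= theta ^+ n.
Proof.
move=> ha; rewrite -powR_mulrn ?powR_ge0// -powRrM ler_powR ?ler1n//.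
by rewrite mulNr lerN2 ler_wpM2r.
Qed.

(** [Lam] contains both ell and its inverse, so its reciprocal decays for large and for small cubes
    alike. *)
Let Lam_gen i y : (Lam (c i) y)^-1 <= theta ^+ `|gen i|%N.
Proof.
apply: le_trans (@theta_ge 1 _ _); last by rewrite ge_min lexx orbT.
rewrite mul1r powRN lef_pV2 ?posrE ?powR_gt0 ?Lam_gt0//.
have X0 := ltW (X_gt0 y); rewrite natr_absz.
have [g0|g0] := leP 0 (gen i).
  rewrite ger0_norm// -ell_gen /Lam.
  by rewrite addrAC lerDr addr_ge0// invr_ge0 ltW.
rewrite ltr0_norm// intrN powRN -ell_gen /Lam.
by rewrite lerDr addr_ge0// ltW.
Qed.

Let Derr := 2 / (1 - theta) * ((C0 `^ Pc + C0 + 1) * (1 + C6)).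

Let err_point i y : Q (c i) y ->
  err (c i) y <= (C0 `^ Pc + C0 + 1) * (h y `^ p y + X y `^ (- K1) * sg y) *
    theta ^+ `|gen i|%N.
Proof.
move=> Qy; have L1 := Lam_ge1 (c i) y; have L0' := Lam_gt0 (c i) y.
have X0 := X_gt0 y; have C00 := ltW C0_gt0; have sgy := ltW (sg_gt0 y).
have t0 : 0 <= theta ^+ `|gen i|%N by rewrite exprn_ge0// powR_ge0.
have hp0 : 0 <= h y `^ p y by exact: powR_ge0.
have Xs0 := Xsg_ge0 y; have CP0 : 0 <= C0 `^ Pc by exact: powR_ge0.
have LX : X y <= Lam (c i) y by rewrite /Lam -addrA lerDl addr_ge0// ?invr_ge0 ltW.
have t1 : C0 * ell (c i) `^ (- delta) * (h y * v y) * \1_(bad (c i)) y <=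
    C0 * (h y `^ p y + X y `^ (- K1) * sg y) * theta ^+ `|gen i|%N.
  rewrite indicE; have [bjy|nb] := pselect (bad (c i) y); last first.
    by rewrite memNset// mulr0 !mulr_ge0// addr_ge0.
  rewrite mem_set// mulr1; have [e1 _ _] := N_big Qy bjy.
  have [h1 _ _] := N_bad_pow Qy bjy.
  have hv : h y * v y * X y `^ (- K1) <= h y `^ p y + X y `^ (- K1) * sg y.
    rewrite -mulrA; apply: le_trans (young_le (p_gt1 y) (h_ge0 y) _) _.
      by rewrite mulr_ge0 ?powR_ge0// ltW.
    rewrite lerD2l powRM ?powR_ge0 ?(ltW (v_gt0 y))// mulrC ler_wpM2r//.
    by rewrite -[leLHS]powRrM ler_powR// mulNr lerN2 ler_peMr// (ltW (pc_gt1 y)).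
  rewrite -!mulrA ler_wpM2l//.
  apply: (@le_trans _ _ (theta ^+ `|gen i|%N * X y `^ (- K1) * (h y * v y))); last first.
    by rewrite [leRHS]mulrC -mulrA; apply: ler_wpM2l => //; rewrite mulrC.
  apply: ler_wpM2r; first by rewrite mulr_ge0// ltW.
  (* One half of the power decays with the generation, which is nonnegative because ell >= 1 at a
     bad point; the other half pays for the factor X^K1. *)
  have -> : - delta = - (delta / 2) - delta / 2 by field.
  rewrite powRD ?(gt_eqF (ell_gt0 _)) ?implybT//; apply: ler_pM; rewrite ?powR_ge0//.
    have g0 : 0 <= gen i.
      move: e1; rewrite ell_gen; apply: contraTT; rewrite -!ltNge => g0.
      rewrite -ltr_ln ?posrE ?powR_gt0// ln1 ln_powR pmulr_llt0 ?ln_gt0 ?ltr1n//.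
      by rewrite ltrz0.
    apply: le_trans (@theta_ge (delta / 2) _ _); last by rewrite ge_min lexx.
    by rewrite ell_gen -powRrM natr_absz ger0_norm// mulrN mulrC.
  by rewrite !powRN lef_pV2 ?posrE ?powR_gt0.
have t2 : Lam (c i) y `^ (- K) * V (c i) y <=
    C0 `^ Pc * (h y `^ p y + X y `^ (- K1) * sg y) * theta ^+ `|gen i|%N.
  apply: (@le_trans _ _ (C0 `^ Pc * (X y `^ (- K1) * sg y) * theta ^+ `|gen i|%N)); last first.
    by apply: ler_wpM2r => //; apply: ler_wpM2l => //; rewrite lerDr.
  have Nle : N (c i) `^ (- pc y) <= C0 `^ Pc * Lam (c i) y `^ (K0 * Pc).
    rewrite powRrM -powRM ?powR_ge0// -powR_invl.
    have Ni : (N (c i))^-1 <= C0 * Lam (c i) y `^ K0.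
      rewrite -[leLHS]mul1r ler_pdivrMr//.
      have := N_lower Qy; rewrite powRN; set b := X y + _ => hN.
      have b1 : 1 <= b by exact: base_ge1.
      have b0 : 0 < b by apply: lt_le_trans b1.
      have bL : b `^ K0 <= Lam (c i) y `^ K0.
        rewrite ge0_ler_powR ?nnegrE ?(ltW b0) ?(ltW L0')//.
        by rewrite /b /Lam addrAC lerDl ltW.
      rewrite mulrAC -ler_pdivrMr ?powR_gt0// mul1r; apply: le_trans hN.
      by rewrite lef_pV2 ?posrE ?powR_gt0.
    apply: (@le_trans _ _ ((C0 * Lam (c i) y `^ K0) `^ pc y)).
      rewrite ge0_ler_powR ?nnegrE ?(ltW (pc_gt0 y)) ?invr_ge0 ?(ltW (N_gt0 _))//.
      by rewrite mulr_ge0 ?powR_ge0.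
    rewrite ler_powR//; apply: mulr_ege1 => //.
    by rewrite -(powRr0 (Lam (c i) y)) ler_powR.
  rewrite VE [leLHS]mulrCA -mulrA [leRHS](_ : _ =
    sg y * (C0 `^ Pc * (X y `^ (- K1) * theta ^+ `|gen i|%N))); last by ring.
  apply: ler_wpM2l => //; rewrite mulrC.
  apply: le_trans (ler_wpM2r (powR_ge0 _ _) Nle) _.
  rewrite -mulrA; apply: ler_wpM2l => //.
  rewrite -powRD ?(gt_eqF L0') ?implybT//.
  apply: (@le_trans _ _ (Lam (c i) y `^ (- K1 + - 1))).
    rewrite ler_powR// /K.
    have h2 : 0 <= (pm - 1)^-1 by rewrite invr_ge0 subr_ge0 ltW.
    by move: lnC0_ge0 K0_ge0 h2; lra.
  rewrite powRD ?(gt_eqF L0') ?implybT//; apply: ler_pM; rewrite ?powR_ge0//.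
    rewrite !powRN lef_pV2 ?posrE ?powR_gt0//.
    by rewrite ge0_ler_powR ?nnegrE ?(ltW L0') ?(ltW X0).
  by rewrite powR_inv1 ?(ltW L0').
have t3 : h y `^ p y * Lam (c i) y `^ (- (K * (pm - 1))) <=
    1 * (h y `^ p y + X y `^ (- K1) * sg y) * theta ^+ `|gen i|%N.
  rewrite mul1r; apply: ler_pM; rewrite ?powR_ge0// ?lerDl//.
  apply: le_trans (Lam_gen i y); rewrite -powR_inv1 ?(ltW L0')// ler_powR// lerN2.
  have pm0 : 0 < pm - 1 by rewrite subr_gt0.
  rewrite -ler_pdivrMr// mul1r /K.
  have h1 : 0 <= K0 * Pc by rewrite mulr_ge0// ltW.
  by move: lnC0_ge0 K0_ge0 K1_ge0 h1; lra.
by rewrite /err; move: t1 t2 t3; lra.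
Qed.

(** The cubes containing a given y have distinct generations, so the factors theta^|gen| add up to
    at most 2/(1 - theta), times a fixed integrable function. *)
Let err_sum : (\sum_(i | S i) \int[mu]_(y in Q (c i)) (err (c i) y)%:E <= Derr%:E)%E.
Proof.
have th1 : 0 < 1 - theta by rewrite subr_gt0; case/andP: theta01.
have CP0 : 0 <= C0 `^ Pc + C0 + 1 by rewrite !addr_ge0 ?powR_ge0// ltW.
pose g y := h y `^ p y + X y `^ (- K1) * sg y.
have ng : nnmfun g by apply: nnmfunD.
have g1 : (\int[mu]_y (g y)%:E <= (1 + C6)%:E)%E by rewrite nnintD// EFinD leeD.
have c0 : 0 <= 2 / (1 - theta) * (C0 `^ Pc + C0 + 1).
  by rewrite mulr_ge0// divr_ge0// ltW.
rewrite /Derr mulrA; apply: (@le_trans _ _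
  (\int[mu]_y (2 / (1 - theta) * (C0 `^ Pc + C0 + 1) * g y)%:E)%E); last first.
  by rewrite nnintZ// [leRHS]EFinM lee_wpmul2l// lee_fin.
apply: nnint_sum_le => // y _.
apply: (@le_trans _ _ (\sum_(i | S i && `[< Q (c i) y >])
   ((C0 `^ Pc + C0 + 1) * g y) * theta ^+ `|gen i|%N)).
  by apply: ler_sum => i /andP[_ /asboolP]; exact: err_point.
rewrite -mulr_sumr mulrC -[leRHS]mulrA ler_wpM2r ?mulr_ge0 ?(nnmfun_ge0 _ ng)//.
apply: sum_geometric_int => // i j; rewrite !unfold_in.
move=> /andP[_ /asboolP Qi] /andP[_ /asboolP Qj] gij.
have ne : Q (c i) `&` Q (c j) !=set0 by exists y.
by have [|_ ->] := lam ne; rewrite ?gij.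
Qed.

Let G y := (h y `^ p y / sg y) `^ pm^-1.

Let nG : nnmfun G.
Proof.
apply: nnmfun_powR => //; apply: nnmfunM => //.
rewrite (_ : (fun _ => _) = fun y => sg y `^ (-1)); first exact: nnmfun_powR.
by apply/funext => y; rewrite powR_inv1// ltW.
Qed.

Let GsgE y : G y * sg y = H y.
Proof.
have s0 := sg_gt0 y; have pm0 : 0 < pm by apply: lt_trans pm1.
rewrite /G /H (powRM _ (powR_ge0 _ _)) ?invr_ge0 ?(ltW s0)//.
rewrite -[(h y `^ _) `^ _]powRrM -mulrA; congr (_ * _).
rewrite powR_invl -{2}(powRr1 (ltW s0)) -powRD ?(gt_eqF s0) ?implybT//.
by rewrite addrC.
Qed.

Let GpmE y : G y `^ pm * sg y = h y `^ p y.
Proof.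
have s0 := sg_gt0 y; have pm0 : 0 < pm by apply: lt_trans pm1.
rewrite /G -[(_ `^ pm^-1) `^ _]powRrM mulVf ?gt_eqF// powRr1; last first.
  by rewrite divr_ge0 ?powR_ge0// ltW.
by rewrite divfK// gt_eqF.
Qed.

Let Ccar := 2 `^ (2 * pm + 1) / (1 - 2 `^ (1 - pm)) : R.
Let Dmid := D1 `^ pm * (CF * 2 / c1) * Ccar.

Let sgint j := fine (\int[mu]_(y in Q j) (sg y)%:E)%E.

Let sgintE j : (\int[mu]_(y in Q j) (sg y)%:E = (sgint j)%:E)%E.
Proof.
rewrite fineK// ge0_fin_numE; first exact: sg_fin.
by apply: nnint_ge0 => y; exact: ltW.
Qed.

(** By [sg_upper] and [sg_lower], each term is at most a constant times the pm-th power of the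
    sg-average of G over the cube times the sg-measure of [E i]. This is the Carleson sum of G, and
    G^pm sg = h^p. *)
Let mid_sum :
  (\sum_(i | S i) (Hint (c i) `^ pm * N (c i) `^ (- (qQ (c i) * (pm - 1))))%:E <= Dmid%:E)%E.
Proof.
have pm0 : 0 < pm by apply: lt_trans pm1.
have CF0 : 0 < CF by exact: expR_gt0.
have D10 : 0 <= D1 by rewrite addr_ge0 ?(ltW CF0)// !mulr_ge0 ?powR_ge0// ltW.
have Ccar0 : 0 <= Ccar.
  rewrite divr_ge0 ?powR_ge0// subr_ge0 -[leRHS](powRr0 2) ler_powR ?ler1n//.
  by rewrite subr_le0 ltW.
pose A i := Hint (c i) / sgint (c i).
have sgint0 j : 0 <= sgint j.
  by apply: fine_ge0; apply: nnint_ge0 => y; exact: ltW.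
have A0 i : 0 <= A i by rewrite divr_ge0.
have avgA i : S i -> ((A i)%:E * \int[mu]_(x in Q (c i)) (sg x)%:E <=
    \int[mu]_(x in Q (c i)) (G x * sg x)%:E)%E.
  move=> _; under [leRHS]eq_integral do rewrite GsgE.
  rewrite HintE sgintE -EFinM lee_fin /A.
  have [->|s0] := eqVneq (sgint (c i)) 0; first by rewrite mulr0.
  by rewrite divfK.
have car := carleson lam (fun i => mQ (c i)) nsg nG (fun i => sg_fin (c i)) pm1 mE EQ
  A0 avgA overlapE.
have D0 : 0 <= D1 `^ pm * (CF * 2 / c1).
  by rewrite mulr_ge0 ?powR_ge0// !mulr_ge0 ?(ltW CF0)// invr_ge0 ltW.
apply: (@le_trans _ _ ((D1 `^ pm * (CF * 2 / c1))%:E *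
    \sum_(i | S i) (A i `^ pm)%:E * \int[mu]_(x in E i) (sg x)%:E)%E); last first.
  rewrite [leRHS](EFinM (D1 `^ pm * (CF * 2 / c1)) Ccar).
  apply: lee_wpmul2l; first by rewrite lee_fin.
  apply: le_trans car _; rewrite -[leRHS]mule1; apply: lee_wpmul2l => //.
  by under eq_integral do rewrite GpmE.
rewrite ge0_sume_distrr; last first.
  move=> i _; apply: mule_ge0; first by rewrite lee_fin powR_ge0.
  by apply: nnint_ge0 => y; exact: ltW.
apply: lee_sum => i Si; set j := c i.
have N0 : 0 < N j by []; have Nq0 : 0 < N j `^ qQ j by exact: powR_gt0.
have up := sg_upper j; rewrite sgintE lee_fin in up.
have low := sg_lower (mE i) (EQ Si) (E_mass Si).
have [e eE /andP[e0 eQ]] : exists2 e, (\int[mu]_(y in E i) (sg y)%:E)%E = e%:E &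
    0 <= e <= sgint j.
  apply: le_EFin_fine; first by apply: nnint_ge0 => y; exact: ltW.
  by rewrite -sgintE; apply: nnint_subset => //; exact: EQ.
rewrite eE -EFinM lee_fin in low; rewrite eE -!EFinM lee_fin.
have sg0 : 0 < sgint j.
  apply: lt_le_trans eQ; rewrite -(pmulr_rgt0 _ CF0); apply: lt_le_trans low.
  by rewrite mulr_gt0// divr_gt0.
have -> : Hint j = A i * sgint j by rewrite /A divfK// gt_eqF.
rewrite (powRM _ (A0 i) (ltW sg0)).
rewrite [leRHS](_ : _ = A i `^ pm * (D1 `^ pm * (CF * 2 / c1 * e))); last by ring.
rewrite -mulrA; apply: ler_wpM2l; first exact: powR_ge0.
have up' : sgint j `^ pm <= D1 `^ pm * N j `^ (qQ j * pm).
  rewrite powRrM -powRM ?(ltW Nq0)//.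
  by rewrite ge0_ler_powR ?nnegrE ?(ltW pm0) ?(ltW sg0)// mulr_ge0// ltW.
apply: le_trans (ler_wpM2r (powR_ge0 _ _) up') _.
rewrite -[leLHS]mulrA; apply: ler_wpM2l; first exact: powR_ge0.
rewrite -powRD ?(gt_eqF N0) ?implybT//.
rewrite (_ : qQ j * pm + _ = qQ j); last by ring.
have -> : CF * 2 / c1 * e = CF * e / (c1 / 2) by field; rewrite gt_eqF.
by rewrite ler_pdivlMr ?divr_gt0// mulrC.
Qed.

Lemma linear_sum (b : I -> R) :
  (forall i, \int[mu]_(y in Q (c i)) (h y * (v y / N (c i)))%:E = (b i)%:E)%E ->
  \sum_(i | S i) (b i / 2) `^ pQ (c i) <= Derr + (CF * CF) `^ pm * Dmid.
Proof.
move=> bE; rewrite -lee_fin -sumEFin.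
have CC : (0 <= ((CF * CF) `^ pm)%:E)%E by rewrite lee_fin powR_ge0.
apply: (@le_trans _ _ (\sum_(i | S i) (\int[mu]_(y in Q (c i)) (err (c i) y)%:E +
  ((CF * CF) `^ pm)%:E * (Hint (c i) `^ pm * N (c i) `^ (- (qQ (c i) * (pm - 1))))%:E))%E).
  apply: lee_sum => i _; rewrite -EFinM mulrA; exact: cube_estimate.
rewrite big_split/= EFinD; apply: leeD; first exact: err_sum.
rewrite -ge0_sume_distrr; last by move=> i _; rewrite lee_fin mulr_ge0 ?powR_ge0.
by rewrite EFinM; apply: lee_wpmul2l => //; exact: mid_sum.
Qed.

End family.
End one_function.

Lemma linear_estimate : exists C : R, forall (h : T -> R),
  nnmfun h -> (\int[mu]_y (h y `^ p y)%:E <= 1)%E ->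
  forall (I : finType) (c : I -> J) (gen : I -> int) (S : pred I) (E : I -> set T),
  (forall i, ell (c i) = 2 `^ (gen i)%:~R) ->
  laminar (fun i => Q (c i)) gen ->
  (forall i, measurable (E i)) -> (forall i, S i -> E i `<=` Q (c i)) ->
  (forall x, (#|[pred i | S i && `[< E i x >]]| <= 2)%N) ->
  (forall i, S i ->
    (c1%:E <= \int[mu]_(y in E i) ((v y / N (c i)) `^ (p y / (p y - 1)))%:E)%E) ->
  forall b : I -> R,
  (forall i, \int[mu]_(y in Q (c i)) (h y * (v y / N (c i)))%:E = (b i)%:E)%E ->
  \sum_(i | S i) (b i / 2) `^ pQ (c i) <= C.
Proof.
(* The constant is read off from [linear_sum]; it depends on neither [h] nor the family. *)
eexists => h nh h1 I c gen S E eg lam mE EQ ov Em b bE.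
exact: (linear_sum nh h1 eg lam mE EQ ov Em bE).
Qed.
End linear.

(** * Norms and the generalized Hoelder inequality *)

Section lnorm.
Context d (T : measurableType d) (R : realType) (mu : {measure set T -> \bar R}).
Variables (e u : T -> R) (em ep : R).
Hypotheses (em0 : 0 < em) (ep0 : 0 < ep) (me : measurable_fun setT e) (nu : nnmfun u).
Hypotheses (u_gt0 : forall x, 0 < u x) (e_bnd : forall x, em <= e x <= ep).

Definition lnorm (E : set T) : \bar R :=
  ereal_inf [set l%:E | l in [set l : R | 0 < l /\
    (\int[mu]_(x in E) ((u x / l) `^ e x)%:E <= 1)%E]].

Local Notation modular E l := (\int[mu]_(x in E) ((u x / l) `^ e x)%:E)%E.

Let e_gt0 x : 0 < e x.
Proof. by case/andP: (e_bnd x) => h _; exact: lt_le_trans h. Qed.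

Lemma nnmfun_scaled_powR l : 0 < l -> nnmfun (fun x => (u x / l) `^ e x).
Proof.
move=> l0; apply: nnmfun_powR => //; apply: nnmfunM => //.
by apply: nnmfun_cst; rewrite invr_ge0 ltW.
Qed.

Lemma modular_le E a b : measurable E -> 0 < a -> a <= b ->
  (modular E a <= ((b / a) `^ ep)%:E * modular E b)%E.
Proof.
move=> mE a0 ab; have b0 := lt_le_trans a0 ab.
rewrite -nnintZ ?powR_ge0//; last exact: nnmfun_scaled_powR.
apply: nnint_le => [x|x _]; first exact: powR_ge0.
have -> : u x / a = b / a * (u x / b) by field; rewrite !gt_eqF.
have ba0 : 0 <= b / a by rewrite divr_ge0// ltW.
have ub0 : 0 <= u x / b by rewrite divr_ge0// ltW.
rewrite (powRM _ ba0 ub0); apply: ler_wpM2r; first exact: powR_ge0.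
rewrite ler_powR//; last by case/andP: (e_bnd x).
by rewrite ler_pdivlMr// mul1r.
Qed.

Lemma modular_ge E a b : measurable E -> 0 < a -> a <= b ->
  (((b / a) `^ em)%:E * modular E b <= modular E a)%E.
Proof.
move=> mE a0 ab; have b0 := lt_le_trans a0 ab.
rewrite -nnintZ ?powR_ge0//; last exact: nnmfun_scaled_powR.
apply: nnint_le => [x|x _]; first by rewrite mulr_ge0 ?powR_ge0.
have -> : u x / a = b / a * (u x / b) by field; rewrite !gt_eqF.
have ba0 : 0 <= b / a by rewrite divr_ge0// ltW.
have ub0 : 0 <= u x / b by rewrite divr_ge0// ltW.
rewrite (powRM _ ba0 ub0); apply: ler_wpM2r; first exact: powR_ge0.
rewrite ler_powR//; last by case/andP: (e_bnd x).
by rewrite ler_pdivlMr// mul1r.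
Qed.

Lemma modular_mono E a b : 0 < a -> a <= b -> (modular E b <= modular E a)%E.
Proof.
move=> a0 ab; have b0 := lt_le_trans a0 ab.
apply: nnint_le => [x|x _]; first exact: powR_ge0.
rewrite ge0_ler_powR ?nnegrE ?(ltW (e_gt0 x)) ?divr_ge0 ?(ltW a0) ?(ltW b0) ?(ltW (u_gt0 x))//.
by rewrite ler_wpM2l ?lef_pV2 ?posrE// ltW.
Qed.

Lemma modular_gt0 E l : measurable E -> 0 < l -> (0 < mu E)%E -> (0 < modular E l)%E.
Proof.
move=> mE l0 muE; rewrite lt_neqAle nnint_ge0 ?andbT; last by move=> x; exact: powR_ge0.
apply/negP => /eqP /esym int0.
have mf := nnmfun_EFin (D := E) (nnmfun_scaled_powR l0).
have : (\int[mu]_(x in E) `|((u x / l) `^ e x)%:E| = 0)%E.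
  rewrite -[RHS]int0; apply: eq_integral => x _.
  by rewrite gee0_abs// lee_fin powR_ge0.
move/(ae_eq_integral_abs mu mE mf) => [A [mA A0 sub]].
have EA : E `<=` A.
  move=> x Ex; apply: sub => /= /(_ Ex) [] /eqP.
  by rewrite gt_eqF// powR_gt0// divr_gt0.
have h : (mu E <= mu A)%E := le_measure mu (mem_set mE) (mem_set mA) EA.
by have := lt_le_trans muE h; rewrite A0 ltxx.
Qed.

Lemma lnorm_ge0 E : (0 <= lnorm E)%E.
Proof. by apply: le_ereal_inf_tmp => _ [l [l0 _] <-]; rewrite lee_fin ltW. Qed.

Lemma lnorm_subset E F : measurable E -> measurable F -> E `<=` F ->
  (lnorm E <= lnorm F)%E.
Proof.
move=> mE mF EF; apply: ereal_inf_le_tmp => _ [l [l0 h] <-]; exists l => //; split => //.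
by apply: le_trans h; apply: nnint_subset => //; exact: nnmfun_scaled_powR.
Qed.

Lemma lnorm_lt_modular E l : 0 < l -> (lnorm E < l%:E)%E -> (modular E l <= 1)%E.
Proof.
move=> l0 /ereal_inf_lt[_ [k [k0 hk] <-]]; rewrite lte_fin => kl.
by apply: le_trans hk; apply: modular_mono => //; exact: ltW.
Qed.

Lemma lnorm_gt_modular E l : 0 < l -> (l%:E < lnorm E)%E -> (1 < modular E l)%E.
Proof.
move=> l0 h; rewrite ltNge; apply/negP => h1.
have : (lnorm E <= l%:E)%E by apply: ereal_inf_lbound; exists l.
by rewrite leNgt h.
Qed.

Variable E : set T.
Hypotheses (mE : measurable E) (muE : (0 < mu E)%E) (E_fin : (lnorm E < +oo)%E).

Lemma lnormE : lnorm E = (fine (lnorm E))%:E.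
Proof. by rewrite fineK// ge0_fin_numE// lnorm_ge0. Qed.

(** If the modular at k is t, then it exceeds one at every l < k t^(1/em), because it grows at least
    like (k/l)^em when k is lowered to l. That t > 0 comes from [u_gt0] and [muE]. *)
Lemma fine_lnorm_gt0 : 0 < fine (lnorm E).
Proof.
have [_ [k [k0 hk] <-] kE] := ereal_inf_lt E_fin.
have m0 := modular_gt0 mE k0 muE.
have [t tE /andP[t0' t1]] := le_EFin_fine (ltW m0) hk.
rewrite tE lte_fin in m0.
apply: (@lt_le_trans _ _ (k * t `^ em^-1)); first by rewrite mulr_gt0// powR_gt0.
rewrite -lee_fin -lnormE; apply: le_ereal_inf_tmp => _ [l [l0 hl] <-].
rewrite lee_fin leNgt; apply/negP => lk.
have lk' : l <= k.
  apply: ltW; apply: lt_le_trans lk _; rewrite ler_piMr ?(ltW k0)//.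
  have -> : 1 = 1 `^ em^-1 :> R by rewrite powR1.
  by rewrite ge0_ler_powR ?nnegrE// invr_ge0 ltW.
have := le_trans (modular_ge mE l0 lk') hl; rewrite tE -EFinM lee_fin.
rewrite leNgt => /negP; apply.
have kl : t `^ (- em^-1) < k / l.
  by rewrite ltr_pdivlMr// powRN -ltr_pdivlMl ?invr_gt0 ?powR_gt0// invrK mulrC.
have : (t `^ (- em^-1)) `^ em < (k / l) `^ em.
  by rewrite gt0_ltr_powR ?nnegrE ?powR_ge0// divr_ge0// ltW.
rewrite -powRrM mulNr mulVf ?gt_eqF// powR_inv1// => h.
by rewrite -ltr_pdivrMr// mul1r.
Qed.

Lemma modular_lnorm_le1 : (modular E (fine (lnorm E)) <= 1)%E.
Proof.
have N0 := fine_lnorm_gt0; set N := fine _ in N0 *.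
have upper l : N < l -> (modular E N <= ((l / N) `^ ep)%:E)%E.
  move=> Nl; have l0 := lt_trans N0 Nl.
  apply: le_trans (modular_le mE N0 (ltW Nl)) _; rewrite -[leRHS]mule1.
  apply: lee_wpmul2l; first by rewrite lee_fin powR_ge0.
  by apply: lnorm_lt_modular => //; rewrite lnormE lte_fin.
have m0 := ltW (modular_gt0 mE N0 muE).
have N2 : N < 2 * N by rewrite ltr_pMl// ltr1n.
have [t tE /andP[t0 _]] := le_EFin_fine m0 (upper _ N2).
rewrite tE lee_fin leNgt; apply/negP => t1.
(* At [r] times the norm, the scaling bound gives r^ep = t^(1/2) as an upper bound for t, which is
   impossible for t > 1. *)
pose r := t `^ (ep^-1 / 2).
have r1 : 1 < r.
  rewrite -ltr_ln ?posrE ?powR_gt0 ?(lt_trans _ t1)// ln1 ln_powR mulr_gt0 ?ln_gt0//.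
  by rewrite divr_gt0// invr_gt0.
have : N < r * N by rewrite ltr_pMl.
move/upper; rewrite tE lee_fin mulfK ?gt_eqF// /r -powRrM leNgt => /negP; apply.
rewrite (_ : ep^-1 / 2 * ep = 2^-1); last by field; rewrite gt_eqF.
rewrite -{2}(powRr1 t0); rewrite -ltr_ln ?posrE ?powR_gt0 ?(lt_trans _ t1)//.
by rewrite !ln_powR ltr_pM2r ?ln_gt0// invf_lt1// ltr1n.
Qed.

Lemma modular_lnorm_ge : (((2 `^ (- ep)) : R)%:E <= modular E (fine (lnorm E)))%E.
Proof.
have N0 := fine_lnorm_gt0; set N := fine _ in N0 *.
have N2 : 0 < N / 2 by rewrite divr_gt0.
have NN : N / 2 <= N by rewrite ler_pdivrMr// ler_peMr ?ler1n// ltW.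
have h1 : (1 < modular E (N / 2))%E.
  by apply: lnorm_gt_modular => //; rewrite lnormE lte_fin ltr_pdivrMr// ltr_pMr// ltr1n.
have := le_trans (ltW h1) (modular_le mE N2 NN).
have -> : N / (N / 2) = 2 by field; rewrite gt_eqF.
have : (0 <= modular E N)%E by apply: nnint_ge0 => x; exact: powR_ge0.
case: (\int[mu]_(x in E) ((u x / N) `^ e x)%:E)%E => [y| |]//; last by move=> *; rewrite leey.
rewrite -EFinM !lee_fin => y0 h.
by rewrite powRN -[leLHS]mul1r ler_pdivrMr ?powR_gt0// mulrC.
Qed.

End lnorm.

(** * Generalized Hoelder inequality for exponents whose reciprocals have a constant sum *)

Section generalized_holder.
Context {R : realType} (K : finType).

(** Each a_k is at most M^(1/e_k), where M is the right-hand side, and these powers multiply to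
    M^g. *)
Lemma prod_powR_le_sum (a e : K -> R) (g : R) : 0 < g ->
  (forall k, 0 <= a k) -> (forall k, 0 < e k) -> \sum_k (e k)^-1 = g ->
  (\prod_k a k) `^ g^-1 <= \sum_k a k `^ e k.
Proof.
move=> g0 a0 e0 eg; set M := \sum_k _.
have M0 : 0 <= M by apply: sumr_ge0 => k _; exact: powR_ge0.
have aM k : a k `^ e k <= M.
  by rewrite /M (bigD1 k)//= lerDl; apply: sumr_ge0 => i _; exact: powR_ge0.
have aM' k : a k <= M `^ (e k)^-1.
  have -> : a k = (a k `^ e k) `^ (e k)^-1.
    by rewrite -powRrM divff ?powRr1// gt_eqF.
  by rewrite ge0_ler_powR ?nnegrE ?powR_ge0// invr_ge0 ltW.
have prodM : \prod_k M `^ (e k)^-1 = M `^ g.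
  have [->|MN0] := eqVneq M 0.
    have [k _|K0] := pickP (xpredT : pred K); last first.
      have z : \sum_k (e k)^-1 = 0.
        by rewrite big_pred0// => k; have := K0 k.
      by move: g0; rewrite -eg z ltxx.
    rewrite (bigD1 k)//= powR0 ?mul0r; last by rewrite invr_eq0 gt_eqF.
    by rewrite powR0// gt_eqF.
  rewrite -eg; elim/big_ind2 : _ => //; first by rewrite powRr0.
  by move=> x1 x2 y1 y2 -> ->; rewrite powRD// MN0 implybT.
apply: (@le_trans _ _ ((M `^ g) `^ g^-1)).
  rewrite ge0_ler_powR ?nnegrE ?invr_ge0 ?(ltW g0) ?powR_ge0 ?prodr_ge0//.
  rewrite -prodM; apply: ler_prod => k _; rewrite a0/=; exact: aM'.
by rewrite -powRrM divff ?powRr1// gt_eqF.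
Qed.

Context d (T : measurableType d) (mu : {measure set T -> \bar R}).
Variables (e u : K -> T -> R) (em ep g : R).
Hypotheses (em0 : 0 < em) (ep0 : 0 < ep) (g0 : 0 < g).
Hypotheses (me : forall k, measurable_fun setT (e k)) (nu : forall k, nnmfun (u k)).
Hypotheses (u_gt0 : forall k x, 0 < u k x) (e_bnd : forall k x, em <= e k x <= ep).
Hypotheses (sum_e : forall x, \sum_k (e k x)^-1 = g) (prod_u : forall x, \prod_k u k x = 1).

Let e_gt0 k x : 0 < e k x.
Proof. by case/andP: (e_bnd k x) => h _; exact: lt_le_trans h. Qed.

(** The weights multiply to 1, so 1 = prod N_k prod (u_k/N_k) pointwise; [prod_powR_le_sum] is
    applied to the last product and integrated over [E]. Values of the exponents below 1 are
    covered. *)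
Lemma generalized_holder (E : set T) (N : K -> R) : measurable E ->
  (forall k, 0 < N k) ->
  (forall k, \int[mu]_(x in E) ((u k x / N k) `^ e k x)%:E <= 1)%E ->
  (mu E <= (#|K|%:R * (\prod_k N k) `^ g^-1)%:E)%E.
Proof.
move=> mE N0 mod1; set P := (\prod_k N k) `^ g^-1.
have P0 : 0 <= P by exact: powR_ge0.
have prodN : 0 < \prod_k N k by apply: prodr_gt0.
have nmod k : nnmfun (fun x => (u k x / N k) `^ e k x).
  exact: (nnmfun_scaled_powR (me k) (nu k)).
rewrite -[leLHS]mul1e -integral_cst//.
apply: (@le_trans _ _ (\int[mu]_(x in E) (P * \sum_k (u k x / N k) `^ e k x)%:E)%E).
  apply: nnint_le => [//|x _].
  have uN k : 0 <= u k x / N k by rewrite divr_ge0// ltW.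
  have := prod_powR_le_sum g0 uN (fun k => e_gt0 k x) (sum_e x).
  rewrite big_split/= prodfV prod_u mul1r powR_invl powRN -/P => h.
  have P1 : 0 < P by exact: powR_gt0.
  by rewrite -(divff (lt0r_neq0 P1)) ler_pM2l.
rewrite nnintZ//; last exact: nnmfun_sum.
rewrite nnint_sum// mulrC EFinM; apply: lee_wpmul2l; first by rewrite lee_fin.
apply: le_trans (lee_sum _ (fun k _ => mod1 k)) _.
by rewrite -[X in \sum_(_ | _) X]/(1%:E) sumEFin sumr_const.
Qed.

Variables (B : set T) (A : R).
Hypotheses (mB : measurable B) (B_fin : (mu B < +oo)%E).
Hypothesis N_fin : forall k, (lnorm mu (e k) (u k) B < +oo)%E.
Hypothesis AB : \prod_k fine (lnorm mu (e k) (u k) B) <= A * fine (mu B) `^ g.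

(* The A_{p,q} condition on [B], read together with Hoelder's inequality on [E],
   shows that no factor of the A_{p,q} product can be small on [E]. *)
Lemma lnorm_compare (E : set T) k : measurable E -> E `<=` B -> (0 < mu E)%E ->
  (fine (mu E) / fine (mu B)) `^ g * fine (lnorm mu (e k) (u k) B) <=
  #|K|%:R `^ g * A * fine (lnorm mu (e k) (u k) E).
Proof.
move=> mE EB muE; pose N F i := fine (lnorm mu (e i) (u i) F).
have EBmu : (mu E <= mu B)%E by apply: le_measure => //; rewrite inE.
have muB : (0 < mu B)%E by apply: lt_le_trans EBmu.
have NEB i : (lnorm mu (e i) (u i) E <= lnorm mu (e i) (u i) B)%E.
  exact: (lnorm_subset mu (me i) (nu i)).
have NE_fin i : (lnorm mu (e i) (u i) E < +oo)%E by apply: le_lt_trans (NEB i) _.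
have gE := fun i => fine_lnorm_gt0 em0 (me i) (nu i) (u_gt0 i) (e_bnd i) mE muE (NE_fin i).
have gB := fun i => fine_lnorm_gt0 em0 (me i) (nu i) (u_gt0 i) (e_bnd i) mB muB (N_fin i).
have mod1 := fun i => modular_lnorm_le1 em0 ep0 (me i) (nu i) (u_gt0 i) (e_bnd i) mE muE (NE_fin i).
have h := generalized_holder mE gE mod1.
have mEfin : mu E \is a fin_num by rewrite ge0_fin_numE// (le_lt_trans EBmu).
have mBfin : mu B \is a fin_num by rewrite ge0_fin_numE.
have bE : 0 < fine (mu E) by rewrite fine_gt0// muE/= -ge0_fin_numE.
have bB : 0 < fine (mu B) by rewrite fine_gt0// muB/= -ge0_fin_numE.
rewrite -(fineK mEfin) lee_fin in h.
have pE : 0 < \prod_i N E i by apply: prodr_gt0 => i _; exact: gE.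
have h' : fine (mu E) `^ g <= #|K|%:R `^ g * \prod_i N E i.
  apply: (@le_trans _ _ ((#|K|%:R * (\prod_i N E i) `^ g^-1) `^ g)).
    by rewrite ge0_ler_powR ?nnegrE ?(ltW g0) ?(ltW bE)// mulr_ge0 ?powR_ge0.
  by rewrite powRM ?powR_ge0// -powRrM mulVf ?gt_eqF// powRr1// ltW.
have c0 : 0 <= (#|K|%:R `^ g : R) by exact: powR_ge0.
have q0 : 0 <= \prod_(i | i != k) N B i by apply: prodr_ge0 => i _; exact: ltW (gB i).
(* All factors but the k-th are replaced by their larger values on [B], where the bound [AB] takes
   care of them. *)
have qEB : \prod_(i | i != k) N E i <= \prod_(i | i != k) N B i.
  apply: ler_prod => i _; rewrite (ltW (gE i))/= fine_le// ge0_fin_numE// lnorm_ge0//.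
have q0' : 0 < \prod_(i | i != k) N B i by apply: prodr_gt0 => i _; exact: gB i.
rewrite -/(N B k) -/(N E k).
rewrite powRM ?invr_ge0 ?(ltW bB) ?(ltW bE)// powR_invl powRN.
rewrite mulrAC ler_pdivrMr ?powR_gt0//.
apply: (@le_trans _ _ (#|K|%:R `^ g * N E k * (N B k * \prod_(i | i != k) N B i))).
  rewrite mulrCA -[leRHS]mulrC; apply: (@le_trans _ _ (N B k * (#|K|%:R `^ g * N E k * \prod_(i | i != k) N B i))).
    rewrite mulrC; apply: ler_wpM2l; first exact: ltW (gB k).
    apply: (le_trans h'); rewrite (bigD1 k)//= mulrA; apply: ler_wpM2l => //.
    by rewrite mulr_ge0// ltW// gE.
  by rewrite le_eqVlt; apply/orP; left; apply/eqP; ring.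
have NBE : N B k * \prod_(i | i != k) N B i = \prod_i N B i by rewrite [RHS](bigD1 k).
rewrite NBE; apply: (@le_trans _ _ (#|K|%:R `^ g * N E k * (A * fine (mu B) `^ g))).
  by apply: ler_wpM2l => //; rewrite mulr_ge0// ltW// gE.
by rewrite le_eqVlt; apply/orP; left; apply/eqP; ring.
Qed.

End generalized_holder.

(** * Balls and cubes *)

Section measurable_comp.
Context d (T : measurableType d) (R : realType).
Implicit Type f : T -> R.

Lemma measurable_fun_normr f :
  measurable_fun setT f -> measurable_fun setT (fun x => `|f x|).
Proof. by move=> mf; apply: measurableT_comp. Qed.

Lemma measurable_fun_sqrtr f :
  measurable_fun setT f -> measurable_fun setT (fun x => Num.sqrt (f x)).
Proof.
move=> mf; apply: measurableT_comp mf.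
by apply: continuous_measurable_fun => t; exact: sqrt_continuous.
Qed.
End measurable_comp.

Section geometry.
Context {R : realType} {n : nat}.
Implicit Types (x y z : Rn R n) (a : 'I_n -> R) (r l : R).
Local Notation mu := (lebesgueRn R n).

Lemma measurable_Rn (A : set (borelRn R n)) :
  measurable A -> measurable (A : set (Rn R n)).
Proof. by move=> mA; apply: sub_caratheodory; exact: sub_sigma_algebra. Qed.

Lemma measurable_fun_Rn (f : borelRn R n -> R) :
  measurable_fun setT f -> measurable_fun setT (f : Rn R n -> R).
Proof.
by move=> mf _ Y mY; rewrite setTI; apply: measurable_Rn; rewrite -[X in measurable X]setTI; exact: mf.
Qed.

Lemma measurable_coord i : measurable_fun setT (fun y : Rn R n => (y : 'rV[R]_n) ord0 i).
Proof. by apply: measurable_fun_Rn; exact: measurable_coordRn. Qed.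

Definition l1norm (y : 'rV[R]_n) : R := \sum_i `|y ord0 i|.

Lemma l1norm_ge0 y : 0 <= l1norm y. Proof. by apply: sumr_ge0. Qed.

Lemma l1norm_triangle (x y z : 'rV[R]_n) : l1norm (x - z) <= l1norm (x - y) + l1norm (y - z).
Proof.
rewrite -big_split/=; apply: ler_sum => i _; rewrite !mxE.
by apply: le_trans (ler_normD _ _); rewrite addrA subrK.
Qed.

Lemma l1normD (x y : 'rV[R]_n) : l1norm (x + y) <= l1norm x + l1norm y.
Proof. by rewrite -big_split/=; apply: ler_sum => i _; rewrite !mxE ler_normD. Qed.

Lemma coord_le_l1norm (y : 'rV[R]_n) i : `|y ord0 i| <= l1norm y.
Proof. by rewrite /l1norm (bigD1 i)//= lerDl; exact: sumr_ge0. Qed.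

Lemma l1norm_le (y : 'rV[R]_n) r : (forall i, `|y ord0 i| <= r) -> l1norm y <= n%:R * r.
Proof.
move=> h; apply: le_trans (ler_sum _ (fun i _ => h i)) _.
by rewrite sumr_const card_ord -[leLHS]mulr_natl.
Qed.

Lemma enorm_ge0 (y : 'rV[R]_n) : 0 <= enorm y. Proof. exact: sqrtr_ge0. Qed.

Lemma coord_le_enorm (y : 'rV[R]_n) i : `|y ord0 i| <= enorm y.
Proof.
rewrite -sqrtr_sqr ler_wsqrtr// (bigD1 i)//= lerDl.
by apply: sumr_ge0 => j _; exact: sqr_ge0.
Qed.

Lemma enorm_le_l1norm (y : 'rV[R]_n) : enorm y <= l1norm y.
Proof.
rewrite -[leRHS]ger0_norm ?l1norm_ge0// -sqrtr_sqr ler_wsqrtr//.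
rewrite expr2 {1}/l1norm mulr_suml; apply: ler_sum => i _.
rewrite -real_normK ?num_real// expr2 ler_wpM2l//; exact: coord_le_l1norm.
Qed.

Lemma l1norm_le_enorm (y : 'rV[R]_n) : l1norm y <= n%:R * enorm y.
Proof. by apply: l1norm_le => i; exact: coord_le_enorm. Qed.

Lemma measurable_l1norm : measurable_fun setT (fun y : Rn R n => l1norm y).
Proof.
apply: measurable_sum => i; apply: measurable_fun_normr; exact: measurable_coord.
Qed.

Lemma measurable_eball x r : measurable (eball x r).
Proof.
have mq : measurable_fun setT (fun y : Rn R n => enorm ((y : 'rV[R]_n) - (x : 'rV[R]_n))).
  apply: measurable_fun_sqrtr.
  apply: measurable_sum => i; apply: measurable_funX.
  rewrite (_ : (fun _ => _) = fun y : Rn R n => (y : 'rV[R]_n) ord0 i - (x : 'rV[R]_n) ord0 i).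
    by apply: measurable_funB (measurable_coord i) (measurable_cst _).
  by apply/funext => y; rewrite !mxE.
have mt : measurable [set true] by [].
rewrite -[eball x r]setTI.
exact: (measurable_fun_ltr mq (@measurable_cst _ _ _ _ _ r) measurableT mt).
Qed.

Definition cube a l : set (Rn R n) :=
  [set y | forall i, a i <= (y : 'rV[R]_n) ord0 i < a i + l].

Lemma cube_box a l : cube a l =
  [set y | forall i, `[a i, a i + l[%classic (coordRn i y)].
Proof.
by apply/seteqP; split => y h i; have := h i; rewrite /= /coordRn in_itv.
Qed.

Lemma measurable_cube a l : measurable (cube a l).
Proof.
rewrite cube_box (_ : [set y | _] =
    \bigcap_(i in [set: 'I_n]) ([set y : Rn R n | `[a i, a i + l[%classic (coordRn i y)])).
  apply: fin_bigcap_measurable; first exact: finite_finset.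
  move=> i _; rewrite -[X in measurable X]setTI.
  by apply: (@measurable_coord i) => //; exact: measurable_itv.
by apply/seteqP; split => y h i; [move=> _; exact: h|exact: h].
Qed.

Lemma lebesgueRn_cube a l : 0 < l -> mu (cube a l) = (l ^+ n)%:E.
Proof.
move=> l0; rewrite cube_box.
apply: etrans (lebesgueRn_prod (A := fun i => `[a i, a i + l[%classic) _) _.
  by move=> i; exact: measurable_itv.
rewrite (eq_bigr (fun=> l%:E)); last first.
  move=> i _; rewrite lebesgue_measure_itv/= lte_fin ltrDl l0.
  by rewrite -EFinD addrAC subrr add0r.
by rewrite -[n in RHS](card_ord n) -prodr_const prodEFin.
Qed.

Lemma eball_cube_sub x r : eball x r `<=` cube (fun i => (x : 'rV[R]_n) ord0 i - r) (2 * r).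
Proof.
move=> y; rewrite /eball/= => yr i.
have := le_lt_trans (coord_le_enorm ((y : 'rV[R]_n) - (x : 'rV[R]_n)) i) yr.
rewrite !mxE ltr_norml => /andP[h1 h2]; apply/andP; split; lra.
Qed.

Lemma cube_eball_sub x r : 0 < r ->
  cube (fun i => (x : 'rV[R]_n) ord0 i - r / n.+1%:R) (2 * (r / n.+1%:R)) `<=` eball x r.
Proof.
move=> r0 y h; rewrite /eball/=.
apply: le_lt_trans (enorm_le_l1norm _) _.
apply: (@le_lt_trans _ _ (n%:R * (r / n.+1%:R))).
  apply: l1norm_le => i; have := h i; rewrite !mxE ler_norml => /andP[].
  by move: (r / _) => t h1 h2; apply/andP; split; lra.
by rewrite mulrA ltr_pdivrMr ?ltr0Sn// mulrC ltr_pM2l// ltr_nat.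
Qed.

Lemma lebesgueRn_eball_le x r : 0 < r -> (mu (eball x r) <= ((2 * r) ^+ n)%:E)%E.
Proof.
move=> r0; rewrite -(lebesgueRn_cube (fun i => (x : 'rV[R]_n) ord0 i - r)) ?mulr_gt0//.
by apply: le_measure; rewrite ?inE; [exact: measurable_eball|exact: measurable_cube|exact: eball_cube_sub].
Qed.

Lemma lebesgueRn_eball_ge x r : 0 < r ->
  (((2 * (r / n.+1%:R)) ^+ n)%:E <= mu (eball x r))%E.
Proof.
move=> r0; rewrite -(lebesgueRn_cube (fun i => (x : 'rV[R]_n) ord0 i - r / n.+1%:R)); last first.
  by rewrite mulr_gt0// divr_gt0.
by apply: le_measure; rewrite ?inE; [exact: measurable_cube|exact: measurable_eball|exact: cube_eball_sub].
Qed.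

Lemma lebesgueRn_eball_gt0 x r : 0 < r -> (0 < mu (eball x r))%E.
Proof.
move=> r0; apply: lt_le_trans (lebesgueRn_eball_ge x r0).
by rewrite lte_fin exprn_gt0// mulr_gt0// divr_gt0.
Qed.

Lemma lebesgueRn_eball_fin x r : 0 < r -> mu (eball x r) \is a fin_num.
Proof.
move=> r0; rewrite ge0_fin_numE//.
exact: le_lt_trans (lebesgueRn_eball_le x r0) (ltry _).
Qed.

Lemma fine_eball_le x r : 0 < r -> fine (mu (eball x r)) <= (2 * r) ^+ n.
Proof.
by move=> r0; rewrite -lee_fin fineK ?lebesgueRn_eball_fin//; exact: lebesgueRn_eball_le.
Qed.

Lemma fine_eball_ge x r : 0 < r -> (2 * (r / n.+1%:R)) ^+ n <= fine (mu (eball x r)).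
Proof.
by move=> r0; rewrite -lee_fin fineK ?lebesgueRn_eball_fin//; exact: lebesgueRn_eball_ge.
Qed.

Lemma fine_eball_gt0 x r : 0 < r -> 0 < fine (mu (eball x r)).
Proof.
by move=> r0; rewrite -lte_fin fineK ?lebesgueRn_eball_fin//; exact: lebesgueRn_eball_gt0.
Qed.

Lemma cube_l1norm a l (y z : Rn R n) : cube a l y -> cube a l z ->
  l1norm ((y : 'rV[R]_n) - (z : 'rV[R]_n)) <= n%:R * l.
Proof.
move=> hy hz; apply: l1norm_le => i; rewrite !mxE.
move: (hy i) (hz i) => /andP[h1 h2] /andP[h3 h4].
by rewrite ler_norml; apply/andP; split; lra.
Qed.

End geometry.

(** * Growth of the norms *)

Lemma powR_le1 (R : realType) (t a : R) : 0 <= t <= 1 -> 0 <= a -> t `^ a <= 1.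
Proof.
move=> /andP[t0 t1] a0; have -> : 1 = 1 `^ a :> R by rewrite powR1.
by rewrite ge0_ler_powR ?nnegrE.
Qed.

Lemma nnintU d (T : measurableType d) (R : realType) (mu : {measure set T -> \bar R})
    (E F : set T) (f : T -> R) : measurable E -> measurable F -> nnmfun f ->
  [disjoint E & F] ->
  (\int[mu]_(x in E `|` F) (f x)%:E =
   \int[mu]_(x in E) (f x)%:E + \int[mu]_(x in F) (f x)%:E)%E.
Proof.
move=> mE mF nf EF; rewrite ge0_integral_setU//; first exact: nnmfun_EFin.
by move=> x _; rewrite lee_fin nnmfun_ge0.
Qed.

Lemma nnint_series_le d (T : measurableType d) (R : realType)
    (mu : {measure set T -> \bar R}) (f : nat -> T -> R) (g : T -> R) (C : R) :
  (forall k, nnmfun (f k)) -> (forall x, 0 <= g x) ->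
  (forall x, exists k, g x <= f k x) ->
  (forall N, \sum_(k < N) \int[mu]_x (f k x)%:E <= C%:E)%E ->
  (\int[mu]_x (g x)%:E <= C%:E)%E.
Proof.
move=> nf g0 gf sC.
have f0 k x : (0 <= (f k x)%:E)%E by rewrite lee_fin nnmfun_ge0.
apply: (@le_trans _ _ (\int[mu]_x \sum_(0 <= k <oo) (f k x)%:E)%E).
  apply: le_integral_ge0 => x _; first by rewrite lee_fin.
  have [k gk] := gf x.
  apply: (@le_trans _ _ (\sum_(0 <= i < k.+1) (f i x)%:E)%E); last first.
    by apply: nneseries_lim_ge => i _ _.
  rewrite big_nat_recr//= -[leLHS]add0e; apply: leeD; last by rewrite lee_fin.
  by apply: sume_ge0.
rewrite integral_nneseries//; last by move=> k; exact: nnmfun_EFin.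
apply: lime_le.
  by apply: is_cvg_nneseries => k _ _; apply: integral_ge0.
by apply: nearW => N; rewrite big_mkord.
Qed.

Section growth.
Context {R : realType} {n : nat}.
Local Notation T := (Rn R n).
Local Notation mu := (lebesgueRn R n).
Variables (e u : T -> R) (em ep g Cst : R).
Hypotheses (n_gt0 : (0 < n)%N) (em0 : 0 < em) (ep0 : 0 < ep) (g0 : 0 < g) (Cst0 : 0 < Cst).
Hypotheses (me : measurable_fun setT e) (nu : nnmfun u).
Hypotheses (u_gt0 : forall x, 0 < u x) (e_bnd : forall x, em <= e x <= ep).
Let NN (E : set T) := fine (lnorm mu e u E).
Hypothesis ball_fin : forall (x : T) r, 0 < r -> (lnorm mu e u (eball x r) < +oo)%E.
(* The conclusion of [lnorm_compare]. *)
Hypothesis compare : forall (x : T) r E, 0 < r -> measurable E -> E `<=` eball x r ->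
  (0 < mu E)%E ->
  (fine (mu E) / fine (mu (eball x r))) `^ g * NN (eball x r) <= Cst * NN E.

Definition Xn (y : T) : R := expR 1 + l1norm y.
Let B r : set T := eball (0 : T) r.
Let ng := n%:R * g.
Let ng_ge0 : 0 <= ng. Proof. by rewrite mulr_ge0// ltW. Qed.
Let n1 : 1 <= n%:R :> R. Proof. by rewrite ler1n. Qed.

Lemma Xn_ge1 y : 1 <= Xn y.
Proof.
apply: (@le_trans _ _ (expR 1)); first by rewrite -[leLHS](@expR0 R) ler_expR.
by rewrite lerDl l1norm_ge0.
Qed.

Let in_B y r : l1norm y < r -> B r y.
Proof. by move=> yr; rewrite /B /eball/= subr0; apply: le_lt_trans yr; exact: enorm_le_l1norm. Qed.

Let B_sub r s : r <= s -> B r `<=` B s.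
Proof. by move=> rs y; rewrite /B /eball/= => h; exact: lt_le_trans rs. Qed.

Let mB r : measurable (B r). Proof. exact: measurable_eball. Qed.

Lemma cube_sub_ball0 a l y : 0 < l -> cube a l y -> cube a l `<=` B (Xn y + n%:R * l).
Proof.
move=> l0 Qy z Qz; apply: in_B.
have := l1norm_triangle (z : 'rV[R]_n) (y : 'rV[R]_n) 0.
rewrite !subr0 => /le_lt_trans; apply.
have h := cube_l1norm Qz Qy; have e1 := expR_gt0 (1 : R).
by rewrite /Xn; move: h e1; lra.
Qed.

Let NN_ge0 E : 0 <= NN E. Proof. by apply: fine_ge0; exact: lnorm_ge0. Qed.

Let NN_mono (x : T) r E F : 0 < r -> measurable E -> measurable F -> E `<=` F -> F `<=` eball x r ->
  NN E <= NN F.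
Proof.
move=> r0 mE mF EF Fx.
have LF : (lnorm mu e u F <= lnorm mu e u (eball x r))%E.
  by apply: (lnorm_subset mu me nu) => //; exact: measurable_eball.
have LE : (lnorm mu e u E <= lnorm mu e u F)%E by exact: (lnorm_subset mu me nu).
have Ff : lnorm mu e u F \is a fin_num.
  by rewrite ge0_fin_numE ?lnorm_ge0// (le_lt_trans LF)// ball_fin.
apply: fine_le => //.
by rewrite ge0_fin_numE ?lnorm_ge0// (le_lt_trans LE)// -ge0_fin_numE ?lnorm_ge0.
Qed.

Let sub_fin (x : T) r E : 0 < r -> measurable E -> E `<=` eball x r -> (lnorm mu e u E < +oo)%E.
Proof.
move=> r0 mE Ex; apply: le_lt_trans (ball_fin x r0).
by apply: (lnorm_subset mu me nu) => //; exact: measurable_eball.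
Qed.

Let NB_gt0 (x : T) r : 0 < r -> 0 < NN (eball x r).
Proof.
move=> r0; apply: (fine_lnorm_gt0 em0 me nu u_gt0 e_bnd).
- exact: measurable_eball.
- exact: lebesgueRn_eball_gt0.
- exact: ball_fin.
Qed.

Let N1 := NN (B 1).
Let N1_gt0 : 0 < N1. Proof. exact: NB_gt0. Qed.

Let cube_mu a l : 0 < l -> fine (mu (cube a l)) = l ^+ n.
Proof. by move=> l0; rewrite lebesgueRn_cube. Qed.

Let cube_mu_gt0 a l : 0 < l -> (0 < mu (cube a l))%E.
Proof. by move=> l0; rewrite lebesgueRn_cube// lte_fin exprn_gt0. Qed.

Let powng t : 0 <= t -> (t ^+ n) `^ g = t `^ ng.
Proof. by move=> t0; rewrite -powR_mulrn// -powRrM. Qed.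

Let compare_ratio (x : T) r E t : 0 < r -> measurable E -> E `<=` eball x r ->
  (0 < mu E)%E -> 0 <= t -> (2 * r * t) ^+ n <= fine (mu E) ->
  t `^ ng * NN (eball x r) <= Cst * NN E.
Proof.
move=> r0 mE Ex muE t0 tE; apply: le_trans (compare r0 mE Ex muE).
apply: ler_wpM2r => //; rewrite -powng//.
have q0 : 0 <= fine (mu E) / fine (mu (eball x r)).
  by apply: divr_ge0; [exact: fine_ge0|exact: ltW (fine_eball_gt0 _ _)].
rewrite ge0_ler_powR ?nnegrE ?(ltW g0) ?exprn_ge0//.
rewrite ler_pdivlMr ?fine_eball_gt0//.
apply: le_trans tE; rewrite exprMn mulrC ler_wpM2r ?exprn_ge0//.
exact: fine_eball_le.
Qed.

Let Q_ball a l y : 0 < l -> cube a l y -> 0 < Xn y + n%:R * l.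
Proof.
by move=> l0 _; rewrite addr_gt0 ?mulr_gt0 ?ltr0n// (lt_le_trans ltr01)// Xn_ge1.
Qed.

(** The cube is compared with a ball about the origin that contains both it and the unit ball, so
    its norm is bounded below by that of the unit ball up to a power of the ratio of the sizes. *)
Lemma growth_lower : exists C : R, forall a l y, 0 < l -> cube a l y ->
  (Xn y + l^-1) `^ (- (2 * ng)) <= C * NN (cube a l).
Proof.
exists ((2 * n%:R) `^ ng * Cst / N1) => a l y l0 Qy.
have r0 := Q_ball l0 Qy; set r := Xn y + n%:R * l in r0 *.
have X1 := Xn_ge1 y; have li0 : 0 < l^-1 by rewrite invr_gt0.
set q := Xn y + l^-1; have q1 : 1 <= q by rewrite (le_trans X1)// lerDl ltW.
have q0 : 0 < q by apply: lt_le_trans q1.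
have n0 : 0 < 2 * n%:R :> R by rewrite mulr_gt0// ltr0n.
(* A lower bound for l/(2r): the quotient r/l = X/l + n is at most n (X + 1/l)^2. *)
pose t := (2 * n%:R * q ^+ 2)^-1.
have t0 : 0 < t by rewrite invr_gt0 mulr_gt0// exprn_gt0.
have h : t `^ ng * NN (eball (0 : T) r) <= Cst * NN (cube a l).
  apply: compare_ratio => //; [exact: measurable_cube|exact: cube_sub_ball0| |exact: ltW|].
    exact: cube_mu_gt0.
  rewrite cube_mu//; apply: lerXn2r; rewrite ?nnegrE ?mulr_ge0 ?(ltW r0) ?(ltW t0) ?(ltW l0)//.
  rewrite /t ler_pdivrMr; last by rewrite mulr_gt0// exprn_gt0.
  have -> : l * (2 * n%:R * q ^+ 2) = 2 * (n%:R * (l * q ^+ 2)) by ring.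
  rewrite ler_pM2l//.
  have -> : r = l * (Xn y * l^-1 + n%:R) by rewrite /r; field; rewrite gt_eqF.
  rewrite [leRHS]mulrCA (ler_pM2l l0); rewrite /q; move: X1 n1 li0.
  move: (Xn y) (l^-1) (n%:R : R) => X li m X1 m1 li0.
  have p1 : 0 <= X * li by apply: mulr_ge0; [exact: le_trans X1|exact: ltW].
  have a1 : X * li <= m * (2 * X * li) by nra.
  have a2 : m <= m * X ^+ 2 by rewrite ler_peMr ?(le_trans ler01 m1)// exprn_ege1.
  have a3 : 0 <= m * li ^+ 2.
    by apply: mulr_ge0; [exact: le_trans m1|exact: sqr_ge0].
  have -> : m * (X + li) ^+ 2 = m * X ^+ 2 + m * (2 * X * li) + m * li ^+ 2 by ring.
  lra.
rewrite mulrAC ler_pdivlMr//.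
have Nr : N1 <= NN (eball (0 : T) r).
  apply: (@NN_mono 0 r) => //; apply: B_sub.
  by rewrite /r (le_trans X1)// lerDl mulr_ge0// ltW.
have -> : q `^ (- (2 * ng)) = (2 * n%:R) `^ ng * t `^ ng.
  have q20 : 0 <= q ^+ 2 by exact: sqr_ge0.
  rewrite /t powR_invl (powRM _ (ltW n0) q20) mulrA -powRD ?(gt_eqF n0) ?implybT//.
  by rewrite subrr powRr0 mul1r -powR_mulrn ?(ltW q0)// -powRrM mulrN.
rewrite -!mulrA; apply: ler_wpM2l; first exact: powR_ge0.
by apply: le_trans h; apply: ler_wpM2l => //; exact: powR_ge0.
Qed.

Let ball_upper r : 1 <= r -> NN (B r) <= Cst * N1 * (n.+1%:R * r) `^ ng.
Proof.
move=> r1; have r0 : 0 < r by apply: lt_le_trans r1.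
have nr0 : 0 < n.+1%:R * r by rewrite mulr_gt0.
have h : (n.+1%:R * r)^-1 `^ ng * NN (B r) <= Cst * NN (B 1).
  apply: (compare_ratio r0 (mB 1) (B_sub r1)); [exact: lebesgueRn_eball_gt0|by rewrite invr_ge0 ltW|].
  apply: le_trans (fine_eball_ge _ ltr01); rewrite le_eqVlt; apply/orP; left; apply/eqP.
  by rewrite -mulf_div divff ?mulr1 ?mul1r// gt_eqF.
by move: h; rewrite powR_invl powRN mulrC ler_pdivrMr ?powR_gt0.
Qed.

Lemma growth_upper : exists C : R, forall a l y, 0 < l -> cube a l y ->
  NN (cube a l) <= C * (Xn y + l) `^ (2 * ng).
Proof.
exists (Cst * N1 * (n.+1%:R * n%:R) `^ ng) => a l y l0 Qy.
have r0 := Q_ball l0 Qy; set r := Xn y + n%:R * l in r0 *.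
have X1 := Xn_ge1 y.
have r1 : 1 <= r by rewrite /r (le_trans X1)// lerDl mulr_ge0// ltW.
have Xl1 : 1 <= Xn y + l by rewrite (le_trans X1)// lerDl ltW.
apply: (@le_trans _ _ (NN (B r))).
  apply: (@NN_mono 0 r) => //; [exact: measurable_cube|exact: cube_sub_ball0].
apply: (le_trans (ball_upper r1)); rewrite -[leRHS]mulrA.
apply: ler_wpM2l; first by rewrite mulr_ge0 ?ltW.
apply: (@le_trans _ _ ((n.+1%:R * n%:R * (Xn y + l)) `^ ng)).
  have Xl0 : 0 <= Xn y + l by exact: le_trans Xl1.
  have rhs0 : 0 <= n.+1%:R * n%:R * (Xn y + l) by rewrite !mulr_ge0.
  have lhs0 : 0 <= n.+1%:R * r by rewrite mulr_ge0// ltW.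
  rewrite ge0_ler_powR ?ng_ge0 ?nnegrE// -mulrA ler_wpM2l// /r mulrDr lerD2r ler_peMl// (le_trans ler01 X1)//.
rewrite powRM ?mulr_ge0 ?(le_trans ler01 Xl1)//; apply: ler_wpM2l; first exact: powR_ge0.
by rewrite ler_powR// ler_peMl// ler1n.
Qed.

(** An A_infinity property: by [compare], a subset with half of the volume has a norm at least c
    times that of the cube. Its modular at its own norm is at least 2^(-ep), and passing to the norm
    of the cube costs at most the factor c^ep. *)
Lemma growth_mass : exists2 c1 : R, 0 < c1 & forall a l E, 0 < l ->
  measurable E -> E `<=` cube a l -> l ^+ n / 2 <= fine (mu E) ->
  (c1%:E <= \int[mu]_(y in E) ((u y / NN (cube a l)) `^ e y)%:E)%E.
Proof.
have n20 : 0 < (4 * n.+1%:R : R) by rewrite mulr_gt0.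
pose c := (4 * n.+1%:R)^-1 `^ ng / Cst.
have c0 : 0 < c by rewrite divr_gt0// powR_gt0// invr_gt0.
exists ((c `^ ep) * 2 `^ (- ep)) => [|a l E l0 mE EQ hE]; first by rewrite mulr_gt0 ?powR_gt0.
pose x : T := \row_i a i; pose r := n.+1%:R * l; have r0 : 0 < r by rewrite mulr_gt0.
have Qx : cube a l `<=` eball x r.
  move=> y Qy; rewrite /eball/=; apply: le_lt_trans (enorm_le_l1norm _) _.
  apply: (@le_lt_trans _ _ (n%:R * l)); last by rewrite ltr_pM2r// ltr_nat.
  apply: cube_l1norm Qy _ => i; rewrite mxE lexx/= ltrDl//.
have mQ := measurable_cube a l.
have Qfin := sub_fin r0 mQ Qx.
have ln0 : 0 < l ^+ n / 2 by rewrite divr_gt0// exprn_gt0.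
have muE : (0 < mu E)%E.
  rewrite lt_neqAle measure_ge0 andbT; apply/eqP => m0.
  by have := lt_le_trans ln0 hE; rewrite -m0 /= ltxx.
have Efin : (lnorm mu e u E < +oo)%E by apply: (sub_fin r0 mE) => y /EQ; exact: Qx.
have NE0 : 0 < NN E by exact: (fine_lnorm_gt0 em0 me nu u_gt0 e_bnd).
have NQ0 : 0 < NN (cube a l).
  by apply: (fine_lnorm_gt0 em0 me nu u_gt0 e_bnd) => //; exact: cube_mu_gt0.
have NEQ : NN E <= NN (cube a l) by exact: (@NN_mono x r).
have h : (4 * n.+1%:R)^-1 `^ ng * NN (eball x r) <= Cst * NN E.
  apply: compare_ratio => //; first by move=> y /EQ; exact: Qx.
  apply: le_trans hE.
  have -> : 2 * r * (4 * n.+1%:R)^-1 = l / 2.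
    by rewrite /r; move: (n.+1%:R : R) n20 => N N0; field; lra.
  rewrite expr_div_n ler_wpM2l ?exprn_ge0 ?(ltW l0)//.
  rewrite lef_pV2 ?posrE ?exprn_gt0//; case: n n_gt0 => // k _.
  by rewrite exprS ler_peMr// exprn_ege1// ler1n.
have cN : c * NN (cube a l) <= NN E.
  rewrite /c mulrAC ler_pdivrMr// [leRHS]mulrC; apply: le_trans h.
  apply: ler_wpM2l; first exact: powR_ge0.
  by apply: (@NN_mono x r) => //; exact: measurable_eball.
have := le_trans (modular_lnorm_ge em0 me nu u_gt0 e_bnd mE muE Efin)
  (modular_le mu me nu u_gt0 e_bnd mE NE0 NEQ).
rewrite -/(NN E).
have : (0 <= \int[mu]_(y in E) ((u y / NN (cube a l)) `^ e y)%:E)%E.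
  by apply: nnint_ge0 => y; exact: powR_ge0.
case: (\int[mu]_(y in E) ((u y / NN (cube a l)) `^ e y)%:E)%E => [m| |]//; last first.
  by move=> *; rewrite leey.
rewrite -EFinM !lee_fin => m0 hm.
apply: (@le_trans _ _ (c `^ ep * ((NN (cube a l) / NN E) `^ ep * m))).
  by apply: ler_wpM2l => //; exact: powR_ge0.
rewrite mulrA -powRM ?(ltW c0) ?divr_ge0 ?(ltW NQ0) ?(ltW NE0)// ler_piMl//.
apply: powR_le1; last exact: ltW.
apply/andP; split; first by rewrite mulr_ge0 ?divr_ge0// ltW.
by rewrite mulrA ler_pdivrMr// mul1r.
Qed.

(** The annulus between the two balls contains half of the larger one, so it carries at least [eta]
    of the modular. Less than the full modular is left for the inner ball, which therefore has a
    norm smaller by a fixed factor. *)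
Let doubling_step : exists2 th : R, 0 < th < 1 & forall r, 0 < r ->
  NN (B r) <= th * NN (B (2 * n.+1%:R * r)).
Proof.
pose c := 2^-1 `^ g / Cst; have c0 : 0 < c by rewrite divr_gt0// powR_gt0.
pose eta := Num.min ((c `^ ep) * 2 `^ (- ep)) 1.
have eta0 : 0 < eta by rewrite lt_min ltr01 mulr_gt0 ?powR_gt0.
have eta1 : eta <= 1 by rewrite ge_min lexx orbT.
(* Half of [eta], so that [th1] stays positive when [eta] is 1. *)
pose th1 := 1 - eta / 2; have th10 : 0 < th1 < 1 by rewrite /th1; lra.
exists (th1 `^ ep^-1).
  rewrite powR_gt0 ?(andP th10).1//= -ltr_ln ?posrE ?powR_gt0 ?(andP th10).1//.
  rewrite ln1 ln_powR pmulr_rlt0 ?invr_gt0// -ln1 ltr_ln ?posrE ?(andP th10).1//.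
  by case/andP: th10.
move=> r r0; set L := 2 * n.+1%:R * r.
have nr0 : 0 < n.+1%:R :> R by [].
have n2 : 1 <= n.+1%:R :> R by rewrite ler1n.
have rL : r <= L by rewrite /L ler_peMl ?(ltW r0)//; lra.
have L0 : 0 < L by apply: lt_le_trans rL.
pose E := B L `\` B r.
have mE : measurable E by apply: measurableD; exact: mB.
have EB : E `<=` B L by move=> y [].
have muBr : mu (B r) \is a fin_num by exact: lebesgueRn_eball_fin.
have muBL : mu (B L) \is a fin_num by exact: lebesgueRn_eball_fin.
have muEE : mu E = (fine (mu (B L)) - fine (mu (B r)))%:E.
  have BLfin : (mu (B L) < +oo)%E by rewrite -ge0_fin_numE.
  rewrite (measureD (mB L) (mB r) BLfin).
  by rewrite setIC (setIidl (B_sub rL)) EFinB !fineK.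
have half : fine (mu (B L)) / 2 <= fine (mu E).
  rewrite muEE/=; have h1 := fine_eball_le (0 : T) r0; have h2 := fine_eball_ge (0 : T) L0.
  (* The dilation factor makes the volume of the large ball at least (4r)^n, which is at least twice
     the upper bound (2r)^n for the small one. *)
  have e2 : 2 * (L / n.+1%:R) = 2 * (2 * r) by rewrite /L; field; rewrite addrC natr1 gt_eqF.
  have h3 : 2 * (2 * r) ^+ n <= (2 * (L / n.+1%:R)) ^+ n.
    rewrite e2 [leRHS]exprMn ler_wpM2r ?exprn_ge0 ?mulr_ge0 ?(ltW r0)//.
    case: n n_gt0 => // k _.
    by rewrite exprS ler_peMr// exprn_ege1// ler1n.
  by move: h1 h2 h3; rewrite -/(B L) -/(B r); lra.
have BL0 := fine_eball_gt0 (0 : T) L0.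
have fE0 : 0 < fine (mu E) by apply: lt_le_trans half; rewrite divr_gt0.
have muE : (0 < mu E)%E by move: fE0; rewrite muEE.
have Efin : (lnorm mu e u E < +oo)%E by exact: (sub_fin L0 mE EB).
have NE0 : 0 < NN E by exact: (fine_lnorm_gt0 em0 me nu u_gt0 e_bnd).
have NL0 : 0 < NN (B L) by exact: NB_gt0.
have NEL : NN E <= NN (B L) by exact: (@NN_mono 0 L _ _ L0 mE (mB L) EB).
have cN : c * NN (B L) <= NN E.
  rewrite /c mulrAC ler_pdivrMr// [leRHS]mulrC; apply: le_trans (compare L0 mE EB muE).
  apply: ler_wpM2r => //; rewrite ge0_ler_powR ?nnegrE ?(ltW g0) ?divr_ge0 ?(ltW fE0) ?(ltW BL0)//.
  by rewrite ler_pdivlMr// mulrC.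
have modE : (eta%:E <= \int[mu]_(y in E) ((u y / NN (B L)) `^ e y)%:E)%E.
  have := le_trans (modular_lnorm_ge em0 me nu u_gt0 e_bnd mE muE Efin)
    (modular_le mu me nu u_gt0 e_bnd mE NE0 NEL).
  rewrite -/(NN E).
  have : (0 <= \int[mu]_(y in E) ((u y / NN (B L)) `^ e y)%:E)%E.
    by apply: nnint_ge0 => y; exact: powR_ge0.
  case: (\int[mu]_(y in E) ((u y / NN (B L)) `^ e y)%:E)%E => [m| |]//; last first.
    by move=> *; rewrite leey.
  rewrite -EFinM !lee_fin => m0 hm; rewrite /eta ge_min; apply/orP; left.
  apply: (@le_trans _ _ (c `^ ep * ((NN (B L) / NN E) `^ ep * m))).
    by apply: ler_wpM2l => //; exact: powR_ge0.
  rewrite mulrA -powRM ?(ltW c0) ?divr_ge0 ?(ltW NL0) ?(ltW NE0)// ler_piMl//.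
  apply: powR_le1; last exact: ltW.
  apply/andP; split; first by rewrite mulr_ge0 ?divr_ge0// ltW.
  by rewrite mulrA ler_pdivrMr// mul1r.
have modL : (\int[mu]_(y in B L) ((u y / NN (B L)) `^ e y)%:E <= 1)%E.
  apply: (modular_lnorm_le1 em0 ep0 me nu u_gt0 e_bnd) => //; first exact: lebesgueRn_eball_gt0.
  exact: ball_fin.
have modr : (\int[mu]_(y in B r) ((u y / NN (B L)) `^ e y)%:E <= th1%:E)%E.
  have nf := nnmfun_scaled_powR me nu NL0.
  have split : B L = E `|` B r by rewrite setUC setDUK//; exact: B_sub.
  have EBr : [disjoint E & B r] by apply/disj_setPS => y [[_ h] /h].
  move: modL; rewrite {1}split (nnintU mu mE (mB r) nf EBr).
  have : (0 <= \int[mu]_(y in B r) ((u y / NN (B L)) `^ e y)%:E)%E.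
    by apply: nnint_ge0 => y; exact: powR_ge0.
  move: modE; case: (\int[mu]_(y in E) ((u y / NN (B L)) `^ e y)%:E)%E => [m| |]//;
  case: (\int[mu]_(y in B r) ((u y / NN (B L)) `^ e y)%:E)%E => [k| |]//.
  by rewrite -EFinD !lee_fin /th1; lra.
have tN0 : 0 < th1 `^ ep^-1 * NN (B L).
  by rewrite mulr_gt0 ?powR_gt0// (andP th10).1.
rewrite -lee_fin -lnormE; last exact: ball_fin.
apply: ereal_inf_lbound; exists (th1 `^ ep^-1 * NN (B L)); last by [].
split; first exact: tN0.
have th0 : 0 < th1 by case/andP: th10.
have tN : th1 `^ ep^-1 * NN (B L) <= NN (B L).
  rewrite ler_piMl//; apply: powR_le1; last by rewrite invr_ge0 ltW.
  by rewrite !ltW//; case/andP: th10.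
apply: le_trans (modular_le mu me nu u_gt0 e_bnd (mB r) tN0 tN) _.
have -> : (NN (B L) / (th1 `^ ep^-1 * NN (B L))) `^ ep = th1^-1.
  have tt0 : 0 < th1 `^ ep^-1 by exact: powR_gt0.
  rewrite (_ : NN (B L) / _ = (th1 `^ ep^-1)^-1); last by field; rewrite !gt_eqF.
  by rewrite powR_invl -powRrM mulrN mulVf ?gt_eqF// powR_inv1// ltW.
apply: le_trans (lee_wpmul2l _ modr) _; first by rewrite lee_fin invr_ge0 ltW.
by rewrite -EFinM mulVf// gt_eqF.
Qed.

(** Multiplying the radius by L multiplies the norm by at least 1/th, whence the exponent - ln th /
    ln L. *)
Lemma growth_ball : exists2 delta : R, 0 < delta & exists2 C : R, 0 < C &
  forall r, 1 <= r -> r `^ delta <= C * NN (B r).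
Proof.
have [th /andP[th0 th1] step] := doubling_step.
pose L : R := 2 * n.+1%:R.
have L1 : 1 < L by rewrite /L -natrM ltr1n; lia.
have L0 : 0 < L by apply: lt_trans L1.
have lnL : 0 < ln L by rewrite ln_gt0.
pose delta := - ln th / ln L.
have lnth : ln th < 0 by rewrite -ln1 ltr_ln ?posrE.
have Ld : L `^ delta = th^-1.
  by rewrite /powR gt_eqF// /delta divfK ?gt_eqF// expRN lnK.
have iter k : N1 <= th ^+ k * NN (B (L ^+ k)).
  elim: k => [|k ih]; first by rewrite expr0 mul1r.
  apply: (le_trans ih); rewrite exprSr -mulrA ler_wpM2l ?exprn_ge0 ?(ltW th0)//.
  by rewrite exprS; apply: step; rewrite exprn_gt0.
exists delta; first by rewrite divr_gt0// oppr_gt0.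
exists ((th * N1)^-1); first by rewrite invr_gt0 mulr_gt0.
move=> r r1; have r0 : 0 < r by apply: lt_le_trans r1.
have lev0 : 0 <= lev L r by rewrite floor_ge0 divr_ge0 ?ln_ge0// ltW.
pose k := `|lev L r|%N.
have kE : (lev L r)%:~R = k%:R :> R by rewrite natr_absz ger0_norm.
have rk : L ^+ k <= r by rewrite -powR_mulrn ?(ltW L0)// -kE lev_le.
have rk1 : r < L ^+ k.+1 by rewrite -powR_mulrn ?(ltW L0)// -natr1 -kE lev_gt.
apply: (@le_trans _ _ ((L ^+ k.+1) `^ delta)).
  rewrite ge0_ler_powR ?nnegrE ?(ltW r0) ?exprn_ge0 ?(ltW L0) ?(ltW rk1)//.
  by apply: divr_ge0; [rewrite oppr_ge0 ltW|exact: ltW].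
rewrite -powR_mulrn ?(ltW L0)// -powRrM mulrC powRrM Ld powR_mulrn ?invr_ge0 ?(ltW th0)//.
rewrite mulrC ler_pdivlMr ?mulr_gt0// exprVn mulrA.
have -> : th ^- k.+1 * th = th ^- k by rewrite exprS invfM mulrAC mulVf ?mul1r// gt_eqF.
rewrite mulrC ler_pdivrMr ?exprn_gt0// mulrC; apply: (le_trans (iter k)).
apply: ler_wpM2l; first by rewrite exprn_ge0// ltW.
apply: (@NN_mono 0 r _ _ r0 (mB _) (mB r) (B_sub rk)); exact: subset_refl.
Qed.

Lemma growth_double : exists2 delta : R, 0 < delta & exists C : R, forall a l y,
  0 < l -> cube a l y -> Xn y <= l -> l `^ delta <= C * NN (cube a l).
Proof.
have [delta d0 [C C0 hC]] := growth_ball; exists delta => //.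
pose c := (2 * n.+1%:R)^-1 `^ ng : R; have c0 : 0 < c by rewrite powR_gt0// invr_gt0 mulr_gt0.
exists (C * (Cst / c)) => a l y l0 Qy Xl.
have r0 := Q_ball l0 Qy; set r := Xn y + n%:R * l in r0 *.
have l1 : 1 <= l by rewrite (le_trans _ Xl)// Xn_ge1.
have rl : r <= n.+1%:R * l by rewrite /r -natr1 mulrDl mul1r [leRHS]addrC lerD2r.
have lr : l <= r.
  by rewrite /r -[leLHS]add0r lerD ?(le_trans ler01 (Xn_ge1 y))// ler_peMl// ltW.
apply: (le_trans (hC l l1)); rewrite -mulrA; apply: ler_wpM2l; first exact: ltW.
rewrite mulrAC ler_pdivlMr// mulrC.
apply: (@le_trans _ _ (c * NN (eball (0 : T) r))).
  apply: ler_wpM2l; first exact: ltW.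
  apply: (@NN_mono 0 r _ _ r0 (mB _) (mB r) (B_sub lr)); exact: subset_refl.
apply: compare_ratio => //; [exact: measurable_cube|exact: cube_sub_ball0|exact: cube_mu_gt0|].
rewrite cube_mu//; apply: lerXn2r; rewrite ?nnegrE ?(ltW l0)//.
  by rewrite !mulr_ge0 ?(ltW r0)// invr_ge0.
by rewrite ler_pdivrMr ?mulr_gt0// [leRHS]mulrCA ler_pM2l// mulrC.
Qed.

Let modular_ball : exists2 D : R, 0 <= D & exists2 K : R, 0 <= K &
  forall r, 1 <= r -> (\int[mu]_(y in B r) (u y `^ e y)%:E <= (D * r `^ K)%:E)%E.
Proof.
pose D := 1 + Cst * N1 * n.+1%:R `^ ng.
have D0 : 0 <= D by rewrite addr_ge0// mulr_ge0 ?powR_ge0// mulr_ge0 ?ltW.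
exists (D `^ ep); first exact: powR_ge0.
exists (ng * ep) => [|r r1]; first by rewrite mulr_ge0// ltW.
have r0 : 0 < r by apply: lt_le_trans r1.
have NB0 : 0 <= NN (B r) by [].
have b1 : 1 <= 1 + NN (B r) by rewrite lerDl.
have b0 : 0 < 1 + NN (B r) by apply: lt_le_trans b1.
have modb : (\int[mu]_(y in B r) ((u y / (1 + NN (B r))) `^ e y)%:E <= 1)%E.
  apply: (lnorm_lt_modular em0 u_gt0 e_bnd) => //.
  by rewrite lnormE ?lte_fin ?ltrDr//; exact: ball_fin.
have := modular_le mu me nu u_gt0 e_bnd (mB r) ltr01 b1.
under eq_integral do rewrite divr1.
rewrite divr1 => /le_trans; apply.
apply: (@le_trans _ _ (((1 + NN (B r)) `^ ep)%:E * 1)%E).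
  by apply: lee_wpmul2l => //; rewrite lee_fin powR_ge0.
rewrite mule1 lee_fin powRrM -powRM ?powR_ge0//.
rewrite ge0_ler_powR ?nnegrE ?(ltW ep0) ?(ltW b0) ?mulr_ge0 ?powR_ge0//.
have rn1 : 1 <= r `^ ng by rewrite -(powRr0 r) ler_powR.
have := ball_upper r1; rewrite powRM ?(ltW r0)// => h.
rewrite /D mulrDl mul1r; apply: lerD => //.
by apply: (le_trans h); rewrite mulrA.
Qed.

Lemma nnmfun_Xn : nnmfun (fun y : T => Xn y).
Proof.
split => [|y]; last exact: le_trans (Xn_ge1 y).
by apply: measurable_funD => //; exact: measurable_l1norm.
Qed.

(** The modular of the ball of radius 2^(k+1) is at most D 2^((k+1) K), so the weight 2^(-k (K+1))
    of the k-th term leaves 2^(-k). At y the term with k the level of [Xn y] already dominates the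
    integrand. *)
Lemma growth_decay : exists2 K : R, 0 <= K & exists2 C : R, 0 <= C &
  (\int[mu]_y (Xn y `^ (- K) * u y `^ e y)%:E <= C%:E)%E.
Proof.
have [D D0 [K K0 mod]] := modular_ball.
exists (K + 1); first by rewrite addr_ge0.
exists (D * 2 `^ K * 2); first by rewrite !mulr_ge0 ?powR_ge0.
have nue : nnmfun (fun y => u y `^ e y) by exact: nnmfun_powR.
have XK1 : 0 <= K + 1 by rewrite addr_ge0.
pose f (k : nat) (y : T) := 2 `^ (- (k%:R * (K + 1))) * (u y `^ e y * \1_(B (2 ^+ k.+1)) y).
have nf k : nnmfun (f k).
  apply: nnmfunZ; first exact: powR_ge0.
  by apply: nnmfunM => //; apply: nnmfun_indic; exact: mB.
apply: (nnint_series_le (f := f)) => //.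
- by move=> y; rewrite mulr_ge0 ?powR_ge0.
- move=> y; have X1 := Xn_ge1 y; have X0 : 0 < Xn y by apply: lt_le_trans X1.
  have lev0 : 0 <= lev 2 (Xn y) by rewrite floor_ge0 divr_ge0 ?ln_ge0// ler1n.
  have kE : (lev 2 (Xn y))%:~R = `|lev 2 (Xn y)|%N%:R :> R by rewrite natr_absz ger0_norm.
  exists `|lev 2 (Xn y)|%N; rewrite /f indicE mem_set ?mulr1; last first.
    apply: in_B; apply: lt_trans (_ : Xn y < _); first by rewrite ltrDr expR_gt0.
    rewrite (_ : 2 ^+ _ = 2 `^ ((lev 2 (Xn y))%:~R + 1)); last first.
      by rewrite kE natr1 powR_mulrn.
    by apply: lev_gt => //; rewrite ltr1n.
  apply: ler_wpM2r; first exact: powR_ge0.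
  rewrite -mulrN powRrM -kE; apply: ler_powRN => //.
  by apply: lev_le => //; rewrite ltr1n.
move=> N; apply: (@le_trans _ _ (\sum_(k < N) (D * 2 `^ K * 2^-1 ^+ k)%:E)%E).
  apply: lee_sum => k _.
  have nk : nnmfun (fun y => u y `^ e y * \1_(B (2 ^+ k.+1)) y).
    by apply: nnmfunM nue _; apply: nnmfun_indic; exact: mB.
  rewrite /f (nnintZ mu measurableT (powR_ge0 _ _) nk) -nnint_mkcond.
  have h2 : 1 <= 2 ^+ k.+1 :> R by rewrite exprn_ege1// ler1n.
  apply: (le_trans (lee_wpmul2l _ (mod _ h2))); first by rewrite lee_fin powR_ge0.
  rewrite -EFinM lee_fin -powR_mulrn// -powRrM mulrCA -mulrA; apply: ler_wpM2l => //.
  rewrite -powR_mulrn// -powR_inv1// -powRrM.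
  have h a b : 2 `^ a * 2 `^ b = 2 `^ (a + b) :> R by rewrite powRD// pnatr_eq0 implybT.
  rewrite !h ler_powR ?ler1n// -natr1.
  by rewrite le_eqVlt; apply/orP; left; apply/eqP; ring.
rewrite sumEFin lee_fin -mulr_sumr; apply: ler_wpM2l; first by rewrite mulr_ge0 ?powR_ge0.
have := @sum_geometric_inj R 'I_N predT (fun k => k : nat) 2^-1.
rewrite (_ : (1 - 2^-1)^-1 = 2); last by field.
by apply; [apply/andP; split; lra|move=> i j _ _ /val_inj].
Qed.

End growth.

(** * Stopping cubes *)

Section selection.
Context d (T : measurableType d) (R : realType) (mu : {measure set T -> \bar R}).
Variables (I : finType) (Q : I -> set T) (gen : I -> int) (m : nat) (g : R).
Variables (vol : I -> R) (f : 'I_m -> T -> R) (phi : I -> 'I_m -> R).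
Hypotheses (lam : laminar Q gen) (mQ : forall i, measurable (Q i)).
Hypotheses (m_gt0 : (0 < m)%N) (g0 : 0 < g) (gm : g <= m%:R).
Hypotheses (volE : forall i, mu (Q i) = (vol i)%:E) (vol_gt0 : forall i, 0 < vol i).
Hypothesis nf : forall j, nnmfun (f j).
Hypothesis phiE : forall i j, (\int[mu]_(x in Q i) (f j x)%:E = (phi i j)%:E)%E.

Definition avgprod i := vol i `^ (- g) * \prod_j phi i j.

Let c := avgprod.
Let a : R := (2 * m%:R) `^ g.

(* Up to powers of [a], the average over a stopping cube exceeds the averages over
   all larger cubes. The stopping part omits the subcubes whose average is more
   than [a] times larger; [a] is chosen so that they fill at most half of the cube. *)
Definition stopping : pred I := fun i => (0 < c i) &&
  [forall j, ((gen i < gen j) && `[< Q i `&` Q j !=set0 >] && (0 < c j))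
    ==> (lev a (c j) < lev a (c i))].

Definition stopping_part i : set T :=
  Q i `&` \bigcap_(k in [set k | 0 < c k /\ lev a (c i) + 1 < lev a (c k)]) ~` Q k.

Let m0 : 0 < m%:R :> R. Proof. by rewrite ltr0n. Qed.
Let a_gt1 : 1 < a.
Proof.
rewrite -ltr_ln ?posrE ?powR_gt0 ?mulr_gt0// ln1 ln_powR mulr_gt0// ln_gt0//.
by rewrite -natrM ltr1n; lia.
Qed.
Let phi_ge0 i j : 0 <= phi i j.
Proof. by rewrite -lee_fin -phiE; apply: nnint_ge0 => x; exact: nnmfun_ge0. Qed.

Lemma measurable_stopping_part i : measurable (stopping_part i).
Proof.
apply: measurableI => //; apply: fin_bigcap_measurable; first exact: finite_finset.
by move=> k _; exact: measurableC.
Qed.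

Lemma stopping_part_sub i : stopping_part i `<=` Q i. Proof. by move=> x []. Qed.

Lemma stopping_partP i k x : stopping_part i x -> Q k x -> 0 < c k ->
  lev a (c k) <= lev a (c i) + 1.
Proof. by move=> [_ h] Qk ck; rewrite leNgt; apply/negP => lt; exact: h Qk. Qed.

Lemma stopping_lev i j x : stopping i -> gen i < gen j -> Q i x -> Q j x -> 0 < c j ->
  lev a (c j) < lev a (c i).
Proof.
move=> /andP[_ /forallP/(_ j)/implyP h] ij Qi Qj cj; apply: h.
by rewrite ij cj andbT/=; apply/asboolP; exists x.
Qed.

(** Among the cubes containing x one takes the highest level that occurs, and then the largest cube
    of that level: no larger cube reaches its level, and no cube through x exceeds it. *)
Lemma stopping_cover k x : Q k x -> 0 < c k ->
  exists i, [/\ stopping i, stopping_part i x, c k <= a * c i &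
    forall k', Q k' x -> 0 < c k' -> lev a (c k') <= lev a (c i)].
Proof.
move=> Qk ck; pose P l := `[< Q l x >] && (0 < c l).
have Pk : P k by rewrite /P ck andbT; exact/asboolP.
have [l Pl lmax] := @Order.TotalTheory.arg_maxP _ _ _ k P (fun l => lev a (c l)) Pk.
pose P' i := P i && (lev a (c i) == lev a (c l)).
have P'l : P' l by rewrite /P' Pl/=.
have [i /andP[Pi /eqP il] imax] := @Order.TotalTheory.arg_maxP _ _ _ l P' gen P'l.
have /andP[/asboolP Qi ci] := Pi.
have lev_max k' : Q k' x -> 0 < c k' -> lev a (c k') <= lev a (c i).
  by move=> Qk' ck'; rewrite il; apply: lmax; rewrite /P ck' andbT; exact/asboolP.
exists i; split => //.
- rewrite /stopping ci/=; apply/forallP => j; apply/implyP => /andP[/andP[ij /asboolP ne] cj].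
  have [/(_ _ Qi) Qj _] := lam ne (ltW ij).
  rewrite lt_neqAle lev_max// andbT; apply/eqP => e.
  have := imax j; rewrite /P' /P cj e il eqxx !andbT => /(_ (asboolT Qj)).
  by rewrite /= leNgt ij.
- split => // k' [ck' lt] Qk'.
  by have := lev_max _ Qk' ck'; rewrite leNgt (lt_trans _ lt)// ltrDl.
- apply: ltW; apply: lt_le_trans (lev_gt a_gt1 ck) _.
  have a0 : 0 < a by apply: lt_trans a_gt1.
  apply: (@le_trans _ _ (a `^ ((lev a (c i))%:~R + 1))).
    by rewrite ler_powR ?(ltW a_gt1)// lerD2r ler_int lev_max.
  rewrite powRD ?(gt_eqF a0) ?implybT// powRr1 ?(ltW a0)// mulrC ler_pM2l//.
  exact: lev_le.
Qed.

(** If the stopping part of a cube contains x, the level of the cube is the highest one at x or the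
    one just below, and two such cubes of equal level coincide. Hence they inject into [bool]. *)
Lemma stopping_overlap x : (#|[pred i | stopping i && `[< stopping_part i x >]]| <= 2)%N.
Proof.
set A := [pred i | _].
have [i0 Ai0|A0] := pickP A; last by rewrite eq_card0.
have /andP[Si0 /asboolP[Qi0 _]] := Ai0.
have ci0 : 0 < c i0 by case/andP: Si0.
have [l [Sl [Ql _] _ lmax]] := stopping_cover Qi0 ci0.
have cl : 0 < c l by case/andP: Sl.
have Alev i : A i -> lev a (c i) <= lev a (c l) <= lev a (c i) + 1.
  move=> /andP[Si /asboolP Ei]; have ci : 0 < c i by case/andP: Si.
  by rewrite lmax//= ?(stopping_partP Ei)//; case: Ei.
have inj i j : A i -> A j -> lev a (c i) = lev a (c j) -> gen i <= gen j -> i = j.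
  move=> /andP[Si /asboolP[Qi _]] /andP[Sj /asboolP[Qj _]] ij ge.
  have ne : Q i `&` Q j !=set0 by exists x.
  have [_ ] := lam ne ge; apply; apply/eqP; rewrite eq_le ge leNgt/=; apply/negP => lt.
  have cj : 0 < c j by case/andP: Sj.
  by have := stopping_lev Si lt Qi Qj cj; rewrite ij ltxx.
rewrite -card_bool -(@card_in_imset _ _ (fun i => lev a (c i) == lev a (c l)) A).
  exact: max_card.
move=> i j Ai Aj e.
have eij : lev a (c i) = lev a (c j).
  have /andP[i1 i2] := Alev _ Ai; have /andP[j1 j2] := Alev _ Aj.
  move: e i1 i2 j1 j2; move: (lev a (c i)) (lev a (c j)) (lev a (c l)) => u v w; clear.
  by case: eqVneq => [->|ni]; case: eqVneq => [->|nj] //; lia.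
by have [ge|/ltW ge] := leP (gen i) (gen j); [exact: inj|symmetry; exact: inj].
Qed.

(** Either the sum U is at least 1, or the product is at most U^m with U < 1 and m/g >= 1. *)
Lemma root_prod_le_sum (u : 'I_m -> R) : (forall j, 0 <= u j <= 1) ->
  (\prod_j u j) `^ g^-1 <= \sum_j u j.
Proof.
move=> u01; have u0 j : 0 <= u j by case/andP: (u01 j).
have p0 : 0 <= \prod_j u j by apply: prodr_ge0.
have gi0 : 0 <= g^-1 by rewrite invr_ge0 ltW.
set U := \sum_j u j; have U0 : 0 <= U by apply: sumr_ge0.
have [U1|U1] := leP 1 U.
  apply: le_trans U1; apply: powR_le1 => //; rewrite p0/=.
  by apply: prodr_ile1 => j _; exact: u01.
have uU j : u j <= U by rewrite /U (bigD1 j)//= lerDl sumr_ge0.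
have pU : \prod_j u j <= U ^+ m.
  rewrite -[m in X in _ <= X](card_ord m) -prodr_const.
  by apply: ler_prod => j _; rewrite u0 uU.
have [U00|UN0] := eqVneq U 0.
  move: pU; rewrite U00 expr0n gtn_eqF//= => pU.
  have -> : \prod_j u j = 0 by apply/eqP; rewrite eq_le pU p0.
  by rewrite powR0// invr_eq0 gt_eqF.
apply: (@le_trans _ _ ((U ^+ m) `^ g^-1)).
  by rewrite ge0_ler_powR ?nnegrE ?exprn_ge0.
rewrite -powR_mulrn// -powRrM ge1r_powR ?(ltW U1) ?andbT ?lt_neqAle 1?eq_sym ?UN0//.
by rewrite ler_pdivlMr// mul1r.
Qed.

(** For an omitted subcube k, the jump of the average by more than (2m)^g gives vol_k <= vol_i/(2m)
    (prod_j phi_kj/phi_ij)^(1/g), and the root is at most the sum of the ratios. Over the disjoint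
    maximal subcubes these add up to at most one for each j, so at most vol_i/2 is omitted. *)
Lemma stopping_part_ge i : stopping i -> vol i / 2 <= fine (mu (stopping_part i)).
Proof.
move=> Si; have ci : 0 < c i by case/andP: Si.
have a0 : 0 < a by apply: lt_trans a_gt1.
pose P k := [&& 0 < c k, lev a (c i) + 1 < lev a (c k) & `[< Q k `&` Q i !=set0 >]].
have PQ k : P k -> Q k `<=` Q i.
  move=> /and3P[ck lt /asboolP ne]; have [ki|ik] := leP (gen k) (gen i).
    by have [] := lam ne ki.
  case: ne => x [Qk Qi]; have := stopping_lev Si ik Qi Qk ck.
  by rewrite ltNge (le_trans _ (ltW lt))// lerDl.
have Phi_gt0 j : 0 < phi i j.
  rewrite lt_neqAle phi_ge0 andbT eq_sym; apply/eqP => z.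
  by move: ci; rewrite /c /avgprod (bigD1 j)//= z mul0r mulr0 ltxx.
have phi_le k j : P k -> phi k j <= phi i j.
  by move=> Pk; rewrite -lee_fin -!phiE; apply: nnint_subset => //; exact: PQ.
have vol_le k : P k -> vol k <= vol i / (2 * m%:R) * \sum_j phi k j / phi i j.
  move=> /[dup] Pk /and3P[ck lt _].
  have ack : a * c i < c k by exact: lev_lt.
  have u01 j : 0 <= phi k j / phi i j <= 1.
    by rewrite divr_ge0//= ler_pdivrMr// mul1r phi_le.
  have := root_prod_le_sum u01; rewrite big_split/= prodfV => h.
  have pi0 : 0 < \prod_j phi i j by apply: prodr_gt0.
  have pk0 : 0 <= \prod_j phi k j by apply: prodr_ge0.
  apply: le_trans (ler_wpM2l _ h); last by rewrite divr_ge0 ?mulr_ge0// ltW.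
  have key : vol k `^ g <= (vol i / (2 * m%:R)) `^ g * ((\prod_j phi k j) / \prod_j phi i j).
    move: ack; rewrite /c /avgprod !powRN -/a.
    have vk : 0 < vol k `^ g by exact: powR_gt0.
    have vi : 0 < vol i `^ g by exact: powR_gt0.
    rewrite [ltRHS]mulrC ltr_pdivlMr// => /ltW h1.
    rewrite powRM ?invr_ge0 ?(ltW (vol_gt0 i)) ?mulr_ge0// powR_invl powRN -/a.
    rewrite mulrA ler_pdivlMr// mulrAC ler_pdivlMr//.
    have -> : vol k `^ g * \prod_j phi i j * a =
      a * ((vol i `^ g)^-1 * \prod_j phi i j) * vol k `^ g * vol i `^ g.
      by field; rewrite gt_eqF.
    by rewrite [leRHS]mulrC ler_pM2r.
  have -> : vol k = (vol k `^ g) `^ g^-1.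
    by rewrite -powRrM divff ?gt_eqF// powRr1// ltW.
  apply: le_trans (ge0_ler_powR _ _ _ key) _; rewrite ?nnegrE ?powR_ge0 ?invr_ge0 ?(ltW g0)//.
    by rewrite mulr_ge0 ?powR_ge0 ?divr_ge0// ltW.
  rewrite powRM ?powR_ge0 ?divr_ge0 ?(ltW pi0)// -powRrM divff ?gt_eqF// powRr1//.
  by rewrite divr_ge0 ?mulr_ge0// ltW.
have lev_le_mu : (\sum_(k | maxQ Q gen P k) mu (Q k) <= (vol i / 2)%:E)%E.
  rewrite (eq_bigr (fun k => (vol k)%:E)); last by move=> k _; rewrite volE.
  rewrite sumEFin lee_fin.
  apply: (@le_trans _ _ (\sum_(k | maxQ Q gen P k)
    vol i / (2 * m%:R) * \sum_j phi k j / phi i j)).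
    by apply: ler_sum => k /maxQ_sub/vol_le.
  rewrite -mulr_sumr exchange_big/=.
  have -> : vol i / 2 = vol i / (2 * m%:R) * m%:R by field; rewrite gt_eqF.
  apply: ler_wpM2l; first by rewrite divr_ge0 ?mulr_ge0// ltW.
  apply: (@le_trans _ _ (\sum_(j < m) 1)); last by rewrite sumr_const card_ord.
  apply: ler_sum => j _; rewrite -mulr_suml ler_pdivrMr// mul1r.
  rewrite -lee_fin -sumEFin -phiE.
  rewrite (eq_bigr (fun k => (\int[mu]_(x in Q k) (f j x)%:E)%E)); last first.
    by move=> k _; rewrite phiE.
  exact: maxQ_sum_le.
pose U := \bigcup_(k in [set k | P k]) Q k.
have mU : measurable U by apply: fin_bigcup_measurable; [exact: finite_finset|].
have UQ : U `<=` Q i by move=> x [k Pk]; exact: PQ.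
have EU : stopping_part i = Q i `\` U.
  apply/seteqP; split => x [Qi h]; split => //.
    by move=> [k /and3P[ck lt _]] Qk; exact: h Qk.
  move=> k [ck lt] Qk; apply: h; exists k => //=.
  by rewrite /P ck lt/=; apply/asboolP; exists x.
have muU : (mu U <= (vol i / 2)%:E)%E.
  apply: le_trans lev_le_mu.
  rewrite (eq_bigr (fun k => \int[mu]_(x in Q k) (1 : R)%:E)%E); last first.
    by move=> k _; rewrite integral_cst// mul1e.
  rewrite -[leLHS]mul1e -integral_cst//.
  rewrite nnint_mkcond.
  rewrite (eq_bigr (fun k => \int[mu]_x (1 * \1_(Q k) x)%:E)%E); last first.
    by move=> k _; rewrite nnint_mkcond.
  rewrite -nnint_sum//; last first.
    by move=> k _; apply: nnmfunZ => //; exact: nnmfun_indic.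
  apply: nnint_le => [x|x _]; first by rewrite mul1r indicE.
  rewrite mul1r indicE; case: (boolP (x \in U)) => [/set_mem[k Pk Qk]|_]; last first.
    by apply: sumr_ge0 => k _; rewrite mul1r indicE.
  have [l ml Ql] := maxQ_cover lam (P := P) Pk Qk.
  rewrite (bigD1 l)//= mul1r indicE mem_set// lerDl.
  by apply: sumr_ge0 => j _; rewrite mul1r indicE.
have muUfin : mu U \is a fin_num.
  by rewrite ge0_fin_numE// (le_lt_trans muU)// ltry.
have Qfin : (mu (Q i) < +oo)%E by rewrite volE ltry.
rewrite EU (measureD (mQ i) mU Qfin) setIC (setIidl UQ).
have -> : ((mu : set T -> \bar R) (Q i) - mu U = (vol i - fine (mu U))%:E)%E.
  by rewrite EFinB fineK//; congr (_ - _)%E; exact: volE.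
rewrite /=.
by move: muU; rewrite -(fineK muUfin) lee_fin/=; lra.
Qed.

End selection.

(** * Log-Hoelder exponents and shifted grids *)

Lemma expR1_gt2 (R : realType) : 2 < expR 1 :> R.
Proof. by have := @expR_gt1Dx R 1; rewrite oner_eq0 -natr1; exact. Qed.

Section log_holder.
Context {R : realType} {n : nat}.
Local Notation T := (Rn R n).
Local Notation mu := (lebesgueRn R n).
Hypothesis n_gt0 : (0 < n)%N.
Let n1 : 1 <= n%:R :> R. Proof. by rewrite ler1n. Qed.

(** The modulus of continuity makes a strict violation at one point persist on a small ball, which
    has positive measure. *)
Lemma ae_ge_everywhere (f : T -> R) (C c : R) : 0 <= C ->
  (forall x y : 'rV[R]_n, enorm (x - y) < 2^-1 ->
    `|f x - f y| <= C / (- ln (enorm (x - y)))) ->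
  {ae mu, forall x, c <= f x} -> forall x, c <= f x.
Proof.
move=> C0 hf [N [mN N0 sub]] x; rewrite leNgt; apply/negP => lt.
pose eps := c - f x; have eps0 : 0 < eps by rewrite subr_gt0.
(* Within this distance -ln |x - y| > C/eps + 1, so the oscillation is less than [eps]. *)
pose r : R := expR (- (C / eps + 1)); have r0 : 0 < r by exact: expR_gt0.
have r2 : r < 2^-1.
  rewrite /r expRN ltf_pV2 ?posrE ?expR_gt0//.
  apply: lt_le_trans (_ : _ < expR 1) _; last by rewrite ler_expR lerDr divr_ge0// ltW.
  by rewrite expR1_gt2.
have inN y : eball x r y -> N y.
  move=> xy; apply: sub => /= h.
  have d1 : enorm ((x : 'rV[R]_n) - (y : 'rV[R]_n)) < r.
    move: xy; rewrite /eball/= /enorm.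
    by rewrite (eq_bigr (fun i => ((x : 'rV[R]_n) - (y : 'rV[R]_n)) ord0 i ^+ 2))// => i _; rewrite !mxE -sqrrN opprB.
  have := hf _ _ (lt_trans d1 r2).
  have [d0|dN0] := eqVneq (enorm ((x : 'rV[R]_n) - (y : 'rV[R]_n))) 0.
    rewrite d0 ln0// oppr0 invr0 mulr0 normr_le0 subr_eq0 => /eqP e.
    by move: lt; rewrite e ltNge h.
  have dp : 0 < enorm ((x : 'rV[R]_n) - (y : 'rV[R]_n)) by rewrite lt_neqAle eq_sym dN0 enorm_ge0.
  have L : C / eps + 1 < - ln (enorm ((x : 'rV[R]_n) - (y : 'rV[R]_n))).
    by rewrite ltrNr -[ltRHS]expRK ltr_ln ?posrE.
  have Ce : 0 <= C / eps by rewrite divr_ge0// ltW.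
  have Lp : 0 < - ln (enorm ((x : 'rV[R]_n) - (y : 'rV[R]_n))) by apply: le_lt_trans L; rewrite addr_ge0.
  rewrite ler_pdivlMr// => h2.
  have h3 : eps <= `|f x - f y| by rewrite distrC (le_trans _ (ler_norm _))// lerD2r.
  have : eps * (C / eps + 1) < eps * - ln (enorm ((x : 'rV[R]_n) - (y : 'rV[R]_n))).
    by rewrite ltr_pM2l.
  have -> : eps * (C / eps + 1) = C + eps by field; rewrite gt_eqF.
  have h4 : eps * - ln (enorm ((x : 'rV[R]_n) - (y : 'rV[R]_n))) <= C.
    by apply: le_trans h2; rewrite ler_pM2r.
  by move=> h5; have := lt_le_trans h5 h4; rewrite ltNge lerDl ltW.
have := lebesgueRn_eball_gt0 x r0; rewrite ltNge -N0 => /negP; apply.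
by apply: le_measure => //; rewrite inE//; exact: measurable_eball.
Qed.

(** If 1/l dominates X at some point of the cube, the local condition freezes p at its value there
    and 1/l governs the logarithm; otherwise 1/l is at most a multiple of X on the whole cube, and
    the condition at infinity serves. *)
Lemma log_holder_cube (p : T -> R) (pm : R) : log_holder p -> (forall y, pm <= p y) ->
  exists CL : R, forall a l, 0 < l -> exists2 pQ, pm <= pQ &
    forall y, cube a l y -> `|p y - pQ| * ln (Xn y + l^-1) <= CL.
Proof.
move=> [C [pinf [C0 _ hloc hinf]]] p_ge.
have n0 : 0 < n%:R :> R by rewrite ltr0n.
have e2 : 2 < expR (1 : R) := expR1_gt2 R.
pose A := (1 + 4 * n%:R) * n%:R : R.
have A1 : 2 * n%:R <= A by rewrite /A ler_pM2r//; move: n1; lra.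
have Apos : 0 < A by rewrite /A mulr_gt0//; move: n1; lra.
have lnA : 0 <= ln A.
  by rewrite ln_ge0//; apply: le_trans A1; move: n1; lra.
exists (C * (1 + ln A)) => a l l0; have li0 : 0 < l^-1 by rewrite invr_gt0.
have [[y0 [Qy0 hy0]]|no] := pselect (exists y0, cube a l y0 /\ 4 * n%:R * Xn y0 <= l^-1).
  exists (p y0) => // y Qy.
  have dn := cube_l1norm Qy Qy0.
  set dd := (y : 'rV[R]_n) - (y0 : 'rV[R]_n) in dn.
  have ed := enorm_le_l1norm dd.
  have Xy0 : 2 < Xn y0 by rewrite /Xn (lt_le_trans e2)// lerDl l1norm_ge0.
  have nl : 4 * Xn y0 <= (n%:R * l)^-1.
    by rewrite invfM [leRHS]mulrC ler_pdivlMr// mulrAC.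
  have nl0 : 0 < n%:R * l by rewrite mulr_gt0.
  have nl8 : n%:R * l < 8^-1.
    rewrite -[n%:R * l]invrK ltf_pV2 ?posrE ?invr_gt0//.
    by apply: lt_le_trans nl; move: Xy0; lra.
  have dlt : enorm dd < 2^-1 by move: nl8 ed dn; lra.
  have := hloc _ _ dlt; rewrite -/dd.
  have [d0|dN0] := eqVneq (enorm dd) 0.
    rewrite d0 ln0// oppr0 invr0 mulr0 normr_le0 => /eqP ->.
    by rewrite normr0 mul0r mulr_ge0 ?(ltW C0)// addr_ge0.
  have dp : 0 < enorm dd by rewrite lt_neqAle eq_sym dN0 enorm_ge0.
  set Ln := ln ((n%:R * l)^-1).
  have L1 : 1 <= Ln.
    rewrite /Ln -[leLHS]expRK ler_ln ?posrE ?expR_gt0 ?invr_gt0//.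
    apply: le_trans nl; rewrite /Xn; have := l1norm_ge0 (y0 : 'rV[R]_n).
    by move: e2; lra.
  have Ld : Ln <= - ln (enorm dd).
    by rewrite /Ln lnV ?posrE// lerN2 ler_ln ?posrE//; apply: le_trans dn.
  have LX : ln (Xn y + l^-1) <= ln A + Ln.
    rewrite /Ln -lnM ?posrE ?invr_gt0//.
    have Xp : 0 < Xn y + l^-1 by apply: addr_gt0 => //; apply: lt_le_trans (Xn_ge1 _).
    rewrite ler_ln ?posrE ?(mulr_gt0 Apos) ?invr_gt0//.
    apply: (@le_trans _ _ (2 * n%:R * (n%:R * l)^-1)); last first.
      by rewrite ler_pM2r ?invr_gt0.
    have -> : 2 * n%:R * (n%:R * l)^-1 = l^-1 + l^-1 by field; rewrite !gt_eqF.
    rewrite lerD2r; apply: le_trans hy0.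
    have : Xn y <= Xn y0 + n%:R * l.
      rewrite /Xn -addrA lerD2l addrC.
      have := l1normD dd (y0 : 'rV[R]_n); rewrite /dd subrK => /le_trans; apply.
      by rewrite lerD2r.
    have : 4 * Xn y0 <= 4 * n%:R * Xn y0.
      by rewrite -mulrA ler_pM2l// ler_peMl// (le_trans _ (Xn_ge1 y0)).
    by move: nl8 Xy0; lra.
  have Lp : 0 < - ln (enorm dd) by apply: lt_le_trans Ld; apply: lt_le_trans L1.
  rewrite ler_pdivlMr// => h.
  have X0 : 0 <= ln (Xn y + l^-1).
    by rewrite ln_ge0// (le_trans (Xn_ge1 y))// lerDl ltW.
  have LA : ln (Xn y + l^-1) <= - ln (enorm dd) * (1 + ln A).
    apply: le_trans LX _; apply: (@le_trans _ _ (Ln * (1 + ln A))).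
      by rewrite mulrDr mulr1 addrC lerD2l ler_peMl.
    by rewrite ler_wpM2r// addr_ge0.
  apply: le_trans (ler_wpM2l _ LA) _ => //.
  by rewrite mulrA ler_wpM2r// addr_ge0.
have far y : cube a l y -> l^-1 < 4 * n%:R * Xn y.
  by move=> Qy; rewrite ltNge; apply/negP => h; apply: no; exists y.
exists (Num.max pinf pm) => [|y Qy]; first by rewrite le_max lexx orbT.
have h1 : `|p y - Num.max pinf pm| <= `|p y - pinf|.
  have := p_ge y; have [h|h] := leP pm pinf; first by [].
  move=> h2; rewrite ger0_norm ?subr_ge0//.
  by apply: le_trans (ler_norm _); rewrite lerD2l lerN2 ltW.
set L := ln (expR 1 + enorm (y : 'rV[R]_n)).
have eey : expR 1 <= expR 1 + enorm (y : 'rV[R]_n) by rewrite lerDl enorm_ge0.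
have eep : 0 < expR 1 + enorm (y : 'rV[R]_n) by apply: lt_le_trans eey; exact: expR_gt0.
have L1 : 1 <= L by rewrite /L -[leLHS]expRK ler_ln ?posrE ?expR_gt0.
have LX : ln (Xn y + l^-1) <= ln A + L.
  rewrite /L -lnM ?posrE//.
  have Xp : 0 < Xn y + l^-1 by apply: addr_gt0 => //; apply: lt_le_trans (Xn_ge1 _).
  rewrite ler_ln ?posrE ?(mulr_gt0 Apos)//.
  apply: (@le_trans _ _ ((1 + 4 * n%:R) * Xn y)).
    by rewrite mulrDl mul1r lerD2l ltW// far.
  rewrite /A -mulrA ler_wpM2l//.
  rewrite /Xn mulrDr lerD// ?l1norm_le_enorm//.
  by rewrite ler_peMl// expR_ge0.
have h2 := hinf y; rewrite -/L ler_pdivlMr ?(lt_le_trans _ L1)// in h2.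
have LA : ln (Xn y + l^-1) <= L * (1 + ln A).
  apply: le_trans LX _.
  by rewrite mulrDr mulr1 addrC lerD2l ler_peMl.
apply: le_trans (ler_wpM2l _ LA) _ => //.
rewrite mulrA ler_wpM2r ?addr_ge0//.
by apply: le_trans h2; rewrite ler_wpM2r// (le_trans _ L1).
Qed.

End log_holder.

Lemma nnint_sup_le d (T : measurableType d) (R : realType)
    (mu : {measure set T -> \bar R}) (f : nat -> T -> R) (G : T -> \bar R) (C : R) :
  (forall k, nnmfun (f k)) -> (forall x k l, (k <= l)%N -> f k x <= f l x) ->
  (forall x, 0 <= G x)%E ->
  (forall x, G x <= ereal_sup (range (fun k => (f k x)%:E)))%E ->
  (forall k, \int[mu]_x (f k x)%:E <= C%:E)%E ->
  (\int[mu]_x G x <= C%:E)%E.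
Proof.
move=> nf ndf G0 Gf fC.
have nd x : {homo (fun k => (f k x)%:E) : k l / (k <= l)%N >-> (k <= l)%E}.
  by move=> k l kl; rewrite lee_fin ndf.
have f0 k x : (0 <= (f k x)%:E)%E by rewrite lee_fin nnmfun_ge0.
apply: (@le_trans _ _ (\int[mu]_x limn (fun k => (f k x)%:E))%E).
  apply: le_integral_ge0 => // x _.
  by rewrite (cvg_lim _ (ereal_nondecreasing_cvgn (nd x))).
rewrite monotone_convergence//; last by move=> k; exact: nnmfun_EFin.
apply: lime_le; last exact: nearW.
apply: ereal_nondecreasing_is_cvgn => k l kl.
by apply: nnint_le => [x|x _]; [exact: nnmfun_ge0|exact: ndf].
Qed.

Fixpoint running_max (R : realType) (F : nat -> R) (k : nat) : R :=
  if k is l.+1 then Num.max (running_max F l) (F l) else 0.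

Section running_max.
Context {R : realType}.
Implicit Types F : nat -> R.

Lemma running_max_mono F k l : (k <= l)%N -> running_max F k <= running_max F l.
Proof.
move=> kl; rewrite -(subnKC kl); elim: (l - k)%N => [|d ih]; first by rewrite addn0.
by rewrite addnS/= le_max ih.
Qed.

Lemma running_max_ge F k l : (k < l)%N -> F k <= running_max F l.
Proof.
by move=> /(running_max_mono F); apply: le_trans; rewrite /= le_max lexx orbT.
Qed.

Lemma running_max_attained F k : 0 < running_max F k ->
  exists2 i, (i < k)%N & running_max F k = F i.
Proof.
elim: k => [|k ih]; first by rewrite ltxx.
rewrite /=; have [lt _|le] := leP (running_max F k); first by exists k.
by move=> /ih[i ik ->]; exists i => //; exact: ltn_trans ik _.
Qed.

Lemma running_max_ge0 F k : 0 <= running_max F k.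
Proof. exact: running_max_mono (leq0n k). Qed.

Lemma nnmfun_running_max d (T : measurableType d) (F : nat -> T -> R) k :
  (forall i, nnmfun (F i)) -> nnmfun (fun x => running_max (F ^~ x) k).
Proof.
move=> nF; split => [|x]; last exact: running_max_ge0.
by elim: k => [|k ih] //=; apply: measurable_maxr => //; exact: nnmfun_measurable.
Qed.

End running_max.

Lemma poweR_le_approx (R : realType) (F S : \bar R) (a q : R) :
  (0 <= F)%E -> 0 < a -> 0 < q -> (0 <= S)%E ->
  (forall s, 0 <= s -> (s%:E < F)%E -> (((s * a) `^ q)%:E <= S)%E) ->
  ((F * a%:E) `^ q <= S)%E.
Proof.
move=> F0 a0 q0 S0 h; case: S S0 h => [c| |]//; rewrite ?lee_fin => c0 h; last by rewrite leey.
have cq0 : 0 <= c `^ q^-1 by exact: powR_ge0.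
have big s : c `^ q^-1 < s * a -> c < (s * a) `^ q.
  move=> lt; have -> : c = (c `^ q^-1) `^ q by rewrite -powRrM mulVf ?gt_eqF// powRr1.
  by rewrite gt0_ltr_powR ?nnegrE// ltW// (le_lt_trans cq0).
case: F F0 h => [r| |]//; rewrite ?lee_fin => r0 h.
  rewrite leNgt; apply/negP => lt.
  have lt' : c `^ q^-1 < r * a.
    rewrite ltNge; apply/negP => le; move: lt; rewrite ltNge => /negP; apply.
    have -> : c = (c `^ q^-1) `^ q by rewrite -powRrM mulVf ?gt_eqF// powRr1.
    by rewrite ge0_ler_powR ?nnegrE ?(ltW q0)// mulr_ge0// ltW.
  pose s := (c `^ q^-1 / a + r) / 2.
  have sr : c `^ q^-1 / a < r by rewrite ltr_pdivrMr.
  have s0 : 0 <= s by rewrite divr_ge0// addr_ge0// divr_ge0// ltW.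
  have s1 : (s%:E < r%:E)%E by rewrite lte_fin /s; move: sr; lra.
  have := h s s0 s1; rewrite lee_fin leNgt big// -ltr_pdivrMr// /s; move: sr; lra.
pose s := (c `^ q^-1 + 1) / a.
have s0 : 0 <= s by rewrite divr_ge0 ?addr_ge0// ltW.
have := h s s0 (ltry s); rewrite lee_fin leNgt big//.
by rewrite /s divfK ?gt_eqF// ltrDl.
Qed.

(** * Shifted dyadic grids on the line *)

Section grid.
Context {R : realType}.

(* The one-third trick: because [1/3 - 2 * (2/3) = -1] and [2/3 - 2 * (1/3) = 0] are
   integers, the alternation of the two offsets keeps the shifted grids nested. *)
Definition grid_offset (b : bool) (k : int) : R :=
  if b then if odd `|k|%N then 2 / 3 else 3^-1 else 0.

Lemma grid_offset_step b k : exists z : int,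
  grid_offset b k - 2 * grid_offset b (k + 1) = z%:~R.
Proof.
have oddS : odd (absz (k + 1)) = ~~ odd (absz k).
  by clear; lia.
rewrite /grid_offset oddS; case: b; last by exists 0; rewrite mulr0 subr0.
by case: (odd _) => /=; [exists 0|exists (-1)]; rewrite ?mulrN1z; field.
Qed.

Definition grid_index b k (s : R) : int := Num.floor (s / 2 `^ k%:~R - grid_offset b k).

Let pow2 (k : int) : 0 < (2 : R) `^ k%:~R. Proof. exact: powR_gt0. Qed.

Let pow2S (k : int) : (2 : R) `^ (k + 1)%:~R = 2 * 2 `^ k%:~R.
Proof.
rewrite intrD mulr1z powRD; last by rewrite pnatr_eq0 implybT.
by rewrite powRr1// mulrC.
Qed.

Lemma grid_indexP b k s z : (2 `^ k%:~R * (z%:~R + grid_offset b k) <= s <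
   2 `^ k%:~R * (z%:~R + grid_offset b k) + 2 `^ k%:~R) = (grid_index b k s == z).
Proof.
set P := 2 `^ k%:~R; set o := grid_offset b k.
have -> : (P * (z%:~R + o) <= s < P * (z%:~R + o) + P) = (z%:~R <= s / P - o < (z + 1)%:~R).
  have P0 : 0 < P by exact: pow2.
  rewrite lerBrDr ltrBlDr ler_pdivlMr// ltr_pdivrMr// [_ * P]mulrC.
  by congr (_ && (_ < _)); rewrite intrD mulr1z; ring.
by apply/idP/eqP => [/floor_def//|<-]; exact: floor_itv.
Qed.

(** Passing to the next scale turns w into (w + z)/2 with the integer z of [grid_offset_step], and
    the integer part of this depends on w only through the integer part of w. *)
Lemma grid_index_step b k s s' : grid_index b k s = grid_index b k s' ->
  grid_index b (k + 1) s = grid_index b (k + 1) s'.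
Proof.
have [z hz] := grid_offset_step b k.
have half t : t / 2 `^ (k + 1)%:~R - grid_offset b (k + 1) =
    (t / 2 `^ k%:~R - grid_offset b k + z%:~R) / 2.
  by rewrite -hz pow2S; field; rewrite gt_eqF.
rewrite /grid_index !half.
move: (s / _ - _) (s' / _ - _) => u u' uu'.
have key (w v : R) : Num.floor w = Num.floor v -> Num.floor ((w + z%:~R) / 2) <= Num.floor ((v + z%:~R) / 2).
  move=> wv; rewrite floor_ge_int ler_pdivlMr// -lerBlDr.
  set t := Num.floor _.
  have -> : t%:~R * 2 - z%:~R = (t * 2 - z)%:~R :> R by rewrite intrB intrM.
  rewrite -floor_ge_int -wv floor_ge_int intrB intrM lerBlDr -ler_pdivlMr//.
  by case/andP: (floor_itv ((w + z%:~R) / 2)).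
by apply/eqP; rewrite eq_le !key.
Qed.

Lemma grid_index_coarser b k k' s s' : k <= k' -> grid_index b k s = grid_index b k s' ->
  grid_index b k' s = grid_index b k' s'.
Proof.
move=> kk h; have [d ->] : exists d : nat, k' = k + d by exists `|k' - k|%N; lia.
elim: d => [|d ih]; first by rewrite addr0.
by rewrite -addn1 PoszD addrA; exact: grid_index_step.
Qed.

(** In units of the cell the interval has length at most 1/3 and starts in [z, z + 1). If it starts
    no later than z + 2/3, the unshifted cell contains it; otherwise the shifted one does, with left
    end at most z + 2/3 and right end at least z + 4/3. *)
Lemma one_third (x r : R) k : 0 < r -> 6 * r <= 2 `^ k%:~R ->
  exists b z, forall y, `|y - x| < r -> grid_index b k y = z.
Proof.
move=> r0 hr; set P := 2 `^ k%:~R in hr; have P0 : 0 < P by exact: pow2.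
set rho := r / P; have rho0 : 0 < rho by rewrite divr_gt0.
have rho6 : 6 * rho <= 1 by rewrite /rho mulrA ler_pdivrMr// mul1r.
set u := x / P; set z := Num.floor (u - rho).
have /andP[z1 z2] := floor_itv (u - rho); rewrite -/z in z1 z2.
have main b : z%:~R + grid_offset b k <= u - rho -> u + rho <= z%:~R + grid_offset b k + 1 ->
    forall y, `|y - x| < r -> grid_index b k y = z.
  move=> h1 h2 y; rewrite ltr_norml => /andP[y1 y2].
  apply/eqP; rewrite -grid_indexP -/P.
  have e1 : u - rho < y / P by rewrite /u /rho -mulrBl ltr_pM2r ?invr_gt0//; move: y1; lra.
  have e2 : y / P < u + rho by rewrite /u /rho -mulrDl ltr_pM2r ?invr_gt0//; move: y2; lra.
  apply/andP; split.
    by rewrite mulrC -ler_pdivlMr// (le_trans h1)// ltW.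
  rewrite -[X in _ + X]mulr1 -mulrDr mulrC -ltr_pdivrMr//.
  exact: lt_le_trans h2.
have [le|gt] := leP (u - rho) (z%:~R + 2 / 3).
  by exists false, z; apply: main; rewrite /grid_offset; move: z1 z2 le rho6; lra.
exists true, z; apply: main; rewrite /grid_offset; case: (odd _); move: z1 z2 gt rho6; rewrite ?intrD; lra.
Qed.

Lemma dyadic_scale (r : R) : 0 < r -> exists k : int, r <= 2 `^ k%:~R <= 2 * r.
Proof.
move=> r0; exists (lev 2 r + 1).
have h1 : 2 `^ (lev 2 r)%:~R <= r by apply: lev_le; rewrite ?ltr1n.
have h2 : r < 2 `^ ((lev 2 r)%:~R + 1) by apply: lev_gt; rewrite ?ltr1n.
move: h2; rewrite -[1 in X in X -> _](mulr1z (1 : R)) -intrD pow2S => /ltW ->/=.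
by rewrite ler_pM2l.
Qed.

End grid.

(** * The maximal operator over cubes and over balls *)

Lemma big_option (S : Type) (idx : S) (op : Monoid.com_law idx) (I : finType) (F : option I -> S) :
  \big[op/idx]_k F k = op (F None) (\big[op/idx]_i F (Some i)).
Proof.
rewrite (bigD1 None)//=; congr (op _ _).
by rewrite (reindex_omap Some id) => [|[]]//=; apply: eq_bigl => i; rewrite eqxx.
Qed.

Lemma nnmfunM_scaled d (T : measurableType d) (R : realType) (h v : T -> R) (c : R) :
  nnmfun h -> nnmfun v -> 0 <= c -> nnmfun (fun y => h y * (v y / c)).
Proof.
by move=> nh nv c0; apply: nnmfunM => //; apply: nnmfunM => //; apply: nnmfun_cst; rewrite invr_ge0.
Qed.

Lemma nnmfun_cst_powR d (T : measurableType d) (R : realType) (c : R) (p : T -> R) :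
  0 <= c -> measurable_fun setT p -> nnmfun (fun y => c `^ p y).
Proof. by move=> c0 mp; apply: nnmfun_powR => //; exact: nnmfun_cst. Qed.

Lemma nnint_sum_cut d (T : measurableType d) (R : realType) (mu : {measure set T -> \bar R})
    (I J : finType) (S : pred I) (E : I -> set T) (F : I -> J -> T -> R) (c : R) :
  (forall i, measurable (E i)) -> (forall i j, nnmfun (F i j)) -> 0 <= c ->
  (\int[mu]_x (\sum_(i | S i) c * ((\sum_j F i j x) * \1_(E i) x))%:E =
   c%:E * \sum_(i | S i) \sum_j \int[mu]_(x in E i) (F i j x)%:E)%E.
Proof.
move=> mE nF c0.
have nG i : nnmfun (fun x => \sum_j F i j x) by exact: nnmfun_sum.
have nGE i : nnmfun (fun x => (\sum_j F i j x) * \1_(E i) x).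
  by apply: nnmfunM => //; exact: nnmfun_indic.
rewrite nnint_sum//; last by move=> i _; exact: nnmfunZ.
under eq_bigr do rewrite nnintZ// -nnint_mkcond nnint_sum//.
rewrite -ge0_sume_distrr// => i _; apply: sume_ge0 => j _.
by apply: nnint_ge0 => y; exact: nnmfun_ge0 (nF i j).
Qed.

Lemma nnint_sum_bound d (T : measurableType d) (R : realType) (mu : {measure set T -> \bar R})
    (I : finType) (F : I -> T -> R) (c C : R) : 0 <= c -> (forall i, nnmfun (F i)) ->
  (forall i, \int[mu]_x (F i x)%:E <= C%:E)%E ->
  nnmfun (fun x => c * \sum_i F i x) /\
  (\int[mu]_x (c * \sum_i F i x)%:E <= (c * (#|I|%:R * C))%:E)%E.
Proof.
move=> c0 nF hC; have nS : nnmfun (fun x => \sum_i F i x) by exact: nnmfun_sum.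
split; first exact: nnmfunZ.
rewrite nnintZ// nnint_sum// EFinM lee_wpmul2l ?lee_fin//.
apply: le_trans (lee_sum _ (fun i _ => hC i)) _.
by rewrite sumEFin lee_fin sumr_const -[leLHS]mulr_natl.
Qed.

Section cell.
Context {R : realType} {n : nat}.
Local Notation T := (Rn R n).

Definition cell (t : 'I_n -> bool) (J : int * {ffun 'I_n -> int}) : ('I_n -> R) * int :=
  (fun i => 2 `^ J.1%:~R * ((J.2 i)%:~R + grid_offset (t i) J.1), J.1).

Definition dside (J : ('I_n -> R) * int) : R := 2 `^ J.2%:~R.
Definition dcube (J : ('I_n -> R) * int) : set T := cube J.1 (dside J).

Lemma dside_gt0 J : 0 < dside J. Proof. exact: powR_gt0. Qed.
Lemma measurable_dcube J : measurable (dcube J). Proof. exact: measurable_cube. Qed.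
Lemma lebesgueRn_dcube J : lebesgueRn R n (dcube J) = (dside J ^+ n)%:E.
Proof. exact/lebesgueRn_cube/dside_gt0. Qed.

Lemma cellP t J y : dcube (cell t J) y <->
  forall i, grid_index (t i) J.1 ((y : 'rV[R]_n) ord0 i) = J.2 i.
Proof.
split => h i; first by apply/eqP; rewrite -grid_indexP; exact: h.
by have /eqP := h i; rewrite -grid_indexP.
Qed.

Lemma laminar_cell t (s : seq (int * {ffun 'I_n -> int})) :
  laminar (fun i : seq_sub s => dcube (cell t (ssval i))) (fun i => (cell t (ssval i)).2).
Proof.
move=> i j [x [/cellP xi /cellP xj]] /= ij; split => [y /cellP yi|e].
  apply/cellP => k; rewrite -(xj k); apply: (grid_index_coarser ij).
  by rewrite (xi k) (yi k).
apply: val_inj => /=; move: e xi xj; case: (ssval i) => ki zi; case: (ssval j) => kj zj /= <-.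
by move=> xi xj; congr (_, _); apply/ffunP => k; rewrite -(xi k) -(xj k).
Qed.

(** The offset is chosen coordinate by coordinate, whence 2^n grids. The factor 12 is the 6 of
    [one_third] times the 2 lost in rounding to a power of two. *)
Lemma eball_sub_cell (x : T) r : 0 < r -> exists t : {ffun 'I_n -> bool}, exists J,
  eball x r `<=` dcube (cell t J) /\ dside (cell t J) <= 12 * r.
Proof.
move=> r0; have r6 : 0 < 6 * r by rewrite mulr_gt0.
have [k /andP[k1 k2]] := dyadic_scale r6.
have /choice[bz hbz] : forall i, exists bz : bool * int, forall y,
    `|y - (x : 'rV[R]_n) ord0 i| < r -> grid_index bz.1 k y = bz.2.
  by move=> i; have [b [z h]] := one_third ((x : 'rV[R]_n) ord0 i) r0 k1; exists (b, z).
exists [ffun i => (bz i).1], (k, [ffun i => (bz i).2]); split.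
  move=> y xy; apply/cellP => i /=; rewrite !ffunE; apply: hbz.
  apply: le_lt_trans xy; apply: le_trans (coord_le_enorm _ i).
  by rewrite !mxE.
by rewrite /dside/= (le_trans k2)// mulrA -natrM.
Qed.

End cell.

(** * From single weights to the multilinear maximal operator *)

Section dyadic.
Context {R : realType} {n m : nat}.
Local Notation T := (Rn R n).
Local Notation mu := (lebesgueRn R n).
Hypotheses (n_gt0 : (0 < n)%N) (m_gt0 : (0 < m)%N).
Variables (p : 'I_m -> T -> R) (q om : T -> R) (v : 'I_m -> T -> R) (pm em ep g A : R).
Hypotheses (LHp : forall j, log_holder (p j)) (mp : forall j, measurable_fun setT (p j)).
Hypotheses (pm1 : 1 < pm) (p_ge : forall j y, pm <= p j y) (mq : measurable_fun setT q).

(* The index [None] stands for the exponent [q] and the weight [om] (the product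
   of the w_i), the index [Some j] for the exponent [p_j'] and [v j = w_j^-1]; in this
   way the A_{p,q} condition is symmetric and the weights have product 1. *)
Definition apq_exponent (k : option 'I_m) : T -> R :=
  if k is Some j then conj_exponent (p j) else q.
Definition apq_weight (k : option 'I_m) : T -> R := if k is Some j then v j else om.
Local Notation e := apq_exponent.
Local Notation u := apq_weight.

Hypotheses (em0 : 0 < em) (e_bnd : forall k y, em <= e k y <= ep).
Hypotheses (nu : forall k, nnmfun (u k)) (u_gt0 : forall k y, 0 < u k y).
Hypotheses (g0 : 0 < g) (gm : g <= m%:R) (sum_e : forall y, \sum_k (e k y)^-1 = g).
Hypothesis prod_u : forall y, \prod_k u k y = 1.
Hypothesis ball_fin : forall k (x : T) r, 0 < r -> (lnorm mu (e k) (u k) (eball x r) < +oo)%E.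
Hypotheses (A0 : 0 < A) (ball_prod : forall (x : T) r, 0 < r ->
  \prod_k fine (lnorm mu (e k) (u k) (eball x r)) <= A * fine (mu (eball x r)) `^ g).

Definition dnorm k J := fine (lnorm mu (e k) (u k) (dcube J)).
Local Notation N := dnorm.

Let ep0 : 0 < ep.
Proof. by have /andP[h1 /(lt_le_trans _) h2] := e_bnd None 0; apply: h2; exact: lt_le_trans h1. Qed.

Let me k : measurable_fun setT (e k).
Proof.
case: k => [j|]; last exact: mq.
by apply: measurable_conj => // y; exact: lt_le_trans (p_ge j y).
Qed.

Lemma dcube_sub_eball J : exists2 x : T, dcube J `<=` eball x (n.+1%:R * dside J) & True.
Proof.
exists (\row_i J.1 i) => // y Qy; rewrite /eball/=.
apply: le_lt_trans (enorm_le_l1norm _) _.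
apply: (@le_lt_trans _ _ (n%:R * dside J)); last by rewrite ltr_pM2r ?dside_gt0// ltr_nat.
apply: l1norm_le => i; rewrite !mxE ger0_norm ?subr_ge0; have /andP[h1 h2] := Qy i => //.
by rewrite lerBlDl ltW.
Qed.

Lemma dnorm_fin k J : (lnorm mu (e k) (u k) (dcube J) < +oo)%E.
Proof.
have [x sub _] := dcube_sub_eball J.
apply: le_lt_trans (ball_fin k x (r := n.+1%:R * dside J) _).
  by apply: (lnorm_subset mu (me k) (nu k)) => //; [exact: measurable_dcube|exact: measurable_eball].
by rewrite mulr_gt0// dside_gt0.
Qed.

Let muQ J : (0 < mu (dcube J))%E.
Proof. by rewrite lebesgueRn_dcube lte_fin exprn_gt0// dside_gt0. Qed.

Lemma dnorm_gt0 k J : 0 < N k J.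
Proof.
apply: (fine_lnorm_gt0 em0 (me k) (nu k) (u_gt0 k) (e_bnd k)) => //; first exact: measurable_dcube.
exact: dnorm_fin.
Qed.

Lemma dnorm_mod k J : (\int[mu]_(y in dcube J) ((u k y / N k J) `^ e k y)%:E <= 1)%E.
Proof.
apply: (modular_lnorm_le1 em0 ep0 (me k) (nu k) (u_gt0 k) (e_bnd k)) => //; first exact: measurable_dcube.
exact: dnorm_fin.
Qed.

Lemma dnorm_prod : exists2 D : R, 0 < D & forall J,
  \prod_k N k J <= D * (dside J ^+ n) `^ g.
Proof.
exists (A * ((2 * n.+1%:R) ^+ n) `^ g) => [|J]; first by rewrite mulr_gt0// powR_gt0// exprn_gt0// mulr_gt0.
have [x sub _] := dcube_sub_eball J.
have r0 : 0 < n.+1%:R * dside J by rewrite mulr_gt0// dside_gt0.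
apply: (@le_trans _ _ (\prod_k fine (lnorm mu (e k) (u k) (eball x (n.+1%:R * dside J))))).
  apply: ler_prod => k _; rewrite ltW ?dnorm_gt0//= fine_le//.
  - by rewrite ge0_fin_numE ?lnorm_ge0// dnorm_fin.
  - by rewrite ge0_fin_numE ?lnorm_ge0// ball_fin.
  - by apply: (lnorm_subset mu (me k) (nu k)) => //; [exact: measurable_dcube|exact: measurable_eball].
apply: le_trans (ball_prod x r0) _.
have d0 := dside_gt0 J.
rewrite -mulrA ler_pM2l// -powRM ?exprn_ge0 ?mulr_ge0 ?(ltW d0)//.
have f0 := fine_eball_gt0 x r0.
rewrite ge0_ler_powR ?nnegrE ?(ltW g0) ?(ltW f0)// -?exprMn ?exprn_ge0 ?mulr_ge0 ?(ltW d0)//.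
by rewrite -mulrA; exact: fine_eball_le.
Qed.

Let compare k (x : T) r E : 0 < r -> measurable E -> E `<=` eball x r ->
  (0 < mu E)%E ->
  (fine (mu E) / fine (mu (eball x r))) `^ g * fine (lnorm mu (e k) (u k) (eball x r)) <=
  (m.+1%:R `^ g * A) * fine (lnorm mu (e k) (u k) E).
Proof.
move=> r0 mE sub muE.
have := @lnorm_compare _ _ _ _ mu _ _ _ _ _ em0 ep0 g0 me nu u_gt0 e_bnd sum_e prod_u
  (eball x r) A (measurable_eball x r) _ (fun k => ball_fin k x r0) (ball_prod x r0)
  E k mE sub muE.
rewrite card_option card_ord; apply.
by rewrite -ge0_fin_numE//; exact: lebesgueRn_eball_fin.
Qed.

Let Cst := m.+1%:R `^ g * A.
Let Cst0 : 0 < Cst. Proof. by rewrite mulr_gt0// powR_gt0. Qed.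

Lemma dcube_average_le j J (h : T -> R) : nnmfun h ->
  (\int[mu]_y (h y `^ p j y)%:E <= 1)%E ->
  (\int[mu]_(y in dcube J) (h y * (v j y / N (Some j) J))%:E <= 2%:E)%E.
Proof.
move=> nh h1.
have vN0 y : 0 <= v j y / N (Some j) J.
  by rewrite divr_ge0 ?(ltW (u_gt0 (Some j) y))// ltW// dnorm_gt0.
have nV : nnmfun (fun y => (v j y / N (Some j) J) `^ e (Some j) y).
  by apply: (nnmfun_scaled_powR (me (Some j)) (nu (Some j))); exact: dnorm_gt0.
have nhp : nnmfun (fun y => h y `^ p j y) by exact: nnmfun_powR.
apply: (@le_trans _ _ (\int[mu]_(y in dcube J)
   (h y `^ p j y + (v j y / N (Some j) J) `^ e (Some j) y)%:E)%E).
  apply: nnint_le => [y|y _]; first exact: mulr_ge0 (nnmfun_ge0 y nh) (vN0 y).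
  by apply: young_le; [exact: lt_le_trans (p_ge j y)|exact: nnmfun_ge0|exact: vN0].
rewrite nnintD//; last exact: measurable_dcube.
have -> : 2%:E = (1 + 1 :> \bar R)%E by rewrite -EFinD.
apply: leeD; last exact: (dnorm_mod (Some j) J).
apply: le_trans h1; apply: nnint_subset => //; exact: measurable_dcube.
Qed.

Lemma dyadic_component j : exists C : R, forall h : T -> R, nnmfun h ->
  (\int[mu]_y (h y `^ p j y)%:E <= 1)%E ->
  forall (I : finType) (c : I -> ('I_n -> R) * int) (S : pred I) (E : I -> set T),
  laminar (fun i => dcube (c i)) (fun i => (c i).2) ->
  (forall i, measurable (E i)) -> (forall i, S i -> E i `<=` dcube (c i)) ->
  (forall x, (#|[pred i | S i && `[< E i x >]]| <= 2)%N) ->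
  (forall i, S i -> dside (c i) ^+ n / 2 <= fine (mu (E i))) ->
  forall b : I -> R,
  (forall i, \int[mu]_(y in dcube (c i)) (h y * (v j y / N (Some j) (c i)))%:E = (b i)%:E)%E ->
  (\sum_(i | S i) \int[mu]_(y in E i)
     ((b i / 2) `^ p j y * (om y / N None (c i)) `^ q y)%:E <= C%:E)%E.
Proof.
have gl k := growth_lower n_gt0 em0 g0 (me k) (nu k) (u_gt0 k) (e_bnd k)
  (ball_fin k) (@compare k).
have [Cl hl] := gl (Some j).
have [Cl0 hl0] := gl None.
have [Cu hu] := growth_upper n_gt0 em0 g0 Cst0 (me (Some j)) (nu (Some j)) (u_gt0 (Some j)) (e_bnd (Some j))
  (ball_fin (Some j)) (@compare (Some j)).
have [delta d0 [Cd hd]] := growth_double n_gt0 em0 ep0 g0 Cst0 (me (Some j)) (nu (Some j)) (u_gt0 (Some j)) (e_bnd (Some j))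
  (ball_fin (Some j)) (@compare (Some j)).
have [K1 K10 [C6 C60 decay]] := growth_decay em0 ep0 g0 Cst0 (me (Some j)) (nu (Some j)) (u_gt0 (Some j)) (e_bnd (Some j))
  (ball_fin (Some j)) (@compare (Some j)).
have [K2 K20 [C7 C70 decay0]] := growth_decay em0 ep0 g0 Cst0 (me None) (nu None) (u_gt0 None) (e_bnd None)
  (ball_fin None) (@compare None).
have [c1 c10 mass] := growth_mass n_gt0 em0 ep0 g0 Cst0 (me (Some j)) (nu (Some j)) (u_gt0 (Some j)) (e_bnd (Some j))
  (ball_fin (Some j)) (@compare (Some j)).
have [CL hCL] := log_holder_cube n_gt0 (LHp j) (p_ge j).
have /choice[pQ hpQ] : forall J : ('I_n -> R) * int, exists pQ, pm <= pQ /\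
    forall y, dcube J y -> `|p j y - pQ| * ln (Xn y + (dside J)^-1) <= CL.
  by move=> J; have [t t1 t2] := hCL J.1 _ (dside_gt0 J); exists t.
set K0 := 2 * (n%:R * g) in hl hl0 hu.
have K00 : 0 <= K0 by rewrite /K0 !mulr_ge0// ltW.
pose C0 := Num.max (Num.max (Num.max Cl Cl0) (Num.max Cu Cd)) 1.
have [C0Cl C0Cl0 C0Cu C0Cd C01] : [/\ Cl <= C0, Cl0 <= C0, Cu <= C0, Cd <= C0 & 1 <= C0].
  by rewrite /C0; split; rewrite !le_max lexx ?orbT.
have N0 := dnorm_gt0 (Some j).
have Xe (y : T) : expR 1 <= Xn y by rewrite /Xn lerDl l1norm_ge0.
have X0 (y : T) : 0 < Xn y by apply: lt_le_trans (Xn_ge1 _).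
have scale k a b c J : a <= c -> b <= a * N k J -> b <= c * N k J.
  by move=> ac /le_trans; apply; rewrite ler_wpM2r// ltW// dnorm_gt0.
have lower J y : dcube J y -> (Xn y + (dside J)^-1) `^ (- K0) <= C0 * N (Some j) J.
  by move=> Qy; apply: scale C0Cl _; exact: (hl _ _ _ (dside_gt0 J) Qy).
have lower0 J y : dcube J y -> (Xn y + (dside J)^-1) `^ (- K0) <= C0 * N None J.
  by move=> Qy; apply: scale C0Cl0 _; exact: (hl0 _ _ _ (dside_gt0 J) Qy).
have upper J y : dcube J y -> N (Some j) J <= C0 * (Xn y + dside J) `^ K0.
  move=> Qy; apply: le_trans (hu _ _ _ (dside_gt0 J) Qy) _.
  by rewrite ler_wpM2r ?powR_ge0.
have doubling J y : dcube J y -> Xn y <= dside J -> dside J `^ delta <= C0 * N (Some j) J.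
  by move=> Qy Xl; apply: scale C0Cd _; exact: (hd _ _ _ (dside_gt0 J) Qy Xl).
have [CC hCC] := @linear_estimate _ T R mu _ dcube dside (@Xn R n) (p j) (v j) pQ (N (Some j))
  pm CL C0 K0 K1 C6 delta c1 measurable_dcube dside_gt0 (nnmfun_measurable nnmfun_Xn)
  Xe (mp j) pm1 (p_ge j) (fun J => (hpQ J).1) (fun J y => (hpQ J).2 y)
  (nnmfun_measurable (nu (Some j))) (u_gt0 (Some j)) N0 C01 K00 K10 C60 d0 c10
  (dnorm_mod (Some j)) lower upper doubling decay.
(* [K0 * ep] compensates the factor N^(-q), and [K2] makes om^q integrable. *)
pose K := K0 * ep + K2.
have K_0 : 0 <= K by rewrite /K addr_ge0// mulr_ge0// ltW.
pose C2 := expR (K * CL); have C20 : 0 <= C2 by exact: expR_ge0.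
pose Bq i y := (om y / N None i) `^ q y.
have nBq J : nnmfun (Bq J).
  by apply: (nnmfun_scaled_powR (me None) (nu None)); exact: dnorm_gt0.
have q_bnd y : em <= q y <= ep by exact: (e_bnd None).
have q0 y : 0 < q y by have /andP[h _] := q_bnd y; exact: lt_le_trans h.
have errB J y : dcube J y -> (Xn y + (dside J)^-1) `^ (- K) * Bq J y <=
    C0 `^ ep * (Xn y `^ (- K2) * om y `^ q y).
  move=> Qy; have om0 : 0 <= om y := ltW (u_gt0 None y).
  set L := Xn y + _; have L1 : 1 <= L.
    by rewrite /L (le_trans (Xn_ge1 y))// lerDl invr_ge0 ltW// dside_gt0.
  have L0 : 0 < L by apply: lt_le_trans L1.
  have Ni : (N None J)^-1 <= C0 * L `^ K0.
    have := lower0 J y Qy; rewrite powRN -/L => h.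
    rewrite -[leLHS]mul1r ler_pdivrMr ?dnorm_gt0// mulrAC.
    by rewrite -ler_pdivrMr ?powR_gt0// mul1r.
  have C00 : 0 <= C0 by apply: le_trans C01.
  have Nq : (N None J)^-1 `^ q y <= C0 `^ ep * L `^ (K0 * ep).
    have /andP[_ qe] := q_bnd y.
    apply: le_trans (ge0_ler_powR (ltW (q0 y)) _ _ Ni) _; rewrite ?nnegrE ?mulr_ge0 ?powR_ge0//.
      by rewrite invr_ge0 ltW// dnorm_gt0.
    rewrite (powRM _ C00 (powR_ge0 _ _)) -[X in _ * X <= _]powRrM.
    by apply: ler_pM; rewrite ?powR_ge0//; apply: ler_powR => //; rewrite ler_wpM2l.
  rewrite /Bq (powRM _ om0) ?invr_ge0 ?(ltW (dnorm_gt0 _ _))//.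
  have LK : L `^ (- K) = L `^ (- (K0 * ep)) * L `^ (- K2).
    by rewrite /K opprD powRD// (gt_eqF L0) implybT.
  have L2 : L `^ (- K2) <= Xn y `^ (- K2).
    by apply: ler_powRN => //; rewrite lerDl invr_ge0 ltW// dside_gt0.
  have LL : L `^ (- (K0 * ep)) * L `^ (K0 * ep) = 1.
    by rewrite powRN mulVf// gt_eqF// powR_gt0.
  rewrite LK; set a1 := L `^ (- (K0 * ep)) in LL *; set a2 := L `^ (- K2) in L2 *.
  set a3 := om y `^ _; set a4 := (N None J)^-1 `^ _ in Nq *.
  have -> : a1 * a2 * (a3 * a4) = (a1 * a4) * (a2 * a3) by ring.
  apply: ler_pM; rewrite ?mulr_ge0 ?powR_ge0//.
    apply: le_trans (ler_wpM2l (powR_ge0 _ _) Nq) _.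
    by rewrite mulrCA LL mulr1.
  by rewrite ler_wpM2r ?powR_ge0.
exists (C2 * CC + 2 * (C0 `^ ep * C7)) => h nh h1 I c S E lam mE EQ ov Em b bE.
have cc := hCC h nh h1 I c (fun i => (c i).2) S E (fun i => erefl) lam mE EQ ov _ b bE.
have {cc} : \sum_(i | S i) (b i / 2) `^ pQ (c i) <= CC.
  by apply: cc => i Si; apply: mass => //; [exact: dside_gt0|exact: EQ|exact: Em].
move=> cc.
have vN0 i y : 0 <= v j y / N (Some j) (c i).
  by rewrite divr_ge0 ?(ltW (u_gt0 (Some j) y))// ltW// dnorm_gt0.
have b0 i : 0 <= b i.
  rewrite -lee_fin -bE; apply: nnint_ge0 => y.
  exact: mulr_ge0 (nnmfun_ge0 y nh) (vN0 i y).
have b2 i : b i / 2 <= 1.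
  by rewrite ler_pdivrMr// mul1r -lee_fin -bE; exact: dcube_average_le.
(* Averages below L^(-K) cannot be frozen, but there p >= 1 and b/2 <= 1 give the bound L^(-K)
   itself. *)
have freeze i y : dcube (c i) y -> (b i / 2) `^ p j y <=
    C2 * (b i / 2) `^ pQ (c i) + (Xn y + (dside (c i))^-1) `^ (- K).
  move=> Qy; set L := Xn y + _; have L1 : 1 <= L.
    by rewrite /L (le_trans (Xn_ge1 y))// lerDl invr_ge0 ltW// dside_gt0.
  have p1 := lt_le_trans pm1 (p_ge j y).
  have bb0 : 0 <= b i / 2 by rewrite divr_ge0.
  have [le|lt] := leP (L `^ (- K)) (b i / 2).
    have bp : 0 < b i / 2 by apply: lt_le_trans le; rewrite powR_gt0// (lt_le_trans _ L1).
    rewrite -[leLHS]addr0; apply: lerD; last exact: powR_ge0.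
    apply: (powR_freeze L1 bp K_0); last exact: (hpQ (c i)).2.
    rewrite le/= (le_trans (b2 i))//.
    by rewrite -(powRr0 L) ler_powR.
  rewrite -[leLHS]add0r; apply: lerD; first by rewrite mulr_ge0 ?powR_ge0.
  apply: le_trans (ltW lt); rewrite -[leRHS]powRr1//.
  have [->|bN0] := eqVneq (b i / 2) 0; first by rewrite !powR0 ?gt_eqF// (lt_trans _ p1).
  by apply: ger_powR; rewrite ?(ltW p1)// b2 andbT lt_neqAle eq_sym bN0.
have ndec : nnmfun (fun y : T => Xn y `^ (- K2) * om y `^ q y).
  apply: nnmfunM; last exact: nnmfun_powR (nu None) (me None).
  by apply: nnmfun_powR nnmfun_Xn _.
pose err y := C0 `^ ep * (Xn y `^ (- K2) * om y `^ q y).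
have nerr : nnmfun err by apply: nnmfunZ; [exact: powR_ge0|].
have nB i : nnmfun (fun y => C2 * (b i / 2) `^ pQ (c i) * Bq (c i) y).
  by apply: nnmfunZ; rewrite ?mulr_ge0 ?powR_ge0.
have step i : S i -> (\int[mu]_(y in E i) ((b i / 2) `^ p j y * Bq (c i) y)%:E <=
    (C2 * (b i / 2) `^ pQ (c i))%:E + \int[mu]_(y in E i) (err y)%:E)%E.
  move=> Si; apply: (@le_trans _ _ (\int[mu]_(y in E i)
    (C2 * (b i / 2) `^ pQ (c i) * Bq (c i) y + err y)%:E)%E).
    apply: nnint_le => [y|y Ey]; first by rewrite mulr_ge0 ?powR_ge0.
    have Qy := EQ _ Si _ Ey.
    apply: le_trans (ler_wpM2r (nnmfun_ge0 y (nBq (c i))) (freeze i y Qy)) _.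
    by rewrite mulrDl lerD2l; exact: errB.
  rewrite nnintD//; apply: leeD => //.
  rewrite nnintZ ?mulr_ge0 ?powR_ge0// -[leRHS]mule1.
  apply: lee_wpmul2l; first by rewrite lee_fin mulr_ge0 ?powR_ge0.
  apply: le_trans (dnorm_mod None (c i)).
  apply: nnint_subset => //; [exact: measurable_dcube|exact: EQ].
apply: le_trans (lee_sum _ step) _.
rewrite big_split/= sumEFin EFinD; apply: leeD.
  by rewrite lee_fin -mulr_sumr ler_wpM2l.
apply: (@le_trans _ _ (\int[mu]_y (2 * err y)%:E)%E).
  apply: nnint_sum_le => //.
  move=> y _; rewrite sumr_const -[leLHS]mulr_natl.
  by apply: ler_wpM2r; [exact: nnmfun_ge0|rewrite ler_nat; exact: ov].
rewrite nnintZ// EFinM lee_wpmul2l//.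
rewrite /err nnintZ ?powR_ge0// EFinM lee_wpmul2l// lee_fin powR_ge0//.
Qed.

Lemma dyadic_bound : exists C : R, forall h : 'I_m -> T -> R, (forall j, nnmfun (h j)) ->
  (forall j, \int[mu]_y (h j y `^ p j y)%:E <= 1)%E ->
  forall (I : finType) (c : I -> ('I_n -> R) * int),
  laminar (fun i => dcube (c i)) (fun i => (c i).2) ->
  forall M : T -> R, (forall x, 0 <= M x) ->
  (forall x, 0 < M x -> exists2 i, dcube (c i) x &
    ((M x)%:E <= ((dside (c i) ^+ n) `^ (- g))%:E *
       \prod_j \int[mu]_(y in dcube (c i)) (h j y * v j y)%:E)%E) ->
  (\int[mu]_x ((M x * om x) `^ q x)%:E <= C%:E)%E.
Proof.
have /choice[Cj hCj] := dyadic_component.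
have [D D0 prodN] := dnorm_prod.
pose a : R := (2 * m%:R) `^ g; have a0 : 0 < a by rewrite powR_gt0// mulr_gt0// ltr0n.
pose C1 := Num.max 1 (a * D * 2 ^+ m) `^ ep.
have C10 : 0 <= C1 by exact: powR_ge0.
exists (C1 * \sum_j Cj j) => h nh h1 I c lam M M0 hM.
pose b i j := fine (\int[mu]_(y in dcube (c i)) (h j y * (v j y / N (Some j) (c i)))%:E)%E.
have vN0 i j y : 0 <= v j y / N (Some j) (c i).
  by rewrite divr_ge0 ?(ltW (u_gt0 (Some j) y))// ltW// dnorm_gt0.
have hv0 i j : (0 <= \int[mu]_(y in dcube (c i)) (h j y * (v j y / N (Some j) (c i)))%:E)%E.
  by apply: nnint_ge0 => y; exact: mulr_ge0 (nnmfun_ge0 y (nh j)) (vN0 i j y).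
have bE i j : (\int[mu]_(y in dcube (c i)) (h j y * (v j y / N (Some j) (c i)))%:E = (b i j)%:E)%E.
  rewrite /b fineK// ge0_fin_numE//.
  by apply: le_lt_trans (dcube_average_le (c i) (nh j) (h1 j)) _; rewrite ltry.
have b0 i j : 0 <= b i j by rewrite -lee_fin -bE.
have b2 i j : b i j <= 2 by rewrite -lee_fin -bE; exact: dcube_average_le.
pose phi i j := b i j * N (Some j) (c i).
have nhv j : nnmfun (fun y => h j y * v j y) := nnmfunM (nh j) (nu (Some j)).
have phiE i j : (\int[mu]_(y in dcube (c i)) (h j y * v j y)%:E = (phi i j)%:E)%E.
  have nk : nnmfun (fun y => h j y * (v j y / N (Some j) (c i))).
    exact: (nnmfunM_scaled (nh j) (nu (Some j)) (ltW (dnorm_gt0 _ _))).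
  rewrite /phi mulrC EFinM -bE.
  rewrite -(nnintZ _ (measurable_dcube (c i)) (ltW (dnorm_gt0 (Some j) (c i))) nk).
  apply: eq_integral => y _; congr (_%:E).
  by field; rewrite gt_eqF// dnorm_gt0.
pose vol i := dside (c i) ^+ n.
have vol0 i : 0 < vol i by rewrite exprn_gt0// dside_gt0.
pose S := stopping (fun i => dcube (c i)) (fun i => (c i).2) g vol phi.
pose E := stopping_part (fun i => dcube (c i)) g vol phi.
have mE i : measurable (E i) by apply: measurable_stopping_part => ?; exact: measurable_dcube.
have EQ i : S i -> E i `<=` dcube (c i) by move=> _; exact: stopping_part_sub.
have ov := @stopping_overlap _ _ _ _ _ _ _ _ vol phi lam m_gt0 g0 gm.
have Emass i : S i -> dside (c i) ^+ n / 2 <= fine (mu (E i)).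
  by apply: (@stopping_part_ge _ _ _ mu _ _ _ _ _ vol _ phi lam _ m_gt0 g0 gm _ vol0 nhv phiE) => k;
    [exact: measurable_dcube|exact: lebesgueRn_dcube].
have comp j := hCj j (h j) (nh j) (h1 j) I c S E lam mE EQ ov Emass (fun i => b i j) (fun i => bE i j).
have q_bnd y : em <= q y <= ep by exact: (e_bnd None).
have q0 y : 0 < q y by have /andP[h' _] := q_bnd y; exact: lt_le_trans h'.
have om0 y : 0 <= om y := ltW (u_gt0 None y).
pose Bq i y := (om y / N None (c i)) `^ q y.
have nBq i : nnmfun (Bq i).
  by apply: (nnmfun_scaled_powR (me None) (nu None)); exact: dnorm_gt0.
pose G i y := \sum_j ((b i j / 2) `^ p j y * Bq i y).
have nGj i j : nnmfun (fun y => (b i j / 2) `^ p j y * Bq i y).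
  have bb : 0 <= b i j / 2 by rewrite divr_ge0.
  exact: nnmfunM (nnmfun_cst_powR bb (mp j)) (nBq i).
have nG i : nnmfun (G i) by exact: nnmfun_sum.
have nGE i : nnmfun (fun y => G i y * \1_(E i) y) by apply: nnmfunM => //; exact: nnmfun_indic.
(* The A_{p,q} bound replaces vol^(-g) by D over the product of all norms, and all of them but that
   of [om] cancel against the norms contained in [phi]. *)
have avg_le i : avgprod g vol phi i <= D * 2 ^+ m * (\prod_j (b i j / 2)) / N None (c i).
  have pb0 : 0 <= \prod_j (b i j) by apply: prodr_ge0.
  rewrite /avgprod /phi big_split/= powRN.
  have -> : \prod_j (b i j / 2) = (\prod_j b i j) / 2 ^+ m.
    by rewrite big_split/= prodr_const card_ord exprVn.
  have := prodN (c i); rewrite big_option/= -/(vol i) => hN.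
  rewrite ler_pdivlMr ?dnorm_gt0// mulrC.
  rewrite mulrCA ler_pdivrMl ?powR_gt0// mulrCA.
  apply: le_trans (ler_wpM2l pb0 hN) _; rewrite le_eqVlt; apply/orP; left; apply/eqP.
  by field; rewrite expf_neq0.
have pt x : (M x * om x) `^ q x <= \sum_(i | S i) C1 * (G i x * \1_(E i) x).
  have R0 i : S i -> 0 <= C1 * (G i x * \1_(E i) x).
    by move=> _; rewrite mulr_ge0// (nnmfun_ge0 x (nGE i)).
  have := M0 x; rewrite le_eqVlt => /predU1P[<-|Mx].
    by rewrite mul0r powR0 ?gt_eqF//; apply: sumr_ge0.
  have [k Qk Mk] := hM x Mx.
  have {}Mk : M x <= avgprod g vol phi k.
    rewrite -lee_fin; apply: le_trans Mk _.
    have -> : (\prod_j \int[mu]_(y in dcube (c k)) (h j y * v j y)%:E = \prod_j (phi k j)%:E)%E.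
      by apply: eq_bigr => j _; exact: phiE.
    by rewrite prodEFin -EFinM.
  have ck : 0 < avgprod g vol phi k by apply: lt_le_trans Mk.
  have [i [Si Ei cki _]] := stopping_cover lam m_gt0 g0 gm Qk ck.
  rewrite (bigD1 i)//= -[leLHS]addr0; apply: lerD; last first.
    by apply: sumr_ge0 => l /andP[Sl _]; exact: R0.
  rewrite indicE mem_set// mulr1.
  have p0 j y : 0 < p j y by apply: lt_le_trans (p_ge j y); exact: lt_trans pm1.
  pose B := \prod_j (b i j / 2).
  have b01 j : 0 <= b i j / 2 <= 1 by rewrite divr_ge0//= ler_pdivrMr// mul1r.
  have B0 : 0 <= B by apply: prodr_ge0 => j _; case/andP: (b01 j).
  have B1 : B <= 1 by apply: prodr_ile1 => j _; exact: b01.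
  have N00 := dnorm_gt0 None (c i).
  have oN0 : 0 <= om x / N None (c i) by rewrite divr_ge0// ltW.
  have M1 : M x * om x <= Num.max 1 (a * D * 2 ^+ m) * (B * (om x / N None (c i))).
    apply: (@le_trans _ _ (a * D * 2 ^+ m * (B * (om x / N None (c i))))); last first.
      by apply: ler_wpM2r; [exact: mulr_ge0|rewrite le_max lexx orbT].
    apply: le_trans (ler_wpM2r (om0 x) Mk) _.
    apply: le_trans (ler_wpM2r (om0 x) cki) _.
    apply: le_trans (ler_wpM2r (om0 x) (ler_wpM2l (ltW a0) (avg_le i))) _.
    by rewrite le_eqVlt -/B; apply/orP; left; apply/eqP; ring.
  have m10 : 0 <= Num.max 1 (a * D * 2 ^+ m) by rewrite le_max ler01.
  have BO0 := mulr_ge0 B0 oN0.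
  apply: le_trans (ge0_ler_powR (ltW (q0 x)) _ _ M1) _.
  - by rewrite nnegrE mulr_ge0.
  - by rewrite nnegrE (mulr_ge0 m10 BO0).
  rewrite (powRM _ m10 (mulr_ge0 B0 oN0)) (powRM _ B0 oN0).
  apply: ler_pM; rewrite ?mulr_ge0 ?powR_ge0//.
    have /andP[_ qe] := q_bnd x.
    by rewrite /C1 ler_powR// le_max lexx.
  rewrite /G -mulr_suml; apply: ler_wpM2r; first exact: powR_ge0.
  (* The reciprocal of the harmonic exponent. As g <= m, q is at least 1/g1, and B <= 1 allows the
     power q to be lowered to 1/g1, for which the product is at most the sum. *)
  pose g1 := \sum_j (p j x)^-1.
  have g10 : 0 < g1.
    by rewrite /g1 (bigD1 (Ordinal m_gt0))//= ltr_wpDr ?invr_gt0// sumr_ge0// => j _; rewrite invr_ge0 ltW.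
  have := prod_powR_le_sum g10 (fun j => proj1 (andP (b01 j))) (fun j => p0 j x) erefl.
  apply: le_trans.
  have [B00|BN0] := eqVneq B 0.
    rewrite B00 powR0 ?gt_eqF// powR_ge0//.
  apply: ger_powR; first by rewrite lt_neqAle eq_sym BN0 B0.
  have := sum_e x; rewrite big_option/= => sx.
  rewrite -[leRHS]invrK lef_pV2 ?posrE ?invr_gt0//.
  have : \sum_(j < m) (conj_exponent (p j) x)^-1 = m%:R - g1.
    rewrite -[m in m%:R](card_ord m) -sumr_const -sumrB; apply: eq_bigr => j _.
    by have := conj_inv (lt_le_trans pm1 (p_ge j x)) => <-; rewrite addrAC subrr add0r.
  by move=> sj; rewrite -(lerD2r (m%:R - g1)) -sj sx sj [leRHS]addrC subrK.
apply: (@le_trans _ _ (\int[mu]_x (\sum_(i | S i) C1 * (G i x * \1_(E i) x))%:E)%E).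
  by apply: nnint_le => [x|x _]; [exact: powR_ge0|exact: pt].
rewrite (nnint_sum_cut mu S mE nGj C10).
rewrite exchange_big/= EFinM lee_wpmul2l// -sumEFin.
by apply: lee_sum => j _; exact: comp.
Qed.

Lemma dcube_integral_fin j J (h : T -> R) : nnmfun h ->
  (\int[mu]_y (h y `^ p j y)%:E <= 1)%E ->
  (\int[mu]_(y in dcube J) (h y * v j y)%:E < +oo)%E.
Proof.
move=> nh h1; have N0 := dnorm_gt0 (Some j) J.
have nk := nnmfunM_scaled nh (nu (Some j)) (ltW N0).
have -> : (\int[mu]_(y in dcube J) (h y * v j y)%:E =
    (N (Some j) J)%:E * \int[mu]_(y in dcube J) (h y * (v j y / N (Some j) J))%:E)%E.
  rewrite -(nnintZ _ (measurable_dcube J) (ltW N0) nk).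
  by apply: eq_integral => y _ /=; congr (_%:E); field; rewrite gt_eqF.
apply: (@le_lt_trans _ _ ((N (Some j) J)%:E * 2%:E)%E); last by rewrite -EFinM ltry.
by apply: lee_wpmul2l; [rewrite lee_fin ltW|exact: dcube_average_le].
Qed.

Definition ball_maximal (f : 'I_m -> T -> R) (x : T) : \bar R :=
  ereal_sup [set ((mu (eball x r) `^ g)^-1 * \prod_j \int[mu]_(y in eball x r) (f j y)%:E)%E
            | r in [set r : R | 0 < r]].

(** The cells of each of the 2^n grids are enumerated by [unpickle]; those among the first k indices
    form a finite laminar family, to which [dyadic_bound] applies uniformly in k. Adding the grids
    and letting k grow dominates the maximal function over balls. *)
Lemma maximal_bound : exists2 K : R, 0 < K & forall h : 'I_m -> T -> R,
  (forall j, nnmfun (h j)) -> (forall j, \int[mu]_y (h j y `^ p j y)%:E <= 1)%E ->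
  (\int[mu]_x ((ball_maximal (fun j y => h j y * v j y)%R x * (om x / K)%:E) `^ q x) <= 1)%E.
Proof.
have [C hC] := dyadic_bound.
pose TT := {ffun 'I_n -> bool}.
(* The loss in volume: the side of the cell is at most 12 r = 6 (n+1) (2r/(n+1)), and (2r/(n+1))^n
   bounds the volume of the ball from below. *)
pose cc : R := ((6 * n.+1%:R) ^+ n) `^ g.
have cc0 : 0 < cc by rewrite powR_gt0// exprn_gt0// mulr_gt0.
pose C1 := Num.max 1 (#|TT|%:R * C).
have C11 : 1 <= C1 by rewrite le_max lexx.
have C10 : 0 < C1 by apply: lt_le_trans C11.
(* Since C1 >= 1 and q >= em, dividing by D multiplies the modular by at most 1/C1. *)
pose D := C1 `^ em^-1; have D0 : 0 < D by exact: powR_gt0.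
exists (cc * D) => [|h nh h1]; first by rewrite mulr_gt0.
have q_bnd y : em <= q y <= ep by exact: (e_bnd None).
have q0 y : 0 < q y by have /andP[h' _] := q_bnd y; exact: lt_le_trans h'.
have om0 y : 0 < om y by exact: (u_gt0 None).
pose qq J j := fine (\int[mu]_(y in dcube J) (h j y * v j y)%:E).
have nhv j : nnmfun (fun y => h j y * v j y) := nnmfunM (nh j) (nu (Some j)).
have hv0 E j : (0 <= \int[mu]_(y in E) (h j y * v j y)%:E)%E.
  by apply: nnint_ge0 => y; exact: nnmfun_ge0 (nhv j).
have qqE J j : (\int[mu]_(y in dcube J) (h j y * v j y)%:E = (qq J j)%:E)%E.
  by rewrite /qq fineK// ge0_fin_numE//; exact: dcube_integral_fin.
have qq0 J j : 0 <= qq J j by rewrite -lee_fin -qqE.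
pose avg J := (dside J ^+ n) `^ (- g) * \prod_j qq J j.
have avg0 J : 0 <= avg J by rewrite mulr_ge0 ?powR_ge0 ?prodr_ge0.
pose F (t : TT) i (x : T) := oapp (fun J => avg (cell t J) * \1_(dcube (cell t J)) x) 0 (unpickle i).
have nF t i : nnmfun (F t i).
  rewrite /F; case: (unpickle i) => [J|] /=; last exact: nnmfun_cst.
  have nI : nnmfun (\1_(dcube (cell t J)) : T -> R).
    by apply: nnmfun_indic; exact: measurable_dcube.
  exact: (nnmfunZ (avg0 (cell t J)) nI).
pose M t k x := running_max (fun i => F t i x) k.
have nM t k : nnmfun (M t k) := nnmfun_running_max k (nF t).
have nMo t k : nnmfun (fun x => (M t k x * om x) `^ q x) :=
  nnmfun_powR (nnmfunM (nM t k) (nu None)) mq.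
have MC t k : (\int[mu]_x ((M t k x * om x) `^ q x)%:E <= C%:E)%E.
  pose s : seq (int * {ffun 'I_n -> int}) := pmap unpickle (iota 0 k).
  have := hC h nh h1 _ (fun i : seq_sub s => cell t (ssval i)) (laminar_cell (s := s)).
  move=> /(_ (M t k)); apply.
    by move=> x; exact: nnmfun_ge0 (nM t k).
  move=> x Mx; have [i ik e] := running_max_attained Mx.
  move: e Mx; rewrite -/(M t k x) => ->; rewrite /F.
  case ui : (unpickle i) => [J|]/=; last by rewrite ltxx.
  rewrite indicE; case: (boolP (x \in _)) => [/set_mem Qx _|_]; last by rewrite mulr0 ltxx.
  have Js : J \in s by rewrite mem_pmap; apply/mapP; exists i; rewrite ?mem_iota.
  exists (SeqSub Js) => //=; rewrite mulr1.
  have -> : (\prod_j \int[mu]_(y in dcube (cell t J)) (h j y * v j y)%:E =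
      \prod_j (qq (cell t J) j)%:E)%E by apply: eq_bigr => j _; exact: qqE.
  by rewrite prodEFin -EFinM.
have C1i0 : 0 <= C1^-1 by rewrite invr_ge0 ltW.
have G_bound k := nnint_sum_bound C1i0 (fun t => nMo t k) (fun t => MC t k).
have F0 x : (0 <= ball_maximal (fun j y => h j y * v j y)%R x)%E.
  apply: (@le_trans _ _ ((mu (eball x 1) `^ g)^-1 *
     \prod_j \int[mu]_(y in eball x 1) (h j y * v j y)%:E)%E).
    by rewrite mule_ge0 ?inve_ge0 ?poweR_ge0// prode_ge0.
  by apply: ereal_sup_ubound; exists 1; [exact: ltr01|].
apply: (nnint_sup_le (fun k => (G_bound k).1)).
- move=> x k l kl; rewrite ler_wpM2l//; apply: ler_sum => t _.
  apply: ge0_ler_powR; rewrite ?nnegrE ?(ltW (q0 x)) ?mulr_ge0 ?(ltW (om0 x)) ?(nnmfun_ge0 x (nM _ _))//.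
  by rewrite ler_pM2r//; exact: running_max_mono.
- by move=> x; exact: poweR_ge0.
- move=> x; have sum0 k : 0 <= \sum_t (M t k x * om x) `^ q x.
    by apply: sumr_ge0 => t _; exact: powR_ge0.
  apply: poweR_le_approx => //; first by rewrite divr_gt0// mulr_gt0.
    apply: (@le_trans _ _ (C1^-1 * \sum_t (M t 0%N x * om x) `^ q x)%:E).
      by rewrite lee_fin mulr_ge0.
    by apply: ereal_sup_ubound; exists 0%N.
  move=> s s0 /ereal_sup_gt[_ [r r0 <-] sr].
  have [t [J [sub side]]] := eball_sub_cell x r0.
  set Q := cell t J in sub side.
  have d0 := dside_gt0 Q; have b0 := fine_eball_gt0 x r0.
  have s_avg : s <= cc * avg Q.
    pose bb j := fine (\int[mu]_(y in eball x r) (h j y * v j y)%:E).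
    have bq j : (\int[mu]_(y in eball x r) (h j y * v j y)%:E <= (qq Q j)%:E)%E.
      rewrite -qqE; have := nnint_subset mu (measurable_eball x r) (measurable_dcube Q) (nhv j) sub.
      by apply.
    have bbE j : (\int[mu]_(y in eball x r) (h j y * v j y)%:E = (bb j)%:E)%E.
      by rewrite /bb fineK// ge0_fin_numE// (le_lt_trans (bq j)) ?ltry.
    have bb0 j : 0 <= bb j by rewrite -lee_fin -bbE.
    have bbq j : bb j <= qq Q j by rewrite -lee_fin -bbE.
    move: sr; have -> : (\prod_j \int[mu]_(y in eball x r) (h j y * v j y)%:E =
      \prod_j (bb j)%:E)%E by apply: eq_bigr => j _; exact: bbE.
    rewrite -(fineK (lebesgueRn_eball_fin x r0)) poweR_EFin inver gt_eqF ?powR_gt0//.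
    rewrite prodEFin -EFinM lte_fin => /ltW/le_trans; apply.
    rewrite /avg mulrA; apply: ler_pM; rewrite ?invr_ge0 ?powR_ge0 ?prodr_ge0//; last first.
      by apply: ler_prod => j _; rewrite bb0 bbq.
    rewrite powRN ler_pdivlMr ?powR_gt0 ?exprn_gt0// mulrC ler_pdivrMr ?powR_gt0//.
    rewrite /cc -(powRM _ _ (ltW b0)) ?exprn_ge0 ?mulr_ge0//.
    apply: ge0_ler_powR; rewrite ?nnegrE ?mulr_ge0 ?exprn_ge0 ?mulr_ge0 ?(ltW g0) ?(ltW d0) ?(ltW b0)//.
    have := fine_eball_ge x r0; move/(ler_wpM2l (exprn_ge0 n (_ : 0 <= 6 * n.+1%:R :> R))).
    rewrite -exprMn; move=> h2; apply: le_trans (h2 _); last by rewrite mulr_ge0.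
    rewrite ler_pXn2r ?nnegrE ?(ltW d0) ?mulr_ge0 ?divr_ge0 ?(ltW r0)//.
    apply: le_trans side _; rewrite le_eqVlt; apply/orP; left; apply/eqP; field.
    by rewrite nat1r pnatr_eq0.
  pose k := (pickle J).+1.
  have avgM : avg Q <= M t k x.
    have Qx : dcube Q x.
      by apply: sub; rewrite /eball/= subrr /enorm big1 ?sqrtr0// => i _; rewrite mxE expr0n.
    have I1 : \1_(dcube Q) x = 1 :> R by rewrite indicE (mem_set Qx).
    have <- : F t (pickle J) x = avg Q by rewrite /F pickleK /= -/Q I1 mulr1.
    exact: (running_max_ge (fun i => F t i x) (ltnSn (pickle J))).
  apply: (@le_trans _ _ (C1^-1 * \sum_t (M t k x * om x) `^ q x)%:E); last first.
    by apply: ereal_sup_ubound; exists k.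
  rewrite lee_fin.
  have M0 : 0 <= M t k x * om x by rewrite mulr_ge0 ?(ltW (om0 x))// (nnmfun_ge0 x (nM t k)).
  apply: (@le_trans _ _ (C1^-1 * (M t k x * om x) `^ q x)); last first.
    rewrite ler_wpM2l// (bigD1 t)//= lerDl.
    by apply: sumr_ge0 => t' _; exact: powR_ge0.
  have sM : s * (om x / (cc * D)) <= D^-1 * (M t k x * om x).
    have -> : s * (om x / (cc * D)) = D^-1 * (s / cc * om x) by field; rewrite !gt_eqF.
    rewrite ler_wpM2l ?invr_ge0 ?(ltW D0)// ler_pM2r//.
    by rewrite ler_pdivrMr// (le_trans s_avg)// mulrC ler_pM2r.
  have Di0 : 0 <= D^-1 by rewrite invr_ge0 ltW.
  apply: (@le_trans _ _ ((D^-1 * (M t k x * om x)) `^ q x)).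
    apply: ge0_ler_powR => //; rewrite ?nnegrE ?(ltW (q0 x))//; last exact: mulr_ge0.
    by rewrite mulr_ge0// divr_ge0 ?(ltW (om0 x))// mulr_ge0 ?ltW.
  rewrite (powRM _ Di0 M0); apply: ler_wpM2r; first exact: powR_ge0.
  have -> : C1^-1 = C1 `^ (-1) by rewrite powR_inv1// ltW.
  rewrite powR_invl /D -powRrM; apply: ler_powR => //.
  rewrite mulrN lerN2 mulrC ler_pdivlMr ?mul1r//.
  by case/andP: (q_bnd x).
- move=> k; apply: le_trans (G_bound k).2 _; rewrite lee_fin.
  by rewrite mulrC ler_pdivrMr// mul1r le_max lexx orbT.
Qed.
End dyadic.

(** * Weights and duality *)

Section weights.
Context d (T : measurableType d) (R : realType) (mu : {measure set T -> \bar R}).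

Lemma real_weight (w : T -> \bar R) : measurable_fun setT w -> (forall x, 0 <= w x)%E ->
  {ae mu, forall x, 0 < w x < +oo}%E ->
  exists V : T -> R, [/\ nnmfun V, forall x, 0 < V x &
    {ae mu, forall x, w x = ((V x)^-1)%:E}].
Proof.
move=> mw w0 w_ae.
pose W x := fine (w x); have W0 x : 0 <= W x by exact: fine_ge0.
have mW : measurable_fun setT W by apply: measurableT_comp => //; exact: measurable_fine.
(* [fine] sends +oo to 0, so Z contains the points where the weight is 0 or infinite; there the
   value is changed to 1. *)
pose Z := W @^-1` [set 0].
have mZ : measurable Z by rewrite -[X in measurable X]setTI; exact: mW.
pose U x := W x + \1_Z x.
have nU : nnmfun U by apply: nnmfunD; [split|exact: nnmfun_indic].
have U0 x : 0 < U x.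
  rewrite /U indicE; case: (boolP (x \in Z)) => [|/negP]; first by rewrite ltr_wpDl.
  by rewrite addr0 lt_neqAle W0 andbT => h; apply/eqP => e; apply: h; rewrite inE /Z/=.
exists (fun x => U x `^ (-1)); split; first exact: nnmfun_powR.
  by move=> x; exact: powR_gt0.
apply: filterS w_ae => x /andP[wx wy].
have wf : w x \is a fin_num by rewrite ge0_fin_numE.
rewrite powR_inv1 ?invrK ?(ltW (U0 x))// /U indicE memNset ?addr0 ?fineK//.
by rewrite /Z/= /W => e; move: wx; rewrite -(fineK wf) e ltxx.
Qed.

Lemma modular_indic (p u : T -> R) (E : set T) (l : R) (f : T -> \bar R) :
  (forall x, 0 < p x) -> nnmfun u -> 0 < l ->
  {ae mu, forall x, `|f x|%E = (u x * \1_E x)%:E} ->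
  (\int[mu]_x ((`|f x| * (l^-1)%:E) `^ p x) = \int[mu]_(x in E) ((u x / l) `^ p x)%:E)%E.
Proof.
move=> p0 nu l0 fE; rewrite nnint_mkcond; apply: ae_eq_integral_ge0 => [x|x|].
- exact: poweR_ge0.
- by rewrite lee_fin mulr_ge0// powR_ge0.
apply: filterS fE => x ->; rewrite -EFinM poweR_EFin; congr (_%:E).
rewrite indicE; case: (x \in E); rewrite ?mulr1//.
by rewrite mulr0 mul0r powR0 ?gt_eqF// mulr0.
Qed.

Variables (p V : T -> R) (ep : R) (B : set T).
Hypotheses (mp : measurable_fun setT p) (p1 : forall y, 1 < p y) (nV : nnmfun V).
Hypotheses (V_gt0 : forall y, 0 < V y) (pc_le : forall y, p y / (p y - 1) <= ep).
Hypotheses (mB : measurable B) (B_fin : (mu B < +oo)%E).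
Let e y := p y / (p y - 1).

(* The extremal function of the duality between the exponents [p] and [p']. *)
Lemma dual_witness lam : 0 < lam ->
  (1 < \int[mu]_(y in B) ((V y / lam) `^ (p y / (p y - 1)))%:E)%E ->
  exists F : T -> R, [/\ nnmfun F,
    (\int[mu]_y ((F y / V y) `^ p y)%:E <= 1)%E &
    (lam%:E <= \int[mu]_(y in B) (F y)%:E)%E].
Proof.
move=> lam0 big.
have e1 y : 1 < e y by exact: gt1_conj.
have e0 y : 0 < e y by apply: lt_trans (e1 y).
have me : measurable_fun setT e by exact: measurable_conj.
have nI : nnmfun (\1_B : T -> R) by exact: nnmfun_indic.
(* V^(p') may fail to be integrable on [B]. Truncation makes the modular finite, and by monotone
   convergence it still exceeds one for some k. *)
pose g k y := Num.min (V y) k%:R.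
have ng k : nnmfun (g k).
  split => [|y]; last by rewrite /g le_min (nnmfun_ge0 y nV) ler0n.
  by apply: measurable_minr => //; case: nV.
have li0 : 0 <= lam^-1 by rewrite invr_ge0 ltW.
have nge k : nnmfun (fun y => (g k y / lam) `^ e y).
  by apply: nnmfun_powR => //; apply: nnmfunM => //; exact: nnmfun_cst.
have ngB k : nnmfun (fun y => (g k y / lam) `^ e y * \1_B y) by exact: nnmfunM.
have [k Ik] : exists k, (1 < \int[mu]_(y in B) ((g k y / lam) `^ e y)%:E)%E.
  apply: contrapT => /forallNP no; move: big; rewrite nnint_mkcond ltNge => /negP; apply.
  apply: (nnint_sup_le ngB).
  - move=> x k l kl; rewrite ler_wpM2r//.
    apply: ge0_ler_powR; rewrite ?nnegrE ?(ltW (e0 x)) ?divr_ge0 ?(nnmfun_ge0 x (ng _)) ?(ltW lam0)//.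
    by rewrite ler_pM2r ?invr_gt0// /g le_min ge_min lexx/= ge_min ler_nat kl orbT.
  - by move=> x; rewrite lee_fin mulr_ge0 ?powR_ge0.
  - move=> x; pose k := Num.truncn (V x); apply: (@le_trans _ _ ((g k.+1 x / lam) `^ e x * \1_B x)%:E); last first.
      by apply: ereal_sup_ubound; exists k.+1.
    rewrite /g (_ : Num.min _ _ = V x)//; apply/min_idPl.
    by rewrite ltW// truncnS_gt.
  - by move=> k; rewrite -nnint_mkcond leNgt; apply/negP => h; exact: (no k h).
set I := (\int[mu]_(y in B) _)%E in Ik.
have Ifin : (I < +oo)%E.
  apply: (@le_lt_trans _ _ (\int[mu]_(y in B) ((1 + k%:R / lam) `^ ep)%:E)%E).
    apply: nnint_le => [y|y _]; first exact: powR_ge0.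
    have kl0 : 0 <= k%:R / lam by rewrite divr_ge0// ltW.
    apply: (@le_trans _ _ ((1 + k%:R / lam) `^ e y)); last by apply: ler_powR (pc_le y); rewrite lerDl.
    apply: ge0_ler_powR; rewrite ?nnegrE ?(ltW (e0 y)) ?divr_ge0 ?(nnmfun_ge0 y (ng _)) ?(ltW lam0) ?addr_ge0//.
    apply: (@le_trans _ _ (k%:R / lam)); last by rewrite lerDr.
    by rewrite ler_pM2r ?invr_gt0// /g ge_min lexx orbT.
  rewrite integral_cst// lte_mul_pinfty// ?lee_fin ?powR_ge0//.
have I0 : (0 <= I)%E by apply: nnint_ge0 => y; exact: powR_ge0.
have IE : I = (fine I)%:E by rewrite fineK// ge0_fin_numE.
set i := fine I in IE; have i1 : 1 < i by rewrite -lte_fin -IE.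
have i0 : 0 < i by apply: lt_trans i1.
have ii0 : 0 <= i^-1 by rewrite invr_ge0 ltW.
have glam y : 0 <= g k y / lam by rewrite divr_ge0 ?(nnmfun_ge0 y (ng _))// ltW.
(* As (p' - 1) p = p', the modular of F/V reduces to that of [g k], and dividing by i > 1 normalizes
   it because i^(-p) <= i^(-1). The factor V in place of [g k] only enlarges the integral of F. *)
pose F y := (g k y / lam) `^ (e y - 1) * \1_B y * (V y * i^-1).
have nF : nnmfun F.
  apply: nnmfunM; first apply: nnmfunM => //.
    apply: nnmfun_powR; last exact: measurable_funB.
    by apply: nnmfunM => //; exact: nnmfun_cst.
  by apply: nnmfunM => //; exact: nnmfun_cst.
exists F; split => //.
- apply: (@le_trans _ _ (\int[mu]_y (i^-1 * ((g k y / lam) `^ e y * \1_B y))%:E)%E).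
    apply: nnint_le => [y|y _]; first exact: powR_ge0.
    have -> : F y / V y = i^-1 * ((g k y / lam) `^ (e y - 1) * \1_B y).
      by rewrite /F; field; rewrite !gt_eqF.
    have p0 : 0 < p y by apply: lt_trans (p1 y).
    rewrite (powRM _ ii0) ?mulr_ge0 ?powR_ge0//; apply: ler_pM; rewrite ?powR_ge0//.
      apply: le_trans (_ : i^-1 `^ 1 <= _); last by rewrite powRr1.
      by apply: ger_powR (ltW (p1 y)); rewrite invr_gt0 i0 invf_le1// ltW.
    rewrite indicE; case: (y \in B); last by rewrite !mulr0 powR0 ?gt_eqF.
    rewrite !mulr1 -powRrM (_ : (e y - 1) * p y = e y)//.
    by rewrite /e; field; rewrite subr_eq0 gt_eqF.
  by rewrite nnintZ// -nnint_mkcond -/I IE -EFinM mulVf ?gt_eqF.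
- apply: (@le_trans _ _ (\int[mu]_(y in B) (lam * i^-1 * (g k y / lam) `^ e y)%:E)%E).
    rewrite nnintZ ?mulr_ge0 ?(ltW lam0)// -/I IE -EFinM -mulrA mulVf ?gt_eqF//.
    by rewrite mulr1.
  apply: nnint_le => [y|y By]; first by rewrite !mulr_ge0 ?powR_ge0// ltW.
  rewrite /F indicE mem_set// mulr1.
  have -> : (g k y / lam) `^ e y = (g k y / lam) `^ (e y - 1) * (g k y / lam).
    by rewrite [RHS]mulrC mulr_powRB1.
  have -> : lam * i^-1 * ((g k y / lam) `^ (e y - 1) * (g k y / lam)) =
     (g k y / lam) `^ (e y - 1) * (g k y * i^-1) by field; rewrite !gt_eqF.
  rewrite ler_wpM2l ?powR_ge0// ler_wpM2r//.
  by rewrite /g ge_min lexx.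
Qed.

End weights.

(** * Bounds for the exponents, valid everywhere *)

Section exponent_bounds.
Context {R : realType} {n m : nat}.
Local Notation T := (Rn R n).
Local Notation mu := (lebesgueRn R n).
Hypotheses (n_gt0 : (0 < n)%N) (m_gt0 : (0 < m)%N).
Variables (p : 'I_m -> T -> R) (q : T -> R) (alpha : R).
Hypothesis p_exp : forall i, log_holder (p i) /\ exponentP (p i).
Hypothesis q_exp : exponentP0 q.
Hypothesis pq : forall x, alpha / n%:R = (harmonic_exponent p x)^-1 - (q x)^-1.
Hypothesis alpha_range : 0 <= alpha / n%:R < m%:R.

Lemma ae_fin_le (f : T -> R) : (ess_sup mu (EFin \o f) < +oo)%E ->
  exists c : R, {ae mu, forall x, f x <= c}.
Proof.
move=> h; have := ess_sup_ge mu (EFin \o f); move: h; case: (ess_sup _ _) => [c| |]// _ ae_c.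
  by exists c; apply: filterS ae_c => x; rewrite lee_fin.
by exists 0; apply: filterS ae_c.
Qed.

Lemma ae_gt_le (f : T -> R) (a : R) : (a%:E < ess_inf mu (EFin \o f))%E ->
  exists2 c : R, a < c & {ae mu, forall x, c <= f x}.
Proof.
move=> h; have := ess_inf_le mu (EFin \o f); move: h; case: (ess_inf _ _) => [c| |]//.
  by rewrite lte_fin => ac ae_c; exists c => //; apply: filterS ae_c => x; rewrite lee_fin.
by move=> _ ae_c; exists (a + 1); rewrite ?ltrDl//; apply: filterS ae_c.
Qed.

Lemma exponent_lower : exists2 pm : R, 1 < pm & forall i y, pm <= p i y.
Proof.
have /choice[c hc] : forall i, exists c : R, 1 < c /\ forall y, c <= p i y.
  move=> i; have [[C [pinf [C0 _ hloc _]]] [_ pinf1 _]] := p_exp i.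
  have [c c1 cp] := ae_gt_le pinf1; exists c; split => //.
  exact: ae_ge_everywhere (ltW C0) hloc cp.
have [i _ imin] := @Order.TotalTheory.arg_minP _ _ _ (Ordinal m_gt0) predT c erefl.
exists (c i) => [|j y]; first by have [] := hc i.
by apply: le_trans (imin j erefl) _; have [_] := hc j.
Qed.

Lemma sum_inv_pq x : (q x)^-1 = \sum_i (p i x)^-1 - alpha / n%:R.
Proof. by rewrite (pq x) /harmonic_exponent invrK opprB addrC subrK. Qed.

Let q0 x : 0 < q x. Proof. by case: q_exp => [[_ +] _ _]; apply. Qed.

Lemma exponent_upper_q : exists c : R, forall y, q y <= c.
Proof.
have [pm pm1 p_ge] := exponent_lower.
have [_ _ /ae_fin_le[c hc]] := q_exp.
have /choice[C hC] : forall i, exists C : R, 0 <= C /\ forall x y : 'rV[R]_n, enorm (x - y) < 2^-1 ->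
    `|(p i x)^-1 - (p i y)^-1| <= C / (- ln (enorm (x - y))).
  move=> i; have [[C [_ [C0 _ hloc _]]] _] := p_exp i; exists C; split; first exact: ltW.
  move=> x y /hloc; apply: le_trans.
  have p1 z : 1 <= p i z by rewrite (le_trans (ltW pm1)).
  have p0 z : 0 < p i z by rewrite (lt_le_trans _ (p1 z)).
  have -> : (p i x)^-1 - (p i y)^-1 = (p i y - p i x) / (p i x * p i y).
    by field; rewrite !gt_eqF.
  rewrite normrM distrC ler_piMr// normfV ger0_norm ?mulr_ge0 ?(ltW (p0 _))//.
  by rewrite invf_le1 ?mulr_gt0// mulr_ege1.
have c'0 : 0 < Num.max c 1 by rewrite lt_max ltr01 orbT.
exists (Num.max c 1) => y; rewrite -[q y]invrK -[leRHS]invrK lef_pV2 ?posrE ?invr_gt0//.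
move: y; apply: (@ae_ge_everywhere _ _ (fun y => (q y)^-1) (\sum_i C i)).
- by apply: sumr_ge0 => i _; case: (hC i).
- move=> x y xy; rewrite !sum_inv_pq opprB subrKA -sumrB.
  apply: le_trans (ler_norm_sum _ _ _) _; rewrite mulr_suml; apply: ler_sum => i _.
  by case: (hC i) => _; exact.
- apply: filterS hc => x qc; rewrite lef_pV2 ?posrE//.
  by rewrite le_max qc.
Qed.

Lemma apq_exponent_bounds : exists em ep : R, 0 < em /\
  forall k y, em <= apq_exponent p q k y <= ep.
Proof.
have [pm pm1 p_ge] := exponent_lower; have [c qc] := exponent_upper_q.
have m0 : 0 < m%:R :> R by rewrite ltr0n.
have m1 : m%:R^-1 <= 1 :> R by rewrite invf_le1// ler1n.
exists m%:R^-1, (Num.max c (pm / (pm - 1))); split; first by rewrite invr_gt0.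
move=> [j|] y /=.
  have p1 := lt_le_trans pm1 (p_ge j y).
  by rewrite (le_trans m1) ?(ltW (gt1_conj p1))//= le_max (conj_le pm1) ?orbT.
rewrite le_max qc andbT -[leRHS]invrK lef_pV2 ?posrE ?invr_gt0//.
rewrite sum_inv_pq lerBlDr; apply: (@le_trans _ _ m%:R).
  rewrite -[m in m%:R](card_ord m) -sumr_const; apply: ler_sum => i _.
  have p1 : 1 <= p i y by rewrite (le_trans (ltW pm1)).
  by rewrite invf_le1// (lt_le_trans ltr01).
by rewrite lerDl; case/andP: alpha_range.
Qed.

Lemma sum_apq_exponent y : \sum_k (apq_exponent p q k y)^-1 = m%:R - alpha / n%:R.
Proof.
have [pm pm1 p_ge] := exponent_lower.
rewrite big_option/= sum_inv_pq addrAC -big_split/=; congr (_ - _).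
rewrite -[m in m%:R](card_ord m) -sumr_const; apply: eq_bigr => i _.
by rewrite conj_inv// (lt_le_trans pm1).
Qed.

End exponent_bounds.

Lemma varnorm_lnorm (R : realType) (n : nat) (p u : Rn R n -> R) (E : set (Rn R n))
    (f : Rn R n -> \bar R) : (forall x, 0 < p x) -> nnmfun u ->
  {ae lebesgueRn R n, forall x, `|f x|%E = (u x * \1_E x)%:E} ->
  varnorm p f = lnorm (lebesgueRn R n) p u E.
Proof.
move=> p0 nu fE; congr (ereal_inf (image _ _)); apply/seteqP.
by split => l [l0 hl]; split => //; move: hl; rewrite (modular_indic p0 nu l0 fE).
Qed.

Section prod_fin.
Context {R : realType} (K : finType).
Local Open Scope ereal_scope.

(** Positivity of all factors matters: in the extended reals 0 times +oo is 0, and a vanishing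
    factor would hide an infinite one. *)
Lemma prode_pos_fin (L : K -> \bar R) (A : R) : (forall k, 0 < L k) ->
  \prod_k L k <= A%:E -> (forall k, L k < +oo) /\ (\prod_k fine (L k) <= A)%R.
Proof.
move=> L0 LA; have fin k : L k < +oo.
  rewrite ltey; apply/eqP => Lk; move: LA; rewrite (bigD1 k)//= Lk gt0_mulye//.
  by elim/big_ind: _ => // x y; exact: mule_gt0.
split => //; rewrite -lee_fin -prodEFin; apply: le_trans LA.
by rewrite le_eqVlt; apply/orP; left; apply/eqP; apply: eq_bigr => k _; rewrite fineK// gt0_fin_numE.
Qed.

End prod_fin.

(** * Necessity and sufficiency *)

Section representatives.
Context d (T : measurableType d) (R : realType) (mu : {measure set T -> \bar R}).

Lemma integral_ae_eq_on (D : set T) (f g : T -> \bar R) :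
  (forall x, 0 <= f x)%E -> (forall x, 0 <= g x)%E ->
  {ae mu, forall x, f x = g x} -> (\int[mu]_(x in D) f x = \int[mu]_(x in D) g x)%E.
Proof.
move=> f0 g0 fg; rewrite integral_mkcond [RHS]integral_mkcond.
apply: ae_eq_integral_ge0 => [x|x|]; rewrite /patch.
- by case: ifP.
- by case: ifP.
by apply: filterS fg => x ->.
Qed.

Variables (p V : T -> R) (w f : T -> \bar R) (lam : R).
Hypothesis p0 : forall x, 0 < p x.
Hypotheses (nV : nnmfun V) (V_gt0 : forall x, 0 < V x) (lam0 : 0 < lam).
Hypothesis w_ae : {ae mu, forall x, w x = ((V x)^-1)%:E}.
Hypothesis mf : measurable_fun setT f.
Hypothesis mod1 : (\int[mu]_x ((`|w x * f x| * (lam^-1)%:E) `^ p x) <= 1)%E.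

Lemma ae_fin_of_modular : {ae mu, forall x, `|f x|%E \is a fin_num}.
Proof.
pose P := (abse \o f) @^-1` [set +oo%E].
have mP : measurable P.
  rewrite -[X in measurable X]setTI; apply: (measurableT_comp (@abse_measurable _ _) mf) => //.
exists P; split => //; last first.
  by move=> x /= h; apply: contrapT => Px; apply: h; rewrite ge0_fin_numE// ltey; apply/eqP.
have h1 : (\int[mu]_(x in P) (+oo : \bar R) <= 1)%E.
  apply: le_trans mod1; rewrite integral_mkcond; apply: ae_le_integral => [x|x|].
  - by rewrite /patch; case: ifP.
  - exact: poweR_ge0.
  apply: filterS w_ae => x wx; rewrite /patch; case: ifPn => [/set_mem Px|_]; last exact: poweR_ge0.
  have li : (0 < (lam^-1)%:E :> \bar R)%E by rewrite lte_fin invr_gt0.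
  have vi : (0 < ((V x)^-1)%:E :> \bar R)%E by rewrite lte_fin invr_gt0.
  rewrite abseM (Px : `|f x|%E = +oo%E) wx gee0_abs ?(ltW vi)// gt0_muley// gt0_mulye// poweRyr//.
  by rewrite gt_eqF.
apply/eqP; rewrite -measure_le0 leNgt; apply/negP => muP.
by move: h1; rewrite integral_cst// gt0_mulye.
Qed.

Lemma real_function : exists h : T -> R, [/\ nnmfun h,
  (\int[mu]_x (h x `^ p x)%:E <= 1)%E &
  {ae mu, forall x, `|f x|%E = (lam * (h x * V x))%:E}].
Proof.
have li0 : 0 <= lam^-1 by rewrite invr_ge0 ltW.
pose F x := fine `|f x|%E.
have nF : nnmfun F.
  split => [|x]; last by rewrite fine_ge0.
  have maf : measurable_fun setT (fun x => `|f x|%E) := measurableT_comp (@abse_measurable _ _) mf.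
  by apply: measurableT_comp.
have nVi : nnmfun (fun x => V x `^ (-1)) by exact: nnmfun_powR.
exists (fun x => lam^-1 * (F x * V x `^ (-1))).
have nh : nnmfun (fun x => lam^-1 * (F x * V x `^ (-1))).
  by apply: nnmfunZ => //; exact: nnmfunM.
have fF : {ae mu, forall x, `|f x|%E = (F x)%:E}.
  by apply: filterS ae_fin_of_modular => x fx; rewrite /F fineK.
split => //.
- apply: le_trans mod1; apply: ae_le_integral => [x|x|].
  + by rewrite lee_fin powR_ge0.
  + exact: poweR_ge0.
  apply: filterS2 fF w_ae => x fx wx.
  rewrite abseM wx fx gee0_abs ?lee_fin ?invr_ge0 ?(ltW (V_gt0 x))//.
  rewrite powR_inv1 ?(ltW (V_gt0 x))//.
  by rewrite le_eqVlt; apply/orP; left; apply/eqP; congr (_ `^ _); ring.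
- apply: filterS fF => x ->; congr (_%:E).
  by rewrite powR_inv1 ?(ltW (V_gt0 x))//; field; rewrite !gt_eqF.
Qed.

End representatives.

Lemma le_poweR (R : realType) (a : R) (x y : \bar R) : 0 <= a ->
  (0 <= x)%E -> (x <= y)%E -> (x `^ a <= y `^ a)%E.
Proof.
move=> a0 x0 xy; apply: gt0_ler_poweR => //; rewrite in_itv/= leey andbT//.
exact: le_trans xy.
Qed.

Lemma lee_prod_nonneg (R : realType) (I : finType) (a b : I -> \bar R) :
  (forall i, 0 <= a i)%E -> (forall i, a i <= b i)%E -> (\prod_i a i <= \prod_i b i)%E.
Proof.
move=> a0 ab.
have : (0 <= \prod_i a i)%E /\ (\prod_i a i <= \prod_i b i)%E.
  elim/big_ind2: _ => // s t u v [s0 st] [u0 uv].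
  by rewrite mule_ge0// lee_pmul.
by case.
Qed.

Lemma nnmfun_inv_prod d (T : measurableType d) (R : realType) (I : finType) (V : I -> T -> R) :
  (forall i, nnmfun (V i)) -> (forall i x, 0 < V i x) ->
  nnmfun (fun x => (\prod_i V i x)^-1).
Proof.
move=> nV V0; rewrite (_ : (fun _ => _) = fun x => (\prod_i V i x) `^ (-1)).
  by apply: nnmfun_powR => //; exact: nnmfun_prod.
by apply/funext => x; rewrite powR_inv1// ltW// prodr_gt0.
Qed.

(** * The two implications, with real representatives of the weights *)

Section assembly.
Context {R : realType} {n m : nat}.
Local Notation T := (Rn R n).
Local Notation mu := (lebesgueRn R n).
Hypotheses (n_gt0 : (0 < n)%N) (m_gt0 : (0 < m)%N).
Variables (p : 'I_m -> T -> R) (q : T -> R) (alpha : R) (w : 'I_m -> T -> \bar R).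
Hypothesis p_exp : forall i, log_holder (p i) /\ exponentP (p i).
Hypothesis q_exp : exponentP0 q.
Hypothesis pq : forall x, alpha / n%:R = (harmonic_exponent p x)^-1 - (q x)^-1.
Hypothesis alpha_range : 0 <= alpha / n%:R < m%:R.
Variable V : 'I_m -> T -> R.
Hypotheses (nV : forall j, nnmfun (V j)) (V_gt0 : forall j x, 0 < V j x).
Hypothesis w_ae : forall j, {ae mu, forall x, w j x = ((V j x)^-1)%:E}.

Let om x := (\prod_j V j x)^-1.
Let g := m%:R - alpha / n%:R.
Local Notation e := (apq_exponent p q).
Local Notation u := (apq_weight om V).
Let L k E := lnorm mu (e k) (u k) E.

Let g0 : 0 < g. Proof. by rewrite subr_gt0; case/andP: alpha_range. Qed.
Let gm : g <= m%:R. Proof. by rewrite gerBl; case/andP: alpha_range. Qed.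
Let mp j : measurable_fun setT (p j). Proof. by case: (p_exp j) => _ [[]]. Qed.
Let mq : measurable_fun setT q. Proof. by case: q_exp => [[]]. Qed.

Let nu k : nnmfun (u k).
Proof. by case: k => [j|]; [exact: nV|exact: nnmfun_inv_prod]. Qed.

Let u_gt0 k x : 0 < u k x.
Proof. by case: k => [j|]; [exact: V_gt0|rewrite invr_gt0 prodr_gt0]. Qed.

Let prod_u x : \prod_k u k x = 1.
Proof. by rewrite big_option/= mulVf// gt_eqF// prodr_gt0. Qed.

Let p1 j x : 1 < p j x.
Proof.
by have [pm pm1 p_ge] := exponent_lower m_gt0 p_exp; exact: lt_le_trans (p_ge j x).
Qed.

Let me k : measurable_fun setT (e k).
Proof. by case: k => [j|]; [exact: (measurable_conj (mp j) (p1 j))|exact: mq]. Qed.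

Let e0 k x : 0 < e k x.
Proof.
case: k => [j|]; first exact: lt_trans ltr01 (gt1_conj (p1 j x)).
by case: q_exp => [[_ +] _ _]; apply.
Qed.

Lemma prod_weight_ae : {ae mu, forall x, prod_weight w x = (om x)%:E}.
Proof.
have : \forall x \ae mu, forall j, w j x = ((V j x)^-1)%:E by exact: filter_forall.
apply: filterS => x wx; rewrite /prod_weight (eq_bigr (fun j => ((V j x)^-1)%:E))//.
by rewrite prodEFin prodfV.
Qed.

Lemma apq_lnorm_gt0 k (x : T) r : 0 < r -> (0 < L k (eball x r))%E.
Proof.
move=> r0; have [em [ep [em0 e_bnd]]] := apq_exponent_bounds m_gt0 p_exp q_exp pq alpha_range.
have [fin|] := boolP (L k (eball x r) < +oo)%E; last by rewrite -leNgt leye_eq => /eqP ->.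
rewrite /L in fin *; rewrite (lnormE fin) lte_fin.
apply: (fine_lnorm_gt0 em0 (me k) (nu k) (u_gt0 k) (e_bnd k)) => //; first exact: measurable_eball.
exact: lebesgueRn_eball_gt0.
Qed.

Lemma Apq_termE (x : T) r : (mu (eball x r) `^ (alpha / n%:R - m%:R) *
    varnorm q (fun y => prod_weight w y * (\1_(eball x r) y)%:E) *
    \prod_(j < m) varnorm (conj_exponent (p j)) (fun y => (w j y)^-1 * (\1_(eball x r) y)%:E)
  = mu (eball x r) `^ (- g) * \prod_k L k (eball x r))%E.
Proof.
have -> : varnorm q (fun y => prod_weight w y * (\1_(eball x r) y)%:E)%E = L None (eball x r).
  apply: varnorm_lnorm; [exact: (e0 None)|exact: (nu None)|].
  apply: filterS prod_weight_ae => y ->; rewrite -EFinM gee0_abs// lee_fin mulr_ge0//.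
  exact: ltW (u_gt0 None y).
have hS j : varnorm (conj_exponent (p j)) (fun y => (w j y)^-1 * (\1_(eball x r) y)%:E)%E =
    L (Some j) (eball x r).
  apply: varnorm_lnorm; [exact: (e0 (Some j))|exact: nV|].
  apply: filterS (w_ae j) => y ->; rewrite inver invr_eq0 gt_eqF// invrK -EFinM gee0_abs//.
  by rewrite lee_fin mulr_ge0// ltW.
rewrite (eq_bigr _ (fun j _ => hS j)) big_option muleA.
by have -> : - g = alpha / n%:R - m%:R by rewrite /g opprB.
Qed.

Lemma Apq_ball_bounds : Apq alpha p q w -> exists2 A : R, 0 < A &
  (forall k (x : T) r, 0 < r -> (L k (eball x r) < +oo)%E) /\
  (forall (x : T) r, 0 < r ->
    \prod_k fine (L k (eball x r)) <= A * fine (mu (eball x r)) `^ g).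
Proof.
rewrite /Apq; set AA := Apq_const _ _ _ _ => AAfin.
have term (x : T) r : 0 < r -> (mu (eball x r) `^ (- g) * \prod_k L k (eball x r) <= AA)%E.
  by move=> r0; rewrite -Apq_termE; apply: ereal_sup_ubound; exists (x, r).
have prod_gt0 (x : T) r : 0 < r -> (0 < \prod_k L k (eball x r))%E.
  move=> r0; elim/big_ind: _ => //; first by move=> y z; exact: mule_gt0.
  by move=> k _; exact: apq_lnorm_gt0.
have muE (x : T) r : 0 < r -> (mu (eball x r) `^ (- g) = (fine (mu (eball x r)) `^ (- g))%:E)%E.
  by move=> r0; rewrite -[in LHS](fineK (lebesgueRn_eball_fin x r0)) poweR_EFin.
have mug0 (x : T) r : 0 < r -> 0 < fine (mu (eball x r)) `^ (- g).
  by move=> r0; rewrite powR_gt0// fine_eball_gt0.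
have AA0 : (0 < AA)%E.
  apply: lt_le_trans (term 0 1 ltr01); rewrite muE// mule_gt0 ?lte_fin ?mug0//.
  exact: prod_gt0.
have AAE : AA = (fine AA)%:E by rewrite fineK// gt0_fin_numE.
have A0 : 0 < fine AA by rewrite -lte_fin -AAE.
exists (fine AA) => //.
have bound (x : T) r : 0 < r -> (\prod_k L k (eball x r) <= (fine AA * fine (mu (eball x r)) `^ g)%:E)%E.
  move=> r0; have f0 := fine_eball_gt0 x r0.
  have -> : (\prod_k L k (eball x r) = (fine (mu (eball x r)) `^ g)%:E *
      (mu (eball x r) `^ (- g) * \prod_k L k (eball x r)))%E.
    by rewrite muE// muleA -EFinM powRN divff ?mul1e// gt_eqF// powR_gt0.
  rewrite mulrC EFinM lee_wpmul2l ?lee_fin ?powR_ge0//.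
  by rewrite -AAE; exact: term.
split=> [k x r r0|x r r0].
  exact: (prode_pos_fin (fun k => apq_lnorm_gt0 k x r0) (bound x r r0)).1.
exact: (prode_pos_fin (fun k => apq_lnorm_gt0 k x r0) (bound x r r0)).2.
Qed.

Lemma varnorm_lt_modular (a : T -> R) (f : T -> \bar R) lam : (forall x, 0 < a x) -> 0 < lam ->
  (varnorm a f < lam%:E)%E -> (\int[mu]_x ((`|f x| * (lam^-1)%:E) `^ a x) <= 1)%E.
Proof.
move=> a0 lam0 /ereal_inf_lt[_ [l [l0 hl] <-]]; rewrite lte_fin => ll.
apply: le_trans hl; apply: le_integral_ge0 => x _; first exact: poweR_ge0.
apply: le_poweR; first exact: ltW.
  by rewrite mule_ge0// lee_fin invr_ge0 ltW.
by rewrite lee_wpmul2l// lee_fin lef_pV2 ?posrE// ltW.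
Qed.

(** Stated for numbers [lam j] strictly above the norms, at which the modulars are at most one; this
    leaves room for functions of norm zero. *)
Lemma Apq_bounded_strict : Apq alpha p q w -> exists2 K : R, 0 < K &
  forall f (lam : 'I_m -> R), (forall j, measurable_fun setT (f j)) -> (forall j, 0 < lam j) ->
    (forall j, wnorm (p j) (w j) (f j) < (lam j)%:E)%E ->
    (wnorm q (prod_weight w) (frac_maximal alpha f) <= (K * \prod_j lam j)%:E)%E.
Proof.
move=> /Apq_ball_bounds[A A0 [ball_fin ball_prod]].
have [em [ep [em0 e_bnd]]] := apq_exponent_bounds m_gt0 p_exp q_exp pq alpha_range.
have [pm pm1 p_ge] := exponent_lower m_gt0 p_exp.
have LHp j : log_holder (p j) by case: (p_exp j).
have sum_e := sum_apq_exponent m_gt0 p_exp pq.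
have [K K0 hK] := maximal_bound n_gt0 m_gt0 LHp mp pm1 p_ge mq em0 e_bnd nu u_gt0 g0 gm
  sum_e prod_u ball_fin A0 ball_prod.
exists K => // f lam mf lam0 fl.
have /choice[h hh] : forall j, exists h : T -> R, [/\ nnmfun h,
  (\int[mu]_x (h x `^ p j x)%:E <= 1)%E &
  {ae mu, forall x, `|f j x|%E = (lam j * (h x * V j x))%:E}].
  move=> j; have p0 x : 0 < p j x by apply: lt_trans ltr01 (p1 j x).
  apply: (real_function p0 (nV j) (V_gt0 j) (lam0 j) (w_ae j) (mf j)).
  exact: (varnorm_lt_modular p0 (lam0 j) (fl j)).
have nh j : nnmfun (h j) by case: (hh j).
have h1 j : (\int[mu]_x (h j x `^ p j x)%:E <= 1)%E by case: (hh j).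
have fE j : {ae mu, forall x, `|f j x|%E = (lam j * (h j x * V j x))%:E} by case: (hh j).
pose Lam := \prod_j lam j; have Lam0 : 0 < Lam by exact: prodr_gt0.
pose BM := ball_maximal g (fun j y => h j y * V j y).
have hv0 j y : 0 <= h j y * V j y by rewrite mulr_ge0 ?(nnmfun_ge0 y (nh j))// ltW.
have BMI x r j : (\int[mu]_(y in eball x r) `|f j y| =
    (lam j)%:E * \int[mu]_(y in eball x r) (h j y * V j y)%:E)%E.
  rewrite -(nnintZ _ (measurable_eball x r) (ltW (lam0 j)) (nnmfunM (nh j) (nV j))).
  apply: integral_ae_eq_on (fE j) => // y.
  by rewrite lee_fin; apply: mulr_ge0; [exact: ltW|exact: hv0].
have FM x : (frac_maximal alpha f x <= Lam%:E * BM x)%E.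
  apply: ge_ereal_sup => _ [r r0 <-].
  rewrite (eq_bigr _ (fun j _ => BMI x r j)) big_split/= prodEFin muleCA.
  apply: lee_wpmul2l; first by rewrite lee_fin ltW.
  by apply: ereal_sup_ubound; exists r.
have F0 x : (0 <= frac_maximal alpha f x)%E.
  apply: (@le_trans _ _ ((mu (eball x 1) `^ (m%:R - alpha / n%:R))^-1 *
     \prod_j \int[mu]_(y in eball x 1) `|f j y|)%E).
    rewrite mule_ge0 ?inve_ge0 ?poweR_ge0// prode_ge0// => j _.
    by apply: integral_ge0 => y _; exact: abse_ge0.
  by apply: ereal_sup_ubound; exists 1; [exact: ltr01|].
have KL0 : 0 < K * Lam by rewrite mulr_gt0.
apply: ereal_inf_lbound; exists (K * Lam) => //; split => //.
apply: le_trans (hK h nh h1); apply: ae_le_integral => [x|x|]; try exact: poweR_ge0.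
apply: filterS prod_weight_ae => x ->.
have om0 : 0 < om x by exact: (u_gt0 None x).
have BM0 : (0 <= BM x)%E.
  by have := le_trans (F0 x) (FM x); rewrite pmule_rge0// lte_fin.
have oK0 : 0 <= om x / K by rewrite divr_ge0// ltW.
apply: le_poweR; first exact: ltW (e0 None x).
  by rewrite mule_ge0// lee_fin invr_ge0 ltW.
rewrite abseM gee0_abs ?lee_fin ?(ltW om0)// gee0_abs//.
apply: (@le_trans _ _ ((om x)%:E * (Lam%:E * BM x) * ((K * Lam)^-1)%:E)%E).
  apply: lee_wpmul2r; first by rewrite lee_fin invr_ge0 ltW.
  by apply: lee_wpmul2l (FM x); rewrite lee_fin ltW.
have -> : ((om x)%:E * (Lam%:E * BM x) * ((K * Lam)^-1)%:E =
    (om x * Lam * (K * Lam)^-1)%:E * BM x)%E.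
  by rewrite !EFinM [in LHS]muleA [LHS]muleAC.
have -> : om x * Lam * (K * Lam)^-1 = om x / K by field; rewrite !gt_eqF.
by rewrite muleC.
Qed.

(** If all norms are positive, [lam j] is twice the norm, whence 2^m. If one of them vanishes, the
    left-hand side must be zero: that [lam] is made arbitrarily small while the others stay
    fixed. *)
Lemma Apq_bounded : Apq alpha p q w -> frac_maximal_bounded alpha p q w.
Proof.
move=> /Apq_bounded_strict[K K0 hK]; exists (K * 2 ^+ m) => f fL.
have mf j : measurable_fun setT (f j) by case: (fL j).
pose N j := wnorm (p j) (w j) (f j).
have N0 j : (0 <= N j)%E.
  by apply: le_ereal_inf_tmp => _ [l [l0 _] <-]; rewrite lee_fin ltW.
have NE j : N j = (fine (N j))%:E by rewrite fineK// ge0_fin_numE//; case: (fL j).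
have l0 j : 0 <= fine (N j) by exact: fine_ge0.
have -> : (\prod_j wnorm (p j) (w j) (f j) = (\prod_j fine (N j))%:E)%E.
  by rewrite -prodEFin; apply: eq_bigr => j _; exact: NE.
have [pos|/existsNP[j0 /negP]] := pselect (forall j, 0 < fine (N j)).
  have := hK f (fun j => fine (N j) * 2) mf; rewrite big_split/= prodr_const card_ord.
  rewrite -EFinM -mulrA [2 ^+ m * _]mulrC; apply=> j; first by rewrite mulr_gt0.
  by rewrite -/(N j) [ltLHS]NE lte_fin ltr_pMr// ltr1n.
rewrite -leNgt => Nj0; have {}Nj0 : fine (N j0) = 0 by apply/eqP; rewrite eq_le Nj0 l0.
rewrite (bigD1 j0)//= Nj0 mul0r mule0.
pose P := \prod_(j | j != j0) (fine (N j) + 1).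
have P0 : 0 < P by apply: prodr_gt0 => j _; rewrite ltr_wpDl.
apply/lee_addgt0Pr => eps eps0; rewrite add0e.
pose lam j := if j == j0 then eps / (K * P) else fine (N j) + 1.
have eKP : 0 < eps / (K * P) by rewrite divr_gt0// mulr_gt0.
have := hK f lam mf; have -> : K * \prod_j lam j = eps.
  rewrite (bigD1 j0)//= (eq_bigr (fun j => fine (N j) + 1)); last first.
    by move=> j jj; rewrite /lam (negbTE jj).
  by rewrite -/P /lam eqxx; field; rewrite !gt_eqF.
apply=> j; rewrite /lam; case: (j =P j0) => [jj|_] //.
- by rewrite ltr_wpDl.
- by rewrite jj -/(N j0) NE Nj0 lte_fin.
- by rewrite -/(N j) [ltLHS]NE lte_fin ltrDl.
Qed.

(** Bounds the ratio of the volumes of two balls of radii 2 (n+1) r and r to the power g, the balls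
    being compared with cubes: 4 (n+1) r = 2 (n+1)^2 (2r/(n+1)). *)
Let cst : R := ((2 * n.+1%:R ^+ 2) ^+ n) `^ g.
Let cst0 : 0 < cst.
Proof. by rewrite powR_gt0// exprn_gt0// mulr_gt0// exprn_gt0. Qed.

Lemma frac_maximal_ge (F : 'I_m -> T -> R) (mun : 'I_m -> R) (x y : T) r :
  0 < r -> (forall j, nnmfun (F j)) -> (forall j, 0 < mun j) ->
  (forall j, (mun j)%:E <= \int[mu]_(z in eball x r) (F j z)%:E)%E -> eball x r y ->
  (((cst * fine (mu (eball x r)) `^ g)^-1 * \prod_j mun j)%:E <=
    frac_maximal alpha (fun j z => (F j z)%:E) y)%E.
Proof.
move=> r0 nF mun0 hF xy; pose r' := 2 * n.+1%:R * r.
have r'0 : 0 < r' by rewrite !mulr_gt0.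
have sub : eball x r `<=` eball y r'.
  move=> z xz; rewrite /eball/=; apply: le_lt_trans (enorm_le_l1norm _) _.
  apply: (@le_lt_trans _ _ (n%:R * (2 * r))).
    apply: l1norm_le => i; rewrite !mxE.
    have := le_lt_trans (coord_le_enorm _ i) xz; have := le_lt_trans (coord_le_enorm _ i) xy.
    rewrite !mxE => h1 h2.
    have -> : (z : 'rV[R]_n) ord0 i - (y : 'rV[R]_n) ord0 i =
      ((z : 'rV[R]_n) ord0 i - (x : 'rV[R]_n) ord0 i) - ((y : 'rV[R]_n) ord0 i - (x : 'rV[R]_n) ord0 i) by ring.
    apply: le_trans (ler_normB _ _) _; move: h1 h2; lra.
  rewrite /r' mulrA [n%:R * 2]mulrC -!mulrA ltr_pM2l// ltr_pM2r// ltr_nat//.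
have f0 := fine_eball_gt0 x r0; have f0' := fine_eball_gt0 y r'0.
apply: (@le_trans _ _ ((mu (eball y r') `^ (m%:R - alpha / n%:R))^-1 *
    \prod_j \int[mu]_(z in eball y r') `|(F j z)%:E|)%E); last first.
  by apply: ereal_sup_ubound; exists r'.
have -> : ((mu (eball y r') `^ (m%:R - alpha / n%:R))^-1 = ((fine (mu (eball y r')) `^ g)^-1)%:E)%E.
  by rewrite -[in LHS](fineK (lebesgueRn_eball_fin y r'0)) poweR_EFin inver gt_eqF// powR_gt0.
rewrite EFinM; apply: lee_pmul.
- by rewrite lee_fin invr_ge0 mulr_ge0 ?powR_ge0// ltW.
- by rewrite lee_fin prodr_ge0// => j _; exact: ltW.
- rewrite lee_fin lef_pV2 ?posrE ?mulr_gt0 ?powR_gt0//.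
  rewrite /cst -(powRM _ _ (ltW f0)) ?exprn_ge0 ?mulr_ge0 ?exprn_ge0//.
  apply: ge0_ler_powR; rewrite ?nnegrE ?(ltW g0) ?(ltW f0')//.
  apply: le_trans (fine_eball_le y r'0) _.
  have c0 : 0 <= (2 * n.+1%:R ^+ 2) ^+ n :> R by rewrite exprn_ge0// mulr_ge0// exprn_ge0.
  apply: le_trans (ler_wpM2l c0 (fine_eball_ge x r0)).
  rewrite -exprMn le_eqVlt; apply/orP; left; apply/eqP; congr (_ ^+ _).
  by rewrite /r'; field; rewrite nat1r pnatr_eq0.
- rewrite -prodEFin; apply: lee_prod_nonneg => j; first by rewrite lee_fin ltW.
  apply: le_trans (hF j) _.
  have -> : (\int[mu]_(z in eball y r') `|(F j z)%:E| = \int[mu]_(z in eball y r') (F j z)%:E)%E.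
    by apply: eq_integral => z _; rewrite gee0_abs// lee_fin (nnmfun_ge0 z (nF j)).
  have := nnint_subset mu (measurable_eball x r) (measurable_eball y r') (nF j) sub.
  by apply.
Qed.

(** Testing on extremal functions for numbers [mun j] below the norms, instead of the norms
    themselves, makes sense even when these are infinite. [C] may be negative, hence the maximum. *)
Lemma bounded_step C (x : T) r (mun : 'I_m -> R) :
  (forall f, (forall i, wLp (p i) (w i) (f i)) ->
    wnorm q (prod_weight w) (frac_maximal alpha f) <=
    C%:E * \prod_(i < m) wnorm (p i) (w i) (f i))%E ->
  0 < r -> (forall j, 0 < mun j) -> (forall j, (mun j)%:E < L (Some j) (eball x r))%E ->
  (((cst * fine (mu (eball x r)) `^ g)^-1 * \prod_j mun j)%:E * L None (eball x r) <=
    (Num.max C 0)%:E)%E.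
Proof.
move=> hC r0 mun0 hm; set a := _ * \prod_j mun j.
have f0 := fine_eball_gt0 x r0.
have a0 : 0 < a by rewrite mulr_gt0 ?prodr_gt0// invr_gt0 mulr_gt0// powR_gt0.
have [em [ep [em0 e_bnd]]] := apq_exponent_bounds m_gt0 p_exp q_exp pq alpha_range.
have mBfin : (mu (eball x r) < +oo)%E.
  by rewrite -ge0_fin_numE//; exact: lebesgueRn_eball_fin.
have /choice[F hF] : forall j, exists F : T -> R, [/\ nnmfun F,
    (\int[mu]_y ((F y / V j y) `^ p j y)%:E <= 1)%E &
    ((mun j)%:E <= \int[mu]_(y in eball x r) (F y)%:E)%E].
  move=> j; have ee y : p j y / (p j y - 1) <= ep by case/andP: (e_bnd (Some j) y).
  have := dual_witness (mp j) (p1 j) (nV j) (V_gt0 j) ee (measurable_eball x r) mBfin (mun0 j).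
  apply; have eb y : 0 < e (Some j) y by exact: e0.
  apply: (lnorm_gt_modular (e := e (Some j)) (u := V j)) => //; exact: hm.
have nF j : nnmfun (F j) by case: (hF j).
pose f j y := (F j y)%:E.
have mf j : measurable_fun setT (f j) by exact: nnmfun_EFin.
have fN j : (wnorm (p j) (w j) (f j) <= 1)%E.
  apply: ereal_inf_lbound; exists 1 => //; split; first exact: ltr01.
  case: (hF j) => _ + _; apply: le_trans; apply: ae_le_integral => [y|y|].
  - exact: poweR_ge0.
  - by rewrite lee_fin powR_ge0.
  apply: filterS (w_ae j) => y ->; rewrite invr1 mule1 -EFinM gee0_abs; last first.
    by rewrite lee_fin mulr_ge0 ?invr_ge0 ?(ltW (V_gt0 j y))// (nnmfun_ge0 y (nF j)).
  by rewrite poweR_EFin mulrC.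
have N0 j : (0 <= wnorm (p j) (w j) (f j))%E.
  by apply: le_ereal_inf_tmp => _ [l [l0 _] <-]; rewrite lee_fin ltW.
have fL j : wLp (p j) (w j) (f j).
  by split => //; apply: le_lt_trans (fN j) _; rewrite ltry.
have := hC f fL => hb.
have {}hb : (wnorm q (prod_weight w) (frac_maximal alpha f) <= (Num.max C 0)%:E)%E.
  apply: le_trans hb _; rewrite -[leRHS]mule1.
  have P0 : (0 <= \prod_j wnorm (p j) (w j) (f j))%E by exact: prode_ge0.
  apply: (@le_trans _ _ ((Num.max C 0)%:E * \prod_j wnorm (p j) (w j) (f j))%E).
    by apply: lee_wpmul2r => //; rewrite lee_fin le_max lexx.
  apply: lee_wpmul2l; first by rewrite lee_fin le_max lexx orbT.
  have : (0 <= \prod_j wnorm (p j) (w j) (f j) <= 1)%E.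
    elim/big_ind: _ => [|s t /andP[s0 s1] /andP[t0 t1]|j _].
    - by rewrite lexx lee01.
    - by rewrite mule_ge0//= -[leRHS]mule1 lee_pmul.
    - by rewrite N0 fN.
  by case/andP.
apply: le_trans hb; apply: le_ereal_inf_tmp => _ [l [l0 hl] <-].
rewrite -lee_pdivlMl// -EFinM.
apply: ereal_inf_lbound; exists (a^-1 * l) => //.
split; first by rewrite mulr_gt0// invr_gt0.
apply: le_trans hl; rewrite nnint_mkcond; apply: ae_le_integral => [y|y|].
- by rewrite lee_fin mulr_ge0// powR_ge0.
- exact: poweR_ge0.
apply: filterS prod_weight_ae => y ->.
rewrite indicE; case: (boolP (y \in _)) => [/set_mem By|_]; last by rewrite mulr0 poweR_ge0.
have om0 : 0 < om y by exact: (u_gt0 None y).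
have My : (a%:E <= frac_maximal alpha f y)%E.
  by apply: (frac_maximal_ge r0 nF mun0 _ By) => j; case: (hF j).
rewrite mulr1 -poweR_EFin; apply: le_poweR; first exact: ltW (e0 None y).
  have al0 : 0 <= a^-1 * l by rewrite mulr_ge0 ?invr_ge0 ?(ltW a0)// ltW.
  by rewrite lee_fin; apply: divr_ge0 => //; exact: ltW om0.
have M0 : (0 <= frac_maximal alpha f y)%E by apply: le_trans My; rewrite lee_fin ltW.
rewrite abseM !gee0_abs ?lee_fin ?(ltW om0)//=.
apply: (@le_trans _ _ ((om y)%:E * a%:E * (l^-1)%:E)%E).
  rewrite -!EFinM lee_fin le_eqVlt; apply/orP; left; apply/eqP.
  by field; rewrite !gt_eqF.
apply: lee_wpmul2r; first by rewrite lee_fin invr_ge0 ltW.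
by apply: lee_wpmul2l => //; rewrite lee_fin ltW.
Qed.

(** Finiteness is obtained in order: first for the norm with exponent q, from any admissible [mun],
    then for each of the others. Only then can [mun] be half of the norms, whence the factor 2^m. *)
Lemma bounded_Apq : frac_maximal_bounded alpha p q w -> Apq alpha p q w.
Proof.
move=> [C hC].
pose D := Num.max C 0 * cst * 2 ^+ m.
suff term (x : T) r : 0 < r -> (mu (eball x r) `^ (- g) * \prod_k L k (eball x r) <= D%:E)%E.
  apply: (@le_lt_trans _ _ D%:E); last by rewrite ltry.
  by apply: ge_ereal_sup => _ [[x r] /= r0 <-]; rewrite Apq_termE; exact: term.
move=> r0; have f0 := fine_eball_gt0 x r0.
set b := fine (mu (eball x r)) in f0.
have bg0 : 0 < b `^ g by exact: powR_gt0.
have L0 k := apq_lnorm_gt0 k x r0.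
pose nu0 j := if (L (Some j) (eball x r) < +oo)%E then fine (L (Some j) (eball x r)) / 2 else 1.
have nu00 j : 0 < nu0 j.
  rewrite /nu0; case: ifP => // fin; rewrite divr_gt0// -lte_fin fineK ?L0//.
  by rewrite gt0_fin_numE ?L0.
have nu0L j : ((nu0 j)%:E < L (Some j) (eball x r))%E.
  rewrite /nu0; case: ifPn => [fin|]; last by rewrite -leNgt leye_eq => /eqP ->; rewrite ltry.
  have LE : L (Some j) (eball x r) = (fine (L (Some j) (eball x r)))%:E.
    by rewrite fineK// gt0_fin_numE ?L0.
  rewrite [ltRHS]LE lte_fin ltr_pdivrMr// ltr_pMr ?ltr1n// -lte_fin -LE; exact: L0.
have step mun := @bounded_step C x r mun hC r0.
have C0 : 0 <= Num.max C 0 by rewrite le_max lexx orbT.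
have Lfin0 : (L None (eball x r) < +oo)%E.
  rewrite ltey; apply/eqP => Ly; have := step _ nu00 nu0L.
  rewrite Ly gt0_muley ?leye_eq//; last by rewrite lte_fin mulr_gt0 ?prodr_gt0// invr_gt0 mulr_gt0.
have LE0 : L None (eball x r) = (fine (L None (eball x r)))%:E by rewrite fineK// gt0_fin_numE ?L0.
have l00 : 0 < fine (L None (eball x r)) by rewrite -lte_fin -LE0; exact: L0.
set l0 := fine (L None _) in LE0 l00.
have {}step mun : (forall j, 0 < mun j) -> (forall j, (mun j)%:E < L (Some j) (eball x r))%E ->
    (\prod_j mun j) * l0 <= Num.max C 0 * cst * b `^ g.
  move=> h1 h2; have := step _ h1 h2; rewrite LE0 -EFinM lee_fin -/b.
  set P := \prod_j _ => hP.
  have -> : P * l0 = cst * b `^ g * ((cst * b `^ g)^-1 * P * l0).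
    by field; rewrite !gt_eqF.
  by rewrite -[leRHS]mulrA [leRHS]mulrC; apply: ler_wpM2l => //; rewrite mulr_ge0// ltW.
have Lfin j0 : (L (Some j0) (eball x r) < +oo)%E.
  rewrite ltey; apply/eqP => Ly.
  pose P := \prod_(j | j != j0) nu0 j; have P0 : 0 < P by exact: prodr_gt0.
  (* If the j0-th norm were infinite, [t] would be admissible for it, and it makes the left side of
     [step] exceed the right by one. *)
  pose t := (Num.max C 0 * cst * b `^ g + 1) / (P * l0).
  have t0 : 0 < t.
    rewrite divr_gt0 ?mulr_gt0// ltr_wpDl// mulr_ge0 ?(ltW bg0)//.
    by rewrite mulr_ge0// ltW.
  have := step (fun j => if j == j0 then t else nu0 j).
  rewrite (bigD1 j0)//= eqxx (eq_bigr nu0); last by move=> j /negbTE ->.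
  rewrite -/P => h; have : t * P * l0 <= Num.max C 0 * cst * b `^ g.
    by apply: h => j; case: (j =P j0) => [jj|_] //; rewrite jj Ly ltry.
  have -> : t * P * l0 = Num.max C 0 * cst * b `^ g + 1 by rewrite /t; field; rewrite !gt_eqF.
  by rewrite leNgt ltrDl ltr01.
have LE j : L (Some j) (eball x r) = (fine (L (Some j) (eball x r)))%:E.
  exact: (lnormE (Lfin j)).
have := step _ nu00 nu0L; rewrite (eq_bigr (fun j => fine (L (Some j) (eball x r)) / 2)); last first.
  by move=> j _; rewrite /nu0 Lfin.
rewrite big_split/= prodr_const card_ord => h.
rewrite big_option LE0 (eq_bigr _ (fun j _ => LE j)) prodEFin.
rewrite -[in X in (X * _)%E](fineK (lebesgueRn_eball_fin x r0)) poweR_EFin -!EFinM lee_fin -/b.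
rewrite powRN ler_pdivrMl// /D.
set P := \prod_j _ in h *; rewrite mulrA [b `^ g * _]mulrC.
have -> : l0 * P = (P * 2^-1 ^+ m * l0) * 2 ^+ m.
  by rewrite exprVn; field; rewrite expf_neq0.
by rewrite ler_wpM2r// exprn_ge0.
Qed.

End assembly.

Theorem theorem2p2 (R : realType) (n m : nat) (n_gt0 : (0 < n)%N) (m_gt0 : (0 < m)%N)
    (p : 'I_m -> Rn R n -> R) (q : Rn R n -> R) (alpha : R)
    (w : 'I_m -> Rn R n -> \bar R)
    (p_exp : forall i, log_holder (p i) /\ exponentP (p i))
    (q_exp : exponentP0 q)
    (pq : forall x, alpha / n%:R = (harmonic_exponent p x)^-1 - (q x)^-1)
    (alpha_range : 0 <= alpha / n%:R < m%:R)
    (w_weight : forall i, weight (w i)) :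
  frac_maximal_bounded alpha p q w <-> Apq alpha p q w.
Proof.
(* Both conditions depend on the weights only up to null sets, so each 1/w_j may be represented by a
   positive real function. *)
have /choice[V hV] : forall j, exists V : Rn R n -> R, [/\ nnmfun V, forall x, 0 < V x &
    {ae lebesgueRn R n, forall x, w j x = ((V x)^-1)%:E}].
  by move=> j; have [mw w0 _ w_ae] := w_weight j; exact: real_weight.
have nV j : nnmfun (V j) by case: (hV j).
have V0 j x : 0 < V j x by case: (hV j).
have wV j : {ae lebesgueRn R n, forall x, w j x = ((V j x)^-1)%:E} by case: (hV j).
split.
  exact: (bounded_Apq m_gt0 p_exp q_exp pq alpha_range nV V0 wV).
exact: (Apq_bounded n_gt0 m_gt0 p_exp q_exp pq alpha_range nV V0 wV).
Qed.
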